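(* Let $K/k$ be an extension of algebraically closed analytic fields such that $\mathrm{Tr.c}(K/k)=1$, $\mathrm{char}(\widetilde k)>0$ and $|K^\times|\neq 1$. Then any $t\in K$ with $\widehat{k(t)^a}=K$ induces a bijection $\rho_t\colon I_{K/k}\to[0,r_k(t)]$ sending an intermediate algebraically closed analytic field $F$ to $r_F(t)$. The bijection $\rho_t$ is monotonic and respects limits: for $F,F'\in I_{K/k}$ one has $F\subseteq F'$ if and only if $r_F(t)\ge r_{F'}(t)$, and for any non-empty family $\{F_i\}\subset I_{K/k}$ with $F'=\bigcap_i F_i$ and $F''$ the completion of $\bigcup_i F_i$ one has that $r_{F'}(t)=\sup_i r_{F_i}(t)$ and $r_{F''}(t)=\inf_i r_{F_i}(t)$.
   Context: An analytic field is a field complete with respect to a real-valued (rank at most one, possibly trivial) multiplicative non-archimedean absolute value $|\ |$; $\widetilde k$ denotes the residue field of $k$, and $|K^\times|\ne 1$ means that $K$ is non-trivially valued. An extension of analytic fields is a field extension in which the absolute value of the larger field restricts to that of the smaller one. For a valued field $K$, $K^a$ denotes an algebraic closure with the extended absolute value, and $\widehat{\ \cdot\ }$ denotes completion. For an extension $K/k$ of analytic fields and a subset $S\subset K$, $\widehat{k(S)^a}$ denotes the closure in $\widehat{K^a}$ of the algebraic closure of $k(S)$. A set $S\subset K$ is t.a. (topologically-algebraically) generating for $K/k$ if $\widehat{K^a}=\widehat{k(S)^a}$. The topological generating degree $\mathrm{Tr.c}(K/k)$ is the minimum of the cardinalities of t.a. generating sets of $K/k$. For an extension $K/k$ of algebraically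 closed analytic fields, $I_{K/k}$ denotes the set of all analytic (i.e. complete) algebraically closed intermediate fields $k\subseteq F\subseteq K$; when $\mathrm{Tr.c}(K/k)=1$ it is known to be totally ordered by inclusion. For $F\in I_{K/k}$ and $x\in K$, $r_F(x)=\inf_{c\in F}|x-c|$. *)

(* Defs.v *)
From HB Require Import structures.
From mathcomp Require Import all_boot all_order all_algebra.
From mathcomp Require Import all_classical all_reals all_analysis.
Set Implicit Arguments.
Unset Strict Implicit.
Unset Printing Implicit Defensive.
Import Order.TTheory GRing.Theory Num.Theory.
Local Open Scope classical_set_scope.
Local Open Scope card_scope.
Local Open Scope ring_scope.

(* MathComp's normedZmodType cannot be used here: its norm satisfies
   `|x *+ n| = `|x| *+ n, which is incompatible with the ultrametric
   inequality. *)
HB.mixin Record isNonArchAbs (R : realType) K & GRing.Field K := {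
  absv : K -> R ;
  absv_ge0 : forall x : K, 0 <= absv x ;
  absv_eq0 : forall x : K, (absv x == 0) = (x == 0) ;
  absvM : forall x y : K, absv (x * y) = absv x * absv y ;
  absvD : forall x y : K, absv (x + y) <= Num.max (absv x) (absv y)
}.

#[short(type="valuedFieldType")]
HB.structure Definition ValuedField (R : realType) :=
  {K of GRing.Field K & isNonArchAbs R K}.

Section ValuedFieldTheory.
Variables (R : realType) (K : valuedFieldType R).
Implicit Types x y : K.

Definition value_group : set R := absv @` [set x : K | x != 0].

Lemma absv0 : absv (0 : K) = 0.
Proof. by apply/eqP; rewrite absv_eq0. Qed.

Lemma absv1 : absv (1 : K) = 1.
Proof.
have n0 : absv (1 : K) != 0 by rewrite absv_eq0 oner_eq0.
by apply: (mulfI n0); rewrite -absvM !mulr1.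
Qed.

Lemma absvN x : absv (- x) = absv x.
Proof.
suff N1 : absv (-1 : K) = 1 by rewrite -mulN1r absvM N1 mul1r.
apply/eqP; rewrite -(@eqrXn2 _ 2) ?absv_ge0 ?ler01//.
by rewrite expr2 -absvM mulrNN mulr1 absv1 expr1n.
Qed.

Lemma absvB x y : absv (x - y) = absv (y - x).
Proof. by rewrite -absvN opprB. Qed.

Lemma absv_triangle x y z : absv (y - z) <= absv (y - x) + absv (x - z).
Proof.
have -> : y - z = (y - x) + (x - z) by rewrite addrA subrK.
apply: le_trans (absvD _ _) _.
by rewrite ge_max lerDl lerDr !absv_ge0.
Qed.

Lemma absv_dist_eq0 x y : absv (x - y) = 0 -> x = y.
Proof. by move/eqP; rewrite absv_eq0 subr_eq0 => /eqP. Qed.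

Lemma absv_distxx x : absv (x - x) = 0.
Proof. by rewrite subrr absv0. Qed.

(* K with the metric |x - y|.  This is an alias because the library's join of
   zmodType and pseudoMetricType is pseudoMetricNormedZmodType, which is
   excluded for the reason given above. *)
Definition absv_space : Type := K.
HB.instance Definition _ := Choice.on absv_space.
HB.instance Definition _ := isMetric.Build R absv_space
  absv_distxx absv_dist_eq0 absvB absv_triangle.

(* For A a subfield of a complete K, the completion of A. *)
Definition completion_in (A : set K) : set K :=
  closure (A : set absv_space).

(* Completeness for the restricted absolute value: every Cauchy filter
   concentrated on F converges in F. *)
Definition is_complete (F : set K) : Prop :=
  forall G : set_system absv_space, ProperFilter G -> G F -> cauchy G ->
    exists2 x : absv_space, F x & G --> x.

Definition integer_pred : pred K := fun x => absv x <= 1.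

Lemma integer_subring : subring_closed integer_pred.
Proof.
split=> [|x y|x y]; rewrite !unfold_in /integer_pred.
- by rewrite absv1.
- move=> x1 y1; apply: le_trans (absvD _ _) _.
  by rewrite absvN ge_max x1.
- by move=> x1 y1; rewrite absvM mulr_ile1 ?absv_ge0.
Qed.

HB.instance Definition _ :=
  GRing.isSubringClosed.Build K integer_pred integer_subring.

Record integers := Integer { integer_val : K; _ : integer_pred integer_val }.

HB.instance Definition _ := [isSub for integer_val].
HB.instance Definition _ := [Choice of integers by <:].
HB.instance Definition _ :=
  [SubChoice_isSubComNzRing of integers by <:].

Definition max_ideal : pred integers :=
  fun x : integers => absv (integer_val x) < 1.

Lemma max_idealr : idealr_closed max_ideal.
Proof.
have valE (x : integers) : integer_val x = val x by [].
split=> [||a x y]; rewrite !unfold_in /max_ideal !valE.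
- by rewrite rmorph0 absv0 ltr01.
- by rewrite rmorph1 absv1 ltxx.
- move=> x1 y1; rewrite rmorphD rmorphM.
  apply: le_lt_trans (absvD _ _) _; rewrite gt_max y1 andbT absvM.
  apply: le_lt_trans x1; rewrite ler_piMl ?absv_ge0//.
  exact: (valP a).
Qed.

HB.instance Definition _ := isIdealr.Build integers max_ideal max_idealr.

Definition max_idealI : idealr integers := max_ideal.
Definition residue_field := {ideal_quot max_idealI}.
HB.instance Definition _ := GRing.ComNzRing.on residue_field.

(* r_F(x) *)
Definition dist_to (F : set K) (x : K) : R :=
  inf [set absv (x - c) | c in F].

Definition is_subfield (F : set K) : Prop := divring_closed (mem F).

Definition is_alg_closed (F : set K) : Prop :=
  forall p : {poly K}, p \is a polyOver (mem F) -> size p != 1%N ->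
    exists2 x, F x & root p x.

Definition alg_closure_in (L : set K) : set K :=
  [set x | exists p : {poly K},
     [/\ p != 0, p \is a polyOver (mem L) & root p x]].

End ValuedFieldTheory.
Arguments value_group {R} K.
Arguments residue_field {R} K.

HB.mixin Record isComplete (R : realType) K & ValuedField R K := {
  absv_complete : is_complete [set: K]
}.

#[short(type="analyticFieldType")]
HB.structure Definition AnalyticField (R : realType) :=
  {K of ValuedField R K & isComplete R K}.

#[short(type="closedAnalyticFieldType")]
HB.structure Definition ClosedAnalyticField (R : realType) :=
  {K of GRing.ClosedField K & AnalyticField R K}.

Section Extension.
Variables (R : realType) (k K : closedAnalyticFieldType R).
Variable iota : {rmorphism k -> K}.

Definition isometric : Prop := forall x, absv (iota x) = absv x.

(* k(S) *)
Definition adjoin (S : set K) : set K :=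
  smallest (@is_subfield R K) (range iota `|` S).

(* As K is algebraically closed and complete, it is its own completed
   algebraic closure: the closures defining \widehat{k(S)^a} are taken in K. *)
Definition completed_closure (S : set K) : set K :=
  completion_in (alg_closure_in (adjoin S)).

Definition ta_generating (S : set K) : Prop :=
  completed_closure S = [set: K].

(* Tr.c(K/k) is the cardinality of A *)
Definition trc_is (T : Type) (A : set T) : Prop :=
  (exists2 S, ta_generating S & S #= A) /\
  (forall S, ta_generating S -> A #<= S).

Definition intermediate : set (set K) :=
  [set F | [/\ is_subfield F, range iota `<=` F,
               is_alg_closed F & is_complete F]].

End Extension.

(* Main.v *)
Require Import Defs.
From HB Require Import structures.
From mathcomp Require Import all_boot all_order all_algebra.
From mathcomp Require Import all_classical all_reals all_analysis.
From mathcomp Require Import zify ring lra.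
Set Implicit Arguments.
Unset Strict Implicit.
Unset Printing Implicit Defensive.
Import Order.TTheory GRing.Theory Num.Theory.
Local Open Scope classical_set_scope.
Local Open Scope ring_scope.

(* Order: if [r_F'(t) <= r_F(t)] then [F'] has points [a'] such that each of
   finitely many polynomials over [F] has nearly the same absolute value at [a']
   and at [t].  For [c] in [F] close to an element algebraic over [k(t)], given
   by [P(t, Z)], the Newton polygons of [P(t, c + Z)] and [P(a', c + Z)] are
   thus nearly equal, so [c] is close to [F'].

   Surjectivity: the union of the [F] with [r_F(t) >= s] is the only candidate,
   and it remains to see that for [s < r_F(t)] some [F'] has
   [s <= r_F'(t) < r_F(t)].  Start from [x_0 = t] and, for a large power [q] of
   the residue characteristic, replace [x] by [x' = c + u^q], where
   [x - c = u^q - eta u^a].  As [q]-th powers contract distances, an element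
   [w] near [x] yields an element near [x'] of controlled degree over [F(w)];
   as [1, u, ..., u^(q-1)] are orthogonal over [F(u^q)], no element of degree
   less than [q] over [F(x')] is near [x].  Hence the least degree over [F(x_n)]
   of an element within [s] of [t] tends to infinity; for [x_n] converging fast
   to [y], no element algebraic over [F(y)] is within [s] of [t].  When [F] is
   trivially valued, no small [eta] exists and the exponent [a] is used
   instead. *)

(** * Gauss norms and roots *)

(** Surjectivity is the hard part: adjoining a point close to [t] could bring in points arbitrarily
    close to [t], and the radius would jump below [s]. A single step excludes only elements of
    bounded degree, whence the infinite sequence; the error bounds of [perturb_degree] depend on the
    degree but not on the points, so they can be fixed before the sequence is built. The shift
    [x' - x = eta u^a] is larger than the radius around [x] to be avoided: for [w] within that
    radius, [(x' - w) / eta] differs from [u^a] by less than [|u|^a], and this is what orthogonality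
    rules out in degree below [q]. That [p] does not divide [a] is used twice: the exponents
    [q l + a j] with [j < q] are distinct, and the derivative of [Z^q - eta Z^a] at [u] is dominated
    by its second term, so nearby values can be lifted. The comparison of radii moves [t] by
    elements of [F'] of prescribed size, which exist only if [F'] is nontrivially valued; over a
    trivially valued [k] the values and residues of [K] are described instead. *)

Section Ultrametric.
Context {R : realType} {K : valuedFieldType R}.
Implicit Types (x y z : K) (B : R).

Lemma absvX x n : absv (x ^+ n) = absv x ^+ n.
Proof. by elim: n => [|n IH]; rewrite ?expr0 ?absv1// !exprS absvM IH. Qed.

Lemma absv_gt0 x : (0 < absv x) = (x != 0).
Proof. by rewrite lt_neqAle absv_ge0 andbT eq_sym absv_eq0. Qed.

Lemma absvV x : absv x^-1 = (absv x)^-1.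
Proof.
have [->|x0] := eqVneq x 0; first by rewrite invr0 absv0 invr0.
have ax0 : absv x != 0 by rewrite absv_eq0.
by apply: (mulIf ax0); rewrite -absvM !mulVf// absv1.
Qed.

Lemma absvD_le x y B : absv x <= B -> absv y <= B -> absv (x + y) <= B.
Proof. by move=> xB yB; apply: le_trans (absvD _ _) _; rewrite ge_max xB. Qed.

Lemma absvD_lt x y B : absv x < B -> absv y < B -> absv (x + y) < B.
Proof. by move=> xB yB; apply: le_lt_trans (absvD _ _) _; rewrite gt_max xB. Qed.

Lemma absv_dist_le x y z B :
  absv (x - y) <= B -> absv (y - z) <= B -> absv (x - z) <= B.
Proof.
move=> xy yz; have -> : x - z = (x - y) + (y - z) by ring.
exact: absvD_le.
Qed.

Lemma absv_dist_lt x y z B :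
  absv (x - y) < B -> absv (y - z) < B -> absv (x - z) < B.
Proof.
move=> xy yz; have -> : x - z = (x - y) + (y - z) by ring.
exact: absvD_lt.
Qed.

Lemma absv_sum_le (I : Type) (s : seq I) (P : pred I) (f : I -> K) B :
  0 <= B -> (forall i, P i -> absv (f i) <= B) ->
  absv (\sum_(i <- s | P i) f i) <= B.
Proof.
move=> B0 fB; elim/big_ind: _ => [|x y|//]; first by rewrite absv0.
exact: absvD_le.
Qed.

Lemma absv_sum_lt (I : Type) (s : seq I) (P : pred I) (f : I -> K) B :
  0 < B -> (forall i, P i -> absv (f i) < B) ->
  absv (\sum_(i <- s | P i) f i) < B.
Proof.
move=> B0 fB; elim/big_ind: _ => [|x y|//]; first by rewrite absv0.
exact: absvD_lt.
Qed.

Lemma absvDl x y : absv y < absv x -> absv (x + y) = absv x.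
Proof.
move=> yx; apply/eqP; rewrite eq_le absvD_le//=; last exact: ltW.
rewrite leNgt; apply/negP => xyx.
have : absv ((x + y) - y) < absv x by apply: absvD_lt; rewrite ?absvN.
by rewrite addrK ltxx.
Qed.

Lemma absvDr x y : absv x < absv y -> absv (x + y) = absv y.
Proof. by rewrite addrC; exact: absvDl. Qed.

Lemma absv_natr n : absv (n%:R : K) <= 1.
Proof.
elim: n => [|n IH]; first by rewrite absv0 ler01.
by rewrite -natr1 absvD_le// absv1.
Qed.

Lemma absvBXX x y B n : absv x <= B -> absv y <= B ->
  absv (x ^+ n - y ^+ n) <= absv (x - y) * B ^+ n.-1.
Proof.
move=> xB yB; have B0 : 0 <= B by apply: le_trans xB; exact: absv_ge0.
rewrite subrXX absvM ler_wpM2l ?absv_ge0//.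
apply: absv_sum_le => [|i _]; first exact: exprn_ge0.
have iN : (i <= n.-1)%N by case: n i => [|n] [].
rewrite absvM !absvX -[X in _ <= B ^+ X](subnK iN) exprD.
by apply: ler_pM; rewrite ?exprn_ge0 ?absv_ge0//;
  apply: lerXn2r; rewrite ?nnegrE ?absv_ge0.
Qed.

End Ultrametric.

Section GaussNorm.
Context {R : realType} {K : valuedFieldType R}.
Implicit Types (f g : {poly K}) (S B C : R).

(* The Gauss norm of [f] on the disc of radius [S] is at most [B]. *)
Definition gauss_le S B f := forall i, absv f`_i * S ^+ i <= B.

Lemma gauss_leW S B C f : B <= C -> gauss_le S B f -> gauss_le S C f.
Proof. by move=> BC fB i; exact: le_trans (fB i) BC. Qed.

Lemma gauss_le0 S B : 0 <= B -> gauss_le S B 0.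
Proof. by move=> B0 i; rewrite coef0 absv0 mul0r. Qed.

Lemma gauss_leD S B f g : 0 <= S -> gauss_le S B f -> gauss_le S B g ->
  gauss_le S B (f + g).
Proof.
move=> S0 fB gB i; rewrite coefD.
apply: le_trans (ler_wpM2r (exprn_ge0 i S0) (absvD _ _)) _.
by rewrite maxr_pMl ?exprn_ge0// ge_max fB gB.
Qed.

Lemma gauss_le_sum S B (I : Type) (s : seq I) (P : pred I) (f : I -> {poly K}) :
  0 <= S -> 0 <= B -> (forall i, P i -> gauss_le S B (f i)) ->
  gauss_le S B (\sum_(i <- s | P i) f i).
Proof.
move=> S0 B0 fB; elim/big_ind: _ => // [|x y]; first exact: gauss_le0.
exact: gauss_leD.
Qed.

Lemma gauss_leM S B C f g : 0 <= S -> 0 <= B -> 0 <= C ->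
  gauss_le S B f -> gauss_le S C g -> gauss_le S (B * C) (f * g).
Proof.
move=> S0 B0 C0 fB gC i; rewrite coefM.
have [->|Si0] := eqVneq (S ^+ i) 0; first by rewrite mulr0 mulr_ge0.
have Sgt : 0 < S ^+ i by rewrite lt_neqAle eq_sym Si0 exprn_ge0.
rewrite -ler_pdivlMr//; apply: absv_sum_le => [|j _].
  by rewrite divr_ge0 ?mulr_ge0 ?exprn_ge0.
have ji : (j <= i)%N by rewrite -ltnS.
rewrite ler_pdivlMr// absvM -[X in S ^+ X](subnKC ji).
by rewrite exprD mulrACA ler_pM ?fB ?gC ?mulr_ge0 ?absv_ge0 ?exprn_ge0.
Qed.

Lemma gauss_leXn S B f n : 0 <= S -> 0 <= B -> gauss_le S B f ->
  gauss_le S (B ^+ n) (f ^+ n).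
Proof.
move=> S0 B0 fB; elim: n => [|n IH].
  move=> i; rewrite !expr0 coef1.
  by case: i => [|i] /=; rewrite ?absv1 ?absv0 ?mul0r ?mulr1 ?expr0.
by rewrite !exprS; apply: gauss_leM => //; exact: exprn_ge0.
Qed.

Lemma gauss_leC S B c : 0 <= B -> absv c <= B -> gauss_le S B c%:P.
Proof.
move=> B0 cB i; rewrite coefC; case: eqP => [->|_]; first by rewrite mulr1.
by rewrite absv0 mul0r.
Qed.

Lemma gauss_leXm S n : 0 <= S -> gauss_le S (S ^+ n) 'X^n.
Proof.
move=> S0 i; rewrite coefXn; case: eqP => [->|_]; first by rewrite absv1 mul1r.
by rewrite absv0 mul0r exprn_ge0.
Qed.

End GaussNorm.

Section GaussRoots.
Context {R : realType} {K : closedAnalyticFieldType R}.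

Lemma seq_argmin (s : seq K) (f : K -> R) x0 : exists2 b, b \in x0 :: s &
  forall c, c \in x0 :: s -> f b <= f c.
Proof.
elim: s x0 => [|y s IH] x0.
  by exists x0; rewrite ?mem_head// => c; rewrite inE => /eqP->.
have [b bs bm] := IH y; have [h|h] := leP (f x0) (f b).
  exists x0; first exact: mem_head.
  by move=> c; rewrite inE => /orP[/eqP->//|/bm]; exact: le_trans.
exists b; first by rewrite inE bs orbT.
by move=> c; rewrite inE => /orP[/eqP->|/bm//]; exact: ltW.
Qed.

(** Each linear factor [X - c] has Gauss norm [max(S, |c|)] and value of size [|u - c|] at [u]; the
    factors are compared one by one. With [u = 0] and [A = 1] it bounds every coefficient by the
    constant one when no root is smaller than [S]. *)
Lemma gauss_le_roots (g : {poly K}) (S A : R) (u : K) : 0 <= S -> 1 <= A ->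
  (forall c, root g c -> Num.max S (absv c) <= A * absv (u - c)) ->
  gauss_le S (A ^+ (size g).-1 * absv g.[u]) g.
Proof.
move=> S0 A1 rootA; have A0 : 0 <= A by exact: le_trans A1.
have [->|g0] := eqVneq g 0.
  by apply: gauss_le0; rewrite mulr_ge0 ?exprn_ge0 ?absv_ge0.
have [s gE] := closed_field_poly_normal g.
have l0 : lead_coef g != 0 by rewrite lead_coef_eq0.
have rs c : c \in s -> Num.max S (absv c) <= A * absv (u - c).
  move=> cs; apply: rootA; rewrite gE rootE hornerZ horner_prod.
  by rewrite (big_rem c)//= hornerXsubC subrr mul0r mulr0.
have sz : (size g).-1 = size s.
  by rewrite gE size_scale// size_prod_XsubC.
rewrite sz gE {g0 rootA gE sz} hornerZ absvM -mul_polyC mulrCA.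
apply: gauss_leM => //; rewrite ?absv_ge0 ?mulr_ge0 ?exprn_ge0 ?absv_ge0//.
  by apply: gauss_leC; rewrite ?absv_ge0.
elim: s rs => [|c s IH] rs.
  rewrite big_nil hornerC absv1 mulr1; apply: gauss_leC => //.
  by rewrite absv1.
rewrite big_cons hornerM absvM exprS mulrACA; apply: gauss_leM => //.
- by rewrite mulr_ge0 ?absv_ge0.
- by rewrite mulr_ge0 ?exprn_ge0 ?absv_ge0.
- rewrite hornerXsubC; apply: gauss_leW (rs c (mem_head _ _)) _ => i.
  rewrite coefD coefX coefN coefC; case: i => [|[|i]] /=.
  + by rewrite sub0r absvN mulr1 le_max lexx orbT.
  + by rewrite subr0 absv1 mul1r le_max lexx.
  + by rewrite subrr absv0 mul0r le_max S0.
- by apply: IH => d ds; apply: rs; rewrite inE ds orbT.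
Qed.

(** Otherwise every root has absolute value at least some [S > |g_0| / |g_1|], and [gauss_le_roots]
    at 0 gives [|g_1| S <= |g_0|]. This plays the role of Hensel's lemma. *)
Lemma small_root (g : {poly K}) : g`_1 != 0 ->
  exists2 h, root g h & absv h * absv g`_1 <= absv g`_0.
Proof.
move=> g1; apply: contrapT => noroot.
have [s gE] := closed_field_poly_normal g.
have g1' : 0 < absv g`_1 by rewrite absv_gt0.
have far h : root g h -> absv g`_0 < absv h * absv g`_1.
  by move=> gh; rewrite ltNge; apply/negP => hh; apply: noroot; exists h.
have rootE' h : root g h = (h \in s).
  rewrite gE rootZ ?lead_coef_eq0; last by apply: contraNneq g1 => ->; rewrite coef0.
  exact: root_prod_XsubC.
have [S [S0 Sg gS]] : exists S, [/\ 0 <= S, absv g`_0 < S * absv g`_1 &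
    forall h, root g h -> S <= absv h].
  case: s {gE} rootE' => [|c s] rs.
    (* Without roots, any radius above the bound will do. *)
    exists ((absv g`_0 + 1) / absv g`_1); split; last by move=> h; rewrite rs.
      by rewrite divr_ge0 ?addr_ge0 ?absv_ge0.
    by rewrite divfK ?gt_eqF// ltrDl.
  have [d ds dm] := seq_argmin s absv c.
  exists (absv d); split; rewrite ?absv_ge0//; first by apply: far; rewrite rs.
  by move=> h; rewrite rs; exact: dm.
have := @gauss_le_roots g S 1 0 S0 (lexx 1) _ 1%N.
rewrite expr1n !mul1r horner_coef0 expr1 mulrC leNgt Sg => /(_ _)/negP; apply=> //.
by move=> c /gS Sc; rewrite mul1r sub0r absvN ge_max Sc lexx.
Qed.

End GaussRoots.

(** * Subfields and degrees *)

Section SubfieldType.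
Context {R : realType} {K : closedAnalyticFieldType R}.
Variables (F : set K) (HF : is_subfield F).

(** The [let] makes the predicate depend on [HF], so that the closure proof can be attached to it as
    an instance. *)
Definition subfield_pred : {pred K} := let _ := HF in mem F.
HB.instance Definition _ := GRing.isDivringClosed.Build K subfield_pred HF.

Record subfield_type :=
  Subfield { subfield_val : K; _ : subfield_pred subfield_val }.
HB.instance Definition _ := [isSub for subfield_val].
HB.instance Definition _ := [Choice of subfield_type by <:].
HB.instance Definition _ :=
  [SubChoice_isSubComUnitRing of subfield_type by <:].
HB.instance Definition _ :=
  [SubComUnitRing_isSubIntegralDomain of subfield_type by <:].
HB.instance Definition _ :=
  [SubIntegralDomain_isSubField of subfield_type by <:].

Lemma subfield_predP x : reflect (F x) (x \in subfield_pred).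
Proof. by apply: (iffP idP) => [/set_mem|/mem_set]. Qed.

Lemma subfield_valP (x : subfield_type) : F (val x).
Proof. by apply/subfield_predP; exact: (valP x). Qed.

Lemma subfield0 : F 0. Proof. by apply/subfield_predP; exact: rpred0. Qed.
Lemma subfield1 : F 1. Proof. by apply/subfield_predP; exact: rpred1. Qed.

Lemma subfieldD x y : F x -> F y -> F (x + y).
Proof. by move=> /subfield_predP ? /subfield_predP ?; apply/subfield_predP/rpredD. Qed.

Lemma subfieldN x : F x -> F (- x).
Proof. by move=> /subfield_predP ?; apply/subfield_predP; rewrite rpredN. Qed.

Lemma subfieldB x y : F x -> F y -> F (x - y).
Proof. by move=> Fx Fy; apply: subfieldD => //; exact: subfieldN. Qed.

Lemma subfieldM x y : F x -> F y -> F (x * y).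
Proof. by move=> /subfield_predP ? /subfield_predP ?; apply/subfield_predP/rpredM. Qed.

Lemma subfieldV x : F x -> F x^-1.
Proof. by move=> /subfield_predP ?; apply/subfield_predP; rewrite rpredV. Qed.

Lemma subfieldX x n : F x -> F (x ^+ n).
Proof. by move=> /subfield_predP ?; apply/subfield_predP/rpredX. Qed.

Lemma subfield_overE (p : {poly K}) :
  (p \is a polyOver (mem F)) = (p \is a polyOver subfield_pred).
Proof. by []. Qed.

Lemma overP (p : {poly K}) : p \is a polyOver (mem F) <-> forall i, F p`_i.
Proof.
rewrite subfield_overE; split=> [/polyOverP op i|op].
  by apply/subfield_predP; exact: op.
by apply/polyOverP => i; apply/subfield_predP; exact: op.
Qed.

Lemma over_coef (p : {poly K}) i : p \is a polyOver (mem F) -> F p`_i.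
Proof. by move=> /overP; apply. Qed.

Lemma overC c : F c -> c%:P \is a polyOver (mem F).
Proof. by move=> Fc; rewrite subfield_overE polyOverC; exact/subfield_predP. Qed.

Lemma overX : 'X \is a polyOver (mem F).
Proof. by rewrite subfield_overE polyOverX. Qed.

Lemma overD (p q : {poly K}) : p \is a polyOver (mem F) ->
  q \is a polyOver (mem F) -> p + q \is a polyOver (mem F).
Proof. by rewrite !subfield_overE; exact: rpredD. Qed.

Lemma overN (p : {poly K}) : p \is a polyOver (mem F) ->
  - p \is a polyOver (mem F).
Proof. by rewrite !subfield_overE rpredN. Qed.

Lemma overM (p q : {poly K}) : p \is a polyOver (mem F) ->
  q \is a polyOver (mem F) -> p * q \is a polyOver (mem F).
Proof. by rewrite !subfield_overE; exact: rpredM. Qed.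

Lemma overZ c (p : {poly K}) : F c -> p \is a polyOver (mem F) ->
  c *: p \is a polyOver (mem F).
Proof. by move=> Fc op; rewrite -mul_polyC overM// overC. Qed.

Lemma overXn (p : {poly K}) n : p \is a polyOver (mem F) ->
  p ^+ n \is a polyOver (mem F).
Proof. by rewrite !subfield_overE; exact: rpredX. Qed.

Lemma over_sum (I : Type) (s : seq I) (P : pred I) (f : I -> {poly K}) :
  (forall i, P i -> f i \is a polyOver (mem F)) ->
  \sum_(i <- s | P i) f i \is a polyOver (mem F).
Proof. by move=> fF; rewrite subfield_overE; apply: rpred_sum => i /fF. Qed.

Lemma over_prod (I : Type) (s : seq I) (P : pred I) (f : I -> {poly K}) :
  (forall i, P i -> f i \is a polyOver (mem F)) ->
  \prod_(i <- s | P i) f i \is a polyOver (mem F).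
Proof. by move=> fF; rewrite subfield_overE; apply: rpred_prod => i /fF. Qed.

Lemma over_comp (p q : {poly K}) : p \is a polyOver (mem F) ->
  q \is a polyOver (mem F) -> p \Po q \is a polyOver (mem F).
Proof. by rewrite !subfield_overE; exact: polyOver_comp. Qed.

Lemma over_horner (p : {poly K}) x : p \is a polyOver (mem F) -> F x -> F p.[x].
Proof.
rewrite subfield_overE => op /subfield_predP Fx.
by apply/subfield_predP; exact: rpred_horner.
Qed.

Lemma over_map (p : {poly subfield_type}) :
  map_poly val p \is a polyOver (mem F).
Proof. by apply/overP => i; rewrite coef_map; exact: subfield_valP. Qed.

Lemma over_lift (p : {poly K}) : p \is a polyOver (mem F) ->
  exists q : {poly subfield_type}, p = map_poly val q.
Proof.
move=> op; exists (\poly_(i < size p) insubd (0 : subfield_type) p`_i).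
apply/polyP => i; rewrite coef_map coef_poly /=.
case: ltnP => [_|/leq_sizeP/(_ i (leqnn _))->//].
by rewrite val_insubd; case: ifP => // /negP[]; apply/subfield_predP/over_coef.
Qed.

End SubfieldType.

(** With [n = deg f], the [n + 1] remainders of [1, g, ..., g^n] modulo [f] live in a space of
    dimension [n]; the coefficients of a linear relation between them form [q]. *)
Lemma dvdp_comp_exists (L : fieldType) (f g : {poly L}) : f != 0 ->
  exists q : {poly L}, [/\ q != 0, (size q <= size f)%N & f %| q \Po g].
Proof.
move=> f0; pose n := (size f).-1.
have szf : size f = n.+1 by rewrite /n prednK// size_poly_gt0.
pose M := \matrix_(i < n.+1) (poly_rV ((g ^+ i) %% f) : 'rV_n).
have kM : kermx M != 0.
  apply/eqP => k0; have := mxrank_ker M; rewrite k0 mxrank0 => /esym/eqP.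
  by rewrite subn_eq0 leqNgt ltnS rank_leq_col.
have [a a0 aM] : exists2 a : 'rV_n.+1, a != 0 & a *m M = 0.
  exists (nz_row (kermx M)); first by rewrite nz_row_eq0.
  by apply/sub_kermxP; exact: nz_row_sub.
exists (rVpoly a); split.
- by apply: contraNneq a0 => q0; rewrite -(rVpolyK a) q0 linear0.
- by rewrite szf size_poly.
rewrite /dvdp comp_polyE; apply/eqP.
have -> : \sum_(i < size (rVpoly a)) (rVpoly a)`_i *: g ^+ i =
          \sum_(i < n.+1) a 0 i *: g ^+ i.
  rewrite (big_ord_widen_cond n.+1 xpredT (fun i => (rVpoly a)`_i *: g ^+ i)).
    rewrite big_mkcond; apply: eq_bigr => i _ /=.
    rewrite coef_rVpoly_ord; case: ltnP => // /leq_sizeP/(_ i (leqnn _)).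
    by rewrite coef_rVpoly_ord => ->; rewrite scale0r.
  exact: size_poly.
rewrite (big_morph _ (fun p q => modpD f p q) (mod0p f)).
transitivity (rVpoly (a *m M)); last by rewrite aM linear0.
rewrite mulmx_sum_row linear_sum; apply: eq_bigr => i _.
rewrite linearZ /= rowK poly_rV_K ?modpZl//.
by have := ltn_modp (g ^+ i) f; rewrite f0 szf ltnS.
Qed.

Section Degree.
Context {R : realType} {K : closedAnalyticFieldType R}.
Implicit Types (F E : set K) (N : nat).

Definition degree_le E N (w : K) := exists p : {poly K},
  [/\ p != 0, p \is a polyOver (mem E), (size p <= N.+1)%N & root p w].

Lemma over_sub E F (p : {poly K}) : E `<=` F ->
  p \is a polyOver (mem E) -> p \is a polyOver (mem F).
Proof.
by move=> EF; apply: polyOverS => x /set_mem/EF/mem_set.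
Qed.

Lemma degree_leS E F M N w : E `<=` F -> (M <= N)%N ->
  degree_le E M w -> degree_le F N w.
Proof.
move=> EF MN [p [p0 pE sp pw]]; exists p; split=> //; first exact: over_sub pE.
exact: leq_trans sp _.
Qed.

Lemma degree_le_comp E N D (h : {poly K}) v : is_subfield E ->
  h \is a polyOver (mem E) -> (size h <= D.+1)%N -> (1 < size h)%N ->
  degree_le E N h.[v] -> degree_le E (N * D) v.
Proof.
move=> HE oh sh h1 [p [p0 op sp pv]]; exists (p \Po h); split.
- by rewrite comp_poly_eq0.
- exact: over_comp.
- apply: leq_trans (leqSpred _) _; rewrite size_comp_poly ltnS leq_mul//.
    by rewrite -ltnS (leq_trans _ sp)// ltn_predL size_poly_gt0.
  by rewrite -ltnS prednK// ltnW.
- by rewrite rootE horner_comp.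
Qed.

(** If [f] kills [v] and divides [q(g)], then [q] kills [g.[v]]. The relation is found over
    [subfield_type HE], which keeps the coefficients of [q] in [E]. *)
Lemma degree_le_horner E N (g : {poly K}) v : is_subfield E ->
  g \is a polyOver (mem E) -> degree_le E N v -> degree_le E N g.[v].
Proof.
move=> HE og [f [f0 oF sf fv]].
have [f' fE] := over_lift HE oF; have [g' gE] := over_lift HE og.
have f'0 : f' != 0 by move: f0; rewrite fE map_poly_eq0.
have [q [q0 sq dv]] := dvdp_comp_exists g' f'0.
exists (map_poly val q); split.
- by rewrite map_poly_eq0.
- exact: over_map.
- by rewrite size_map_poly (leq_trans sq)// (leq_trans _ sf)// fE size_map_poly.
- rewrite gE rootE -horner_comp -map_comp_poly -rootE.
  by apply: (@root_dvdp _ (map_poly val f')); rewrite ?dvdp_map// -fE.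
Qed.

End Degree.

Section Adjoin.
Context {R : realType} {K : closedAnalyticFieldType R}.
Implicit Types (F E : set K) (P : {poly {poly K}}) (x y w : K).

Lemma is_subfield_bigcap (I : Type) (D : set I) (F : I -> set K) :
  (forall i, D i -> is_subfield (F i)) -> is_subfield (\bigcap_(i in D) F i).
Proof.
move=> HF; split=> [|x y /set_mem Fx /set_mem Fy|x y /set_mem Fx /set_mem Fy];
  apply/mem_set => i Di.
- exact: subfield1 (HF i Di).
- exact: subfieldB (HF i Di) _ _ (Fx i Di) (Fy i Di).
- exact: (subfieldM (HF i Di) (Fx i Di) (subfieldV (HF i Di) (Fy i Di))).
Qed.

Definition adjoin_elt F y := smallest (@is_subfield R K) (F `|` [set y]).

Lemma is_subfield_adjoin F y : is_subfield (adjoin_elt F y).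
Proof. by apply: is_subfield_bigcap => A [] . Qed.

Lemma sub_adjoin F y : F `<=` adjoin_elt F y.
Proof. by move=> x Fx; apply: sub_gen_smallest; left. Qed.

Lemma mem_adjoin F y : adjoin_elt F y y.
Proof. by apply: sub_gen_smallest; right. Qed.

Lemma adjoin_min F E y : is_subfield E -> F `<=` E -> E y ->
  adjoin_elt F y `<=` E.
Proof. by move=> HE FE Ey; apply: smallest_sub => // x [/FE|->]. Qed.

Lemma adjoin_fraction F y x : is_subfield F -> adjoin_elt F y x ->
  exists f g : {poly K}, [/\ f \is a polyOver (mem F),
    g \is a polyOver (mem F), g.[y] != 0 & x = f.[y] / g.[y]].
Proof.
move=> HF; pose L := [set x | exists f g : {poly K},
  [/\ f \is a polyOver (mem F), g \is a polyOver (mem F), g.[y] != 0 &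
      x = f.[y] / g.[y]]].
suff : adjoin_elt F y `<=` L by move=> h /h.
apply: adjoin_min.
- split=> [|a b /set_mem[f [g [of_ og g0 ->]]] /set_mem[f' [g' [of' og' g'0 ->]]]
           |a b /set_mem[f [g [of_ og g0 ->]]] /set_mem[f' [g' [of' og' g'0 ->]]]];
    apply/mem_set.
  + by exists 1, 1; rewrite -polyC1 !overC ?hornerC ?divr1 ?oner_neq0//;
      exact: subfield1.
  + exists (f * g' - f' * g), (g * g'); split.
    * by apply: overD => //; rewrite ?overN ?overM.
    * exact: overM.
    * by rewrite hornerM mulf_neq0.
    * by rewrite !hornerE; field; rewrite g0 g'0.
  (* Division by 0 gives 0, written here as the fraction [0 / 1]. *)
  + have [f'0|f'0] := eqVneq f'.[y] 0.
      exists 0, 1; rewrite f'0 mul0r invr0 mulr0 horner0 mul0r.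
      by rewrite -polyC1 -(polyC0 K) !overC ?hornerC ?oner_neq0//;
        [exact: subfield1|exact: subfield0].
    exists (f * g'), (g * f'); split.
    * exact: overM.
    * exact: overM.
    * by rewrite hornerM mulf_neq0.
    * by rewrite !hornerE; field; rewrite g0 g'0 f'0.
- move=> a Fa; exists a%:P, 1.
  by rewrite -polyC1 !overC ?hornerC ?divr1 ?oner_neq0//; exact: subfield1.
- exists 'X, 1; rewrite hornerX overX//.
  by rewrite -polyC1 !overC ?hornerC ?divr1 ?oner_neq0//; exact: subfield1.
Qed.

(* A bivariate polynomial [P] in [F[X][Z]], with [Z] the outer variable. *)
Definition over2 F P := forall j, P`_j \is a polyOver (mem F).

Definition specialize y P : {poly K} := map_poly (horner_eval y) P.

Lemma coef_specialize y P j : (specialize y P)`_j = (P`_j).[y].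
Proof. by rewrite coef_map. Qed.

Lemma size_specialize y P : (size (specialize y P) <= size P)%N.
Proof. exact: size_poly. Qed.

(** Denominators are cleared. With coefficients polynomial in [y], the same [P] can later be
    specialized at points near [y]. *)
Lemma degree_le_adjoinP F y N w : is_subfield F ->
  degree_le (adjoin_elt F y) N w ->
  exists P, [/\ over2 F P, (size P <= N.+1)%N, specialize y P != 0 &
    root (specialize y P) w].
Proof.
move=> HF [p [p0 op sp pw]].
have /choice[fg fgP] i : exists fg : {poly K} * {poly K},
    [/\ fg.1 \is a polyOver (mem F), fg.2 \is a polyOver (mem F),
        fg.2.[y] != 0 & p`_i = fg.1.[y] / fg.2.[y]].
  have [f [g [? ? ? ?]]] := adjoin_fraction HF
    (over_coef (is_subfield_adjoin F y) i op).
  by exists (f, g).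
pose n := size p; pose g := \prod_(i < n) (fg i).2.
pose P := \poly_(i < n) ((fg i).1 * \prod_(j < n | (j : nat) != i) (fg j).2).
have g0 : g.[y] != 0.
  by rewrite horner_prod; apply/prodf_neq0 => i _; have [] := fgP i.
have PE : specialize y P = g.[y] *: p.
  apply/polyP => i; rewrite coef_specialize coef_poly coefZ.
  case: ltnP => [ilt|nle]; last by rewrite horner0 nth_default// mulr0.
  have [_ _ gi0 ->] := fgP i.
  have gE : g = (fg i).2 * \prod_(j < n | (j : nat) != i) (fg j).2.
    by rewrite /g (bigD1 (Ordinal ilt)).
  rewrite gE !hornerM.
  by field; exact: gi0.
exists P; split.
- move=> j; rewrite coef_poly; case: ifP => _; last by rewrite -(polyC0 K) overC//; exact: subfield0.
  apply: overM => //; first by have [] := fgP j.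
  by apply: over_prod => // i _; have [] := fgP i.
- exact: leq_trans (size_poly _ _) sp.
- by rewrite PE scaler_eq0 negb_or g0.
- by rewrite PE rootZ.
Qed.

Lemma adjoin_horner F y (f : {poly K}) : f \is a polyOver (mem F) ->
  adjoin_elt F y f.[y].
Proof.
move=> of_; apply: (over_horner (is_subfield_adjoin F y)).
  exact: over_sub (@sub_adjoin F y) of_.
exact: mem_adjoin.
Qed.

Lemma degree_le_adjoin F y N w P : over2 F P -> (size P <= N.+1)%N ->
  specialize y P != 0 -> root (specialize y P) w ->
  degree_le (adjoin_elt F y) N w.
Proof.
move=> oP sP P0 Pw; exists (specialize y P); split=> //.
  apply/(overP (is_subfield_adjoin F y)) => i.
  by rewrite coef_specialize; exact: adjoin_horner.
exact: leq_trans (size_specialize _ _) sP.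
Qed.

(** [is_alg_closed] provides a single root in [F]; dividing it out and inducting on the size reaches
    every root in [K]. *)
Lemma alg_closed_root F (p : {poly K}) x : is_subfield F -> is_alg_closed F ->
  p \is a polyOver (mem F) -> p != 0 -> root p x -> F x.
Proof.
move=> HF AF; have [n] := ubnP (size p).
elim: n p => // n IH p sp op p0 px.
have [|y Fy py] := AF p op.
  by apply: contraTneq px => /eqP/size_poly1P[c c0 ->]; rewrite rootC.
have [p' pE] := over_lift HF op.
have Fy' : subfield_pred HF y by apply/subfield_predP.
have [q' qE] : exists q, p' = q * ('X - (Subfield Fy' : subfield_type HF)%:P).
  by apply/factor_theorem; move: py; rewrite pE -[y]/(val (Subfield Fy' : subfield_type HF)) fmorph_root.
have [->//|xy] := eqVneq x y.
have pM : p = map_poly val q' * ('X - y%:P).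
  rewrite pE qE rmorphM; congr (_ * _); apply/polyP => i.
  by rewrite coef_map !coefB !coefX !coefC; case: i => [|[|i]].
have q0 : map_poly val q' != 0 by apply: contraNneq p0 => q0; rewrite pM q0 mul0r.
apply: (IH (map_poly val q')) => //.
- by move: sp; rewrite pM size_Mmonic ?monicXsubC// size_XsubC addn2.
- exact: over_map.
- by move: px; rewrite pM rootM root_XsubC (negPf xy) orbF.
Qed.

Lemma alg_closureP E (HE : is_subfield E) x : alg_closure_in E x <->
  algebraicOver (val : subfield_type HE -> K) x.
Proof.
split=> [[p [p0 op px]]|[p p0 px]].
  have [q pE] := over_lift HE op; exists q; last by rewrite -pE.
  by move: p0; rewrite pE map_poly_eq0.
exists (map_poly val p); split=> //; first by rewrite map_poly_eq0.
exact: over_map.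
Qed.

Lemma sub_alg_closure E : is_subfield E -> E `<=` alg_closure_in E.
Proof.
move=> HE x Ex; exists ('X - x%:P); rewrite polyXsubC_eq0 root_XsubC; split=> //.
by apply: overD => //; [exact: overX|exact/overN/overC].
Qed.

Lemma is_subfield_alg_closure E : is_subfield E -> is_subfield (alg_closure_in E).
Proof.
move=> HE; split=> [|x y /set_mem xE /set_mem yE|x y /set_mem xE /set_mem yE];
  apply/mem_set.
- exact: sub_alg_closure HE _ (subfield1 HE).
- by apply/(alg_closureP HE)/algebraic_sub; exact/(alg_closureP HE).
- by apply/(alg_closureP HE)/algebraic_div; exact/(alg_closureP HE).
Qed.

Lemma is_alg_closed_alg_closure E : is_subfield E ->
  is_alg_closed (alg_closure_in E).
Proof.
move=> HE p op sp; have [->|p0] := eqVneq p 0.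
  by exists 0; [exact: subfield0 (is_subfield_alg_closure HE)|exact: root0].
have [x px] := closed_rootP p sp; exists x => //.
apply/(alg_closureP HE)/integral_algebraic/(integral_root p0 px) => i.
move=> /(nthP 0)[j _ <-]; apply/integral_algebraic/(alg_closureP HE).
by have := over_coef (is_subfield_alg_closure HE) j op.
Qed.

End Adjoin.

(** * Completions *)

Section Closure.
Context {R : realType} {K : closedAnalyticFieldType R}.
Implicit Types (A F : set K) (x y : K).

Lemma absv_ballE (L : valuedFieldType R) (x y : L) e :
  ball (x : absv_space L) e y = (absv (x - y) < e) :> Prop.
Proof. by rewrite ballEmdist. Qed.

Lemma completion_inP A x : completion_in A x <->
  forall e, 0 < e -> exists2 a, A a & absv (x - a) < e.
Proof.
split=> [Ax e e0|Ae B].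
  have [|a [Aa xa]] := Ax (ball (x : absv_space K) e).
    by apply/nbhs_ballP; exists e.
  by exists a => //; move: xa; rewrite absv_ballE.
move=> /nbhs_ballP[e /= e0 eB]; have [a Aa xa] := Ae e e0.
by exists a; split=> //; apply: eB; rewrite absv_ballE.
Qed.

Lemma sub_completion A : A `<=` completion_in A.
Proof.
move=> x Ax; apply/completion_inP => e e0.
by exists x; rewrite ?subrr ?absv0.
Qed.

Lemma completion_idem A : completion_in (completion_in A) `<=` completion_in A.
Proof.
move=> x /completion_inP Ax; apply/completion_inP => e e0.
have [a /completion_inP/(_ e e0)[b Ab ab] xa] := Ax e e0.
by exists b => //; exact: absv_dist_lt xa ab.
Qed.

Lemma completion_sub A F : completion_in F `<=` F -> A `<=` F ->
  completion_in A `<=` F.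
Proof.
move=> cF AF x /completion_inP Ax; apply/cF/completion_inP => e /Ax[a Aa xa].
by exists a => //; exact: AF.
Qed.

(** The elements of [k] whose images approach [x] form a Cauchy filter because [iota] preserves
    distances; the image of its limit is [x]. *)
Lemma isometric_closed (k : closedAnalyticFieldType R) (iota : {rmorphism k -> K}) :
  isometric iota -> completion_in (range iota) `<=` range iota.
Proof.
move=> iso x /completion_inP xk.
pose B e := [set a : absv_space k | absv (x - iota a) < e].
pose G : set_system (absv_space k) := filter_from [set e : R | 0 < e] B.
have GF : Filter G.
  apply: filter_from_filter; first by exists 1; exact: ltr01.
  move=> e e' e0 e'0; exists (Num.min e e'); first by rewrite /= lt_min e0.
  by move=> a; rewrite /B /= lt_min => /andP[].
have GP : ProperFilter G.
  apply: filter_from_proper => e e0.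
  by have [_ [a _ <-] ?] := xk e e0; exists a.
have [||a _ Ga] := absv_complete _ GP.
- by exists 1 => //; exact: ltr01.
- apply/cauchy_ballP => e e0.
  exists (B e, B e); first by split; exists e.
  move=> [a b] /= [xa xb]; rewrite absv_ballE -iso rmorphB.
  by apply: absv_dist_lt xb; rewrite absvB.
exists a => //; apply/esym/absv_dist_eq0/eqP; rewrite eq_le absv_ge0 andbT.
rewrite leNgt; apply/negP => d0.
have [|e e0 eB] := Ga (ball a (absv (x - iota a))).
  by apply/nbhs_ballP; exists (absv (x - iota a)).
pose e' := Num.min e (absv (x - iota a)).
have [|_ [b _ <-] xb] := xk e'; first by rewrite lt_min e0.
have : absv (x - iota a) < absv (x - iota a).
  apply: (absv_dist_lt (y := iota b)); first by move: xb; rewrite lt_min => /andP[].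
  have := eB b; rewrite absv_ballE -iso rmorphB absvB; apply.
  by move: xb; rewrite lt_min => /andP[].
by rewrite ltxx.
Qed.

Lemma is_completeP F : is_complete F <-> completion_in F `<=` F.
Proof.
split=> [cF x /completion_inP xF|cF G GP GF Gc].
  pose B e := [set a : absv_space K | F a /\ absv (x - a) < e].
  pose G : set_system (absv_space K) := filter_from [set e : R | 0 < e] B.
  have GF : Filter G.
    apply: filter_from_filter; first by exists 1; exact: ltr01.
    move=> e e' e0 e'0; exists (Num.min e e'); first by rewrite /= lt_min e0.
    by move=> a [Fa]; rewrite /B /= lt_min => /andP[].
  have GP : ProperFilter G.
    by apply: filter_from_proper => e e0; have [a ? ?] := xF e e0; exists a.
  have [||a Fa Ga] := cF _ GP.
  - by exists 1; [exact: ltr01|move=> a []].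
  - apply/cauchy_ballP => e e0.
    exists (B e, B e); first by split; exists e.
    move=> [a b] /= [[_ xa] [_ xb]]; rewrite absv_ballE.
    by apply: absv_dist_lt xb; rewrite absvB.
  suff -> : x = a by [].
  apply/absv_dist_eq0/eqP; rewrite eq_le absv_ge0 andbT.
  rewrite leNgt; apply/negP => d0.
  have [|e e0 eB] := Ga (ball a (absv (x - a))).
    by apply/nbhs_ballP; exists (absv (x - a)).
  pose e' := Num.min e (absv (x - a)).
  have [|b Fb] := xF e'; first by rewrite lt_min e0.
  rewrite lt_min => /andP[xbe xb].
  have : absv (x - a) < absv (x - a).
    apply: (absv_dist_lt (y := b)) => //.
    have := eB b; rewrite absv_ballE absvB; apply; split => //.
  by rewrite ltxx.
have [|x _ Gx] := absv_complete G GP _ Gc; first exact: filterT.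
exists x => //; apply: cF => B /Gx GB.
exact: filter_ex (filterI GF GB).
Qed.

(** By the ultrametric inequality the distance from [u n] to the limit is bounded by the largest
    later move, not by the sum of the moves. *)
Lemma cauchy_limit (u : nat -> K) (e : nat -> R) :
  (forall n, 0 < e n.+1 <= e n / 2) ->
  (forall n, absv (u n.+1 - u n) <= e n) ->
  exists y, forall n, absv (y - u n) <= e n.
Proof.
move=> e2 ue.
have e0 n : 0 < e n.
  by have /andP[a b] := e2 n; lra.
have emono n m : (n <= m)%N -> e m <= e n.
  elim: m => [|m IH]; first by rewrite leqn0 => /eqP->.
  rewrite leq_eqVlt => /orP[/eqP->//|]; rewrite ltnS => /IH mn.
  have /andP[_ h] := e2 m; have := e0 m; lra.
have esmall d : 0 < d -> exists n, e n < d.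
  move=> d0; have eexp n : e n <= e 0 / 2 ^+ n.
    elim: n => [|n IH]; first by rewrite expr0 divr1.
    have /andP[_ h] := e2 n; apply: le_trans h _; rewrite exprS invfM mulrCA.
    by rewrite mulrC ler_pM2l ?invr_gt0.
  have [n nP] : exists n : nat, e 0 / d < n%:R.
    by exists (Num.truncn (e 0 / d)).+1; rewrite truncnS_gt.
  exists n; apply: le_lt_trans (eexp n) _; rewrite ltr_pdivrMr ?exprn_gt0//.
  rewrite mulrC -ltr_pdivrMr//; apply: lt_le_trans nP _.
  by rewrite -natrX ler_nat ltnW// ltn_expl.
have udist n m : (n <= m)%N -> absv (u m - u n) <= e n.
  elim: m => [|m IH]; first by rewrite leqn0 => /eqP->; rewrite subrr absv0 ltW.
  rewrite leq_eqVlt => /orP[/eqP->|]; first by rewrite subrr absv0 ltW.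
  rewrite ltnS => nm; apply: absv_dist_le (IH nm).
  exact: le_trans (ue m) (emono _ _ nm).
pose B n := [set u m | m in [set m | (n <= m)%N]] : set (absv_space K).
pose G : set_system (absv_space K) := filter_from [set: nat] B.
have GF : Filter G.
  apply: filter_from_filter; first by exists 0%N.
  move=> n m _ _; exists (maxn n m) => // _ [l /= nl <-].
  by move: nl; rewrite geq_max => /andP[nl ml]; split; exists l.
have GP : ProperFilter G.
  by apply: filter_from_proper => n _; exists (u n); exists n => /=.
have [||y _ Gy] := absv_complete _ GP; first by exists 0%N.
- apply/cauchy_ballP => d d0.
  have [n nd] := esmall d d0.
  exists (B n, B n); first by split; exists n.
  move=> [_ _] /= [[m nm <-] [l nl <-]]; rewrite absv_ballE.
  apply: le_lt_trans nd; apply: (absv_dist_le (y := u n)); first exact: udist.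
  by rewrite absvB; exact: udist.
exists y => n.
have [|m _ mB] := Gy (ball y (e n)); first by apply/nbhs_ballP; exists (e n); [exact: e0|].
have : ball (y : absv_space K) (e n) (u (maxn n m)).
  by apply: mB; exists (maxn n m) => //=; exact: leq_maxr.
rewrite absv_ballE => /ltW yu; apply: absv_dist_le yu _.
by apply: udist; exact: leq_maxl.
Qed.

End Closure.

Section DistTo.
Context {R : realType} {K : valuedFieldType R}.
Implicit Types (F E : set K) (x c : K) (r : R).

Lemma dist_to_has_inf F x : F !=set0 -> has_inf [set absv (x - c) | c in F].
Proof.
move=> [c Fc]; split; first by exists (absv (x - c)), c.
by exists 0 => _ [d _ <-]; exact: absv_ge0.
Qed.

Lemma dist_to_le F x c : F c -> dist_to F x <= absv (x - c).
Proof.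
move=> Fc; apply: ge_inf; last by exists c.
by have [] := dist_to_has_inf x (ex_intro _ c Fc).
Qed.

Lemma dist_to_ge F x r : F !=set0 -> (forall c, F c -> r <= absv (x - c)) ->
  r <= dist_to F x.
Proof.
move=> [c Fc] rF; apply: lb_le_inf; first by exists (absv (x - c)), c.
by move=> _ [d Fd <-]; exact: rF.
Qed.

Lemma dist_to_lt F x r : F !=set0 -> dist_to F x < r ->
  exists2 c, F c & absv (x - c) < r.
Proof.
move=> F0 /(inf_lt (dist_to_has_inf x F0).1)[_ [c Fc <-]] h.
by exists c.
Qed.

Lemma dist_to_ge0 F x : F !=set0 -> 0 <= dist_to F x.
Proof. by move=> F0; apply: dist_to_ge => // c _; exact: absv_ge0. Qed.

Lemma dist_toS F E x : F !=set0 -> F `<=` E -> dist_to E x <= dist_to F x.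
Proof. by move=> F0 FE; apply: dist_to_ge => // c /FE; exact: dist_to_le. Qed.

End DistTo.

Section GoodFields.
Context {R : realType} {K : closedAnalyticFieldType R}.
Implicit Types (A F : set K) (x y t : K).

(** The part of [intermediate] that does not mention the base field, with completeness restated as
    closedness in [K]. *)
Definition closed_analytic F :=
  [/\ is_subfield F, is_alg_closed F & completion_in F `<=` F].

Lemma completion_mul A x y : is_subfield A ->
  completion_in A x -> completion_in A y -> completion_in A (x * y).
Proof.
move=> HA /completion_inP Ax /completion_inP Ay; apply/completion_inP => e e0.
pose M := absv x + absv y + 1.
have M0 : 0 < M by rewrite ltr_wpDl// addr_ge0 ?absv_ge0.
have d0 : 0 < Num.min 1 (e / M) by rewrite lt_min ltr01 divr_gt0.
have [a Aa] := Ax _ d0; have [b Ab] := Ay _ d0.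
rewrite !lt_min !ltr_pdivlMr// => /andP[yb1 yb] /andP[xa1 xa].
exists (a * b); first exact: subfieldM.
have -> : x * y - a * b = x * (y - b) + (x - a) * b by ring.
have bM : absv b <= M.
  have -> : b = y - (y - b) by ring.
  rewrite /M; apply: absvD_le; rewrite ?absvN; have := absv_ge0 x;
    have := absv_ge0 y; lra.
apply: absvD_lt; rewrite absvM; last first.
  by apply: le_lt_trans xa; rewrite ler_wpM2l ?absv_ge0.
apply: le_lt_trans yb; rewrite mulrC ler_wpM2l ?absv_ge0//.
by rewrite /M; have := absv_ge0 y; lra.
Qed.

Lemma completion_inv A y : is_subfield A -> completion_in A y ->
  completion_in A y^-1.
Proof.
move=> HA Ay; have [->|y0] := eqVneq y 0.
  by rewrite invr0; apply: sub_completion; exact: subfield0.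
move/completion_inP: Ay => Ay; apply/completion_inP => e e0.
have ay0 : 0 < absv y by rewrite absv_gt0.
have [|b Ab] := Ay (Num.min (absv y) (e * (absv y * absv y))).
  by rewrite lt_min ay0 !mulr_gt0.
rewrite lt_min => /andP[yb yb'].
have byE : absv b = absv y.
  have -> : b = y + - (y - b) by ring.
  by rewrite absvDl// absvN.
have b0 : b != 0 by rewrite -absv_gt0 byE.
exists b^-1; first exact: subfieldV.
have -> : y^-1 - b^-1 = - (y - b) / (y * b) by field; rewrite y0 b0.
by rewrite absvM absvN absvV absvM byE ltr_pdivrMr// mulr_gt0.
Qed.

Lemma is_subfield_completion A : is_subfield A -> is_subfield (completion_in A).
Proof.
move=> HA; split=> [|x y /set_mem Ax /set_mem Ay|x y /set_mem Ax /set_mem Ay];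
  apply/mem_set.
- by apply: sub_completion; exact: subfield1.
- move/completion_inP: Ax => Ax; move/completion_inP: Ay => Ay.
  apply/completion_inP => e e0.
  have [a Aa xa] := Ax e e0; have [b Ab yb] := Ay e e0.
  exists (a - b); first exact: subfieldB.
  have -> : x - y - (a - b) = (x - a) - (y - b) by ring.
  by apply: absvD_lt; rewrite ?absvN.
- by apply: completion_mul => //; exact: completion_inv.
Qed.

(* Continuity of roots: a root in [K] of [p] is approximated by roots of
   polynomials over [A] approximating [p]. *)
Lemma is_alg_closed_completion A : is_subfield A -> is_alg_closed A ->
  is_alg_closed (completion_in A).
Proof.
move=> HA cA p op sp; have HC := is_subfield_completion HA.
have [->|p0] := eqVneq p 0; first by exists 0; [exact: subfield0|exact: root0].
have [x px] := closed_rootP p sp; exists x => //.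
apply: contrapT => xA.
have [e e0 eA] : exists2 e, 0 < e & forall a, A a -> e <= absv (x - a).
  apply: contrapT => noe; apply: xA; apply/completion_inP => e e0.
  apply: contrapT => noa; apply: noe; exists e => // a Aa.
  by rewrite leNgt; apply/negP => xa; apply: noa; exists a.
pose n := size p; pose l := absv (lead_coef p).
have l0 : 0 < l by rewrite absv_gt0 lead_coef_eq0.
pose M := Num.max 1 (absv x) ^+ n.
have M1 : 1 <= M by rewrite exprn_ege1// le_max lexx.
(* The first bound preserves the absolute value of the leading coefficient, hence the degree. The
   second gives [|Q(x)| < l e^(n-1)], whereas all roots of [Q] lie in [A], at distance at least [e]
   from [x]. *)
pose d := Num.min l (l * e ^+ n.-1 / M).
have M0 : 0 < M := lt_le_trans ltr01 M1.
have d0 : 0 < d by rewrite /d lt_min l0 divr_gt0// mulr_gt0// exprn_gt0.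
have /choice[q qP] i : exists c, A c /\ absv (p`_i - c) < d.
  have /completion_inP/(_ d d0)[a ? ?] := over_coef HC i op.
  by exists a.
pose Q := \poly_(i < n) q i.
have oQ : Q \is a polyOver (mem A).
  apply/(overP HA) => i; rewrite coef_poly; case: ifP => _.
    by have [] := qP i.
  exact: subfield0.
have n0 : (0 < n)%N by rewrite size_poly_gt0.
have lq : absv (q n.-1) = l.
  have [_] := qP n.-1; rewrite /d lt_min => /andP[h _].
  have -> : q n.-1 = p`_n.-1 + - (p`_n.-1 - q n.-1) by ring.
  by rewrite absvDl// absvN.
have sQ : size Q = n.
  by rewrite size_poly_eq//; rewrite -absv_gt0 lq.
have Q0 : Q != 0 by rewrite -size_poly_gt0 sQ.
have lQ : absv (lead_coef Q) = l by rewrite lead_coefE sQ coef_poly ltn_predL n0 lq.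
have : absv Q.[x] < l * e ^+ n.-1.
  have -> : Q.[x] = - (p - Q).[x] by rewrite hornerD hornerN (rootP px) sub0r opprK.
  rewrite absvN (horner_coef_wide (n := n)); last first.
    by rewrite (leq_trans (size_polyD _ _))// size_polyN sQ geq_max !leqnn.
  apply: absv_sum_lt => [|i _]; first by rewrite mulr_gt0 ?exprn_gt0.
  rewrite coefB coef_poly ltn_ord absvM absvX.
  have [_ pq] := qP i; have dM : d * M <= l * e ^+ n.-1.
    by rewrite -ler_pdivlMr // ge_min lexx orbT.
  apply: lt_le_trans dM; apply: (@le_lt_trans _ _ (absv (p`_i - q i) * M)).
    rewrite ler_wpM2l ?absv_ge0//.
    apply: (@le_trans _ _ (Num.max 1 (absv x) ^+ i)).
      by apply: lerXn2r; rewrite ?nnegrE ?absv_ge0 ?le_max ?ler01 ?lexx ?orbT.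
    by apply: ler_weXn2l; [rewrite le_max lexx|exact: ltnW].
  by rewrite ltr_pM2r.
apply/negP; rewrite -leNgt -lQ -sQ.
have lQ0 : lead_coef Q != 0 by rewrite lead_coef_eq0.
have [s QE] := closed_field_poly_normal Q.
have rs c : c \in s -> e <= absv (x - c).
  move=> cs; apply: eA; apply: alg_closed_root oQ Q0 _ => //.
  by rewrite QE rootZ// root_prod_XsubC.
have szs : (size Q).-1 = size s by rewrite QE size_scale// size_prod_XsubC.
rewrite szs [X in absv X.[x]]QE hornerZ absvM ler_wpM2l ?absv_ge0//.
elim: s rs {QE szs} => [|c s IH] rs; first by rewrite big_nil hornerC absv1.
rewrite big_cons hornerM hornerXsubC absvM exprS.
have e0' := ltW e0.
apply: ler_pM; rewrite ?exprn_ge0//; first by apply: rs; rewrite mem_head.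
by apply: IH => a sa; apply: rs; rewrite inE sa orbT.
Qed.

Lemma closed_analytic_completion A : is_subfield A -> is_alg_closed A ->
  closed_analytic (completion_in A).
Proof.
move=> HA cA; split; first exact: is_subfield_completion.
  exact: is_alg_closed_completion.
exact: completion_idem.
Qed.

Lemma closed_analytic_closure A : is_subfield A ->
  closed_analytic (completion_in (alg_closure_in A)).
Proof.
move=> HA; apply: closed_analytic_completion.
  exact: is_subfield_alg_closure.
exact: is_alg_closed_alg_closure.
Qed.

Lemma alg_closure_sub A F : is_subfield F -> is_alg_closed F -> A `<=` F ->
  alg_closure_in A `<=` F.
Proof.
move=> HF cF AF x [p [p0 op px]].
exact: alg_closed_root HF cF (over_sub AF op) p0 px.
Qed.

Lemma completed_closure_sub A F : closed_analytic F -> A `<=` F ->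
  completion_in (alg_closure_in A) `<=` F.
Proof.
by move=> [HF cF kF] AF; apply: completion_sub => //; exact: alg_closure_sub.
Qed.

(** A root found in one member lies in every other one, since each contains all roots in [K] of a
    nonzero polynomial over it. *)
Lemma closed_analytic_bigcap (I : Type) (F : I -> set K) : [set: I] !=set0 ->
  (forall i, closed_analytic (F i)) -> closed_analytic (\bigcap_i F i).
Proof.
move=> [i0 _] GF; split.
- by apply: is_subfield_bigcap => i _; have [] := GF i.
- move=> p op sp; have opi i : p \is a polyOver (mem (F i)).
    by apply: over_sub op => x; apply.
  have [Hi0 ci0 _] := GF i0; have [->|p0] := eqVneq p 0.
    exists 0; last exact: root0.
    by move=> i _; have [Hi _ _] := GF i; exact: subfield0.
  have [x _ px] := ci0 p (opi i0) sp; exists x => // i _.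
  by have [Hi ci _] := GF i; exact: alg_closed_root (opi i) p0 px.
- move=> x /completion_inP Ax i _; have [_ _] := GF i; apply.
  by apply/completion_inP => e /Ax[a Fa xa]; exists a => //; exact: Fa.
Qed.

(** The finitely many coefficients of a polynomial over the union lie in one member of the chain, so
    the union is already algebraically closed before completion. *)
Lemma closed_analytic_chain (I : Type) (F : I -> set K) : [set: I] !=set0 ->
  (forall i, closed_analytic (F i)) ->
  (forall i j, F i `<=` F j \/ F j `<=` F i) ->
  closed_analytic (completion_in (\bigcup_i F i)).
Proof.
move=> [i0 _] GF Fchain.
have two x y : (\bigcup_i F i) x -> (\bigcup_i F i) y -> exists i, F i x /\ F i y.
  move=> [i _ ix] [j _ jy]; have [ij|ji] := Fchain i j.
    by exists j; split=> //; exact: ij.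
  by exists i; split=> //; exact: ji.
apply: closed_analytic_completion.
  split=> [|x y /set_mem Fx /set_mem Fy|x y /set_mem Fx /set_mem Fy]; apply/mem_set.
  - by exists i0 => //; have [Hi _ _] := GF i0; exact: subfield1.
  - have [i [ix iy]] := two x y Fx Fy; exists i => //.
    by have [Hi _ _] := GF i; exact: subfieldB.
  - have [i [ix iy]] := two x y Fx Fy; exists i => //.
    by have [Hi _ _] := GF i; apply: subfieldM => //; exact: subfieldV.
move=> p op sp.
have HU i : (\bigcup_i F i) p`_i.
  have [ilt|ige] := ltnP i (size p); last first.
    by rewrite nth_default//; exists i0 => //; have [Hi _ _] := GF i0; exact: subfield0.
  by have := allP op p`_i (mem_nth 0 ilt); move/set_mem.
have [i ip] : exists i, forall m, (m < size p)%N -> F i p`_m.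
  elim: (size p) => [|n [i IH]]; first by exists i0.
  have [j _ jn] := HU n; have [ij|ji] := Fchain i j.
    exists j => m; rewrite ltnS leq_eqVlt => /orP[/eqP->//|/IH]; exact: ij.
  exists i => m; rewrite ltnS leq_eqVlt => /orP[/eqP->|/IH//]; exact: ji.
have [Hi ci _] := GF i.
have [|x ix px] := ci p _ sp; last by exists x => //; exists i.
apply/(overP Hi) => m; have [/ip//|mge] := ltnP m (size p).
by rewrite nth_default//; exact: subfield0.
Qed.

End GoodFields.

(** * Comparing intermediate fields *)

Section RealPowers.
Context {R : realType}.
Implicit Types (a b c : R).

Lemma bernoulli_le c n : 0 <= c -> 1 + c *+ n <= (1 + c) ^+ n.
Proof.
move=> c0; elim: n => [|n IH]; first by rewrite expr0 mulr0n addr0.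
rewrite exprS; apply: le_trans (ler_wpM2l (addr_ge0 ler01 c0) IH).
rewrite mulrS mulrDl mul1r mulrDr mulr1 addrA [1 + c]addrC -addrA addrC.
have : 0 <= c * (c *+ n) by rewrite mulr_ge0 ?mulrn_wge0.
lra.
Qed.

Lemma expr_unbounded c b : 1 < c -> exists n, b < c ^+ n.
Proof.
move=> c1; exists (Num.truncn (b / (c - 1))).+1.
have d0 : 0 < c - 1 by lra.
have := bernoulli_le (Num.truncn (b / (c - 1))).+1 (ltW d0).
rewrite [1 + (c - 1)]addrC subrK; apply: lt_le_trans.
have : b / (c - 1) < (Num.truncn (b / (c - 1))).+1%:R by rewrite truncnS_gt.
by rewrite ltr_pdivrMr// mulr_natl; lra.
Qed.

Lemma expr_small c b : 0 <= c < 1 -> 0 < b -> exists n, c ^+ n < b.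
Proof.
move=> /andP[c0 c1] b0; have [->|cn0] := eqVneq c 0.
  by exists 1%N; rewrite expr1.
have cp : 0 < c by rewrite lt_neqAle eq_sym cn0.
have [|n nP] := @expr_unbounded c^-1 b^-1; first by rewrite invf_gt1.
exists n; move: nP; rewrite exprVn ltf_pV2 ?posrE ?exprn_gt0//.
Qed.

Lemma expr_near1 n b : 1 < b -> exists2 a, 1 < a & a ^+ n < b.
Proof.
move=> b1; pose e := Num.min 1 ((b - 1) / 2 / 2 ^+ n).
have e0 : 0 < e by rewrite /e lt_min ltr01 !divr_gt0 ?exprn_gt0 ?subr_gt0.
exists (1 + e); first by rewrite ltrDl.
(* Convexity of [(1 + e)^n] for [e] in [[0, 1]]. *)
apply: (@le_lt_trans _ _ (1 + (2 ^+ n - 1) * e)).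
  have e1 : e <= 1 by rewrite /e ge_min lexx.
  elim: (n) => [|m IH]; first by rewrite !expr0 subrr mul0r addr0.
  rewrite exprS; apply: le_trans (ler_wpM2l _ IH) _; first lra.
  have : 1 <= (2 : R) ^+ m by rewrite exprn_ege1// ler1n.
  rewrite exprS; move: (2 ^+ m) => x x1.
  have : (x - 1) * e * e <= (x - 1) * e by rewrite ler_piMr// mulr_ge0//; lra.
  lra.
have : 2 ^+ n * e <= (b - 1) / 2.
  by rewrite mulrC -ler_pdivlMr ?exprn_gt0// /e ge_min lexx orbT.
lra.
Qed.

(** The quotient stands for an integer power of [c]. The exponent [n] makes [a c^n > 1], so the
    least [m] with [a c^n < c^m] is positive and the preceding power is at most [a c^n]. *)
Lemma expr_between c a b : 1 < c -> 0 < a -> a * c < b ->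
  exists m n, a < c ^+ m / c ^+ n < b.
Proof.
move=> c1 a0 acb; have c0 : 0 < c by lra.
have [n nP] := expr_unbounded a^-1 c1.
have an : 1 < a * c ^+ n by rewrite mulrC -ltr_pdivrMr// div1r.
have ex : exists m, a * c ^+ n < c ^+ m by exact: expr_unbounded.
case: (ex_minnP ex) => -[|m] mP mmin; first by move: mP; rewrite expr0; lra.
exists m.+1, n; rewrite ltr_pdivlMr ?exprn_gt0// mP ltr_pdivrMr ?exprn_gt0//.
have h : c ^+ m <= a * c ^+ n.
  by rewrite leNgt; apply/negP => /mmin; rewrite ltnn.
apply: (@le_lt_trans _ _ (a * c * c ^+ n)).
  by rewrite exprS mulrAC mulrC ler_pM2r.
by rewrite ltr_pM2r ?exprn_gt0.
Qed.

Lemma interval_avoid (s : seq R) a b : a < b ->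
  exists a' b', [/\ a <= a', a' < b', b' <= b &
    forall x, a' < x < b' -> x \notin s].
Proof.
elim: s a b => [|d s IH] a b ab; first by exists a, b.
have [a' [b' [aa' ab' bb' h]]] := IH a b ab.
have [da|ad] := leP d a'.
  exists a', b'; split=> // x /andP[x1 x2]; rewrite inE negb_or h ?x1//.
  by rewrite andbT; apply: contraTneq x1 => ->; rewrite -leNgt.
exists a', (Num.min b' d); split=> //.
- by rewrite lt_min ab'.
- by rewrite ge_min bb'.
move=> x /andP[x1]; rewrite lt_min => /andP[x2 x3]; rewrite inE negb_or h ?x1//.
by rewrite andbT; apply: contraTneq x3 => ->; rewrite ltxx.
Qed.

End RealPowers.

Section Comparison.
Context {R : realType} {K : closedAnalyticFieldType R}.
Implicit Types (F : set K) (x y t : K).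

Definition nontrivial_val F := exists2 y, F y & (y != 0) && (absv y != 1).

Lemma closed_nth_root F e n : is_subfield F -> is_alg_closed F -> (0 < n)%N ->
  F e -> exists2 z, F z & z ^+ n = e.
Proof.
move=> HF cF n0 Fe; have [||z Fz] := cF ('X^n - e%:P).
- by apply: overD => //; [exact/overXn/overX|exact/overN/overC].
- by rewrite size_XnsubC//; case: n n0.
by rewrite rootE !hornerE subr_eq0 => /eqP; exists z.
Qed.

(** [F] contains roots of all orders: an [n]-th root [z] of an element of absolute value above 1 has
    [1 < |z| < b / a] for large [n], and some quotient of powers of [z] falls into the interval. *)
Lemma dense_val F (a b : R) : is_subfield F -> is_alg_closed F ->
  nontrivial_val F -> 0 < a < b -> exists2 y, F y & a < absv y < b.
Proof.
move=> HF cF [y Fy /andP[y0 y1]] /andP[a0 ab].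
have [e Fe e1] : exists2 e, F e & 1 < absv e.
  have [h|h] := ltP 1 (absv y); first by exists y.
  exists y^-1; first exact: subfieldV.
  by rewrite absvV invf_gt1 ?absv_gt0// lt_neqAle y1.
have ba : 1 < b / a by rewrite ltr_pdivlMr// mul1r.
have [n nP] := expr_unbounded (absv e) ba.
have n0 : (0 < n)%N by case: n nP => //; rewrite expr0; lra.
have [z Fz zn] := closed_nth_root HF cF n0 Fe.
have z1 : 1 < absv z.
  rewrite ltNge; apply/negP => zle; move: e1; rewrite -zn absvX ltNge.
  by rewrite exprn_ile1 ?absv_ge0.
have zb : absv z < b / a.
  rewrite ltNge; apply/negP => ble; move: nP; rewrite -zn absvX ltNge.
  apply/negP; rewrite negbK; apply: lerXn2r; rewrite ?nnegrE ?absv_ge0//.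
  exact: ltW (lt_trans ltr01 ba).
have [|m [l /andP[h1 h2]]] := expr_between z1 a0 (b := b).
  by rewrite mulrC -ltr_pdivlMr.
exists (z ^+ m / z ^+ l); last by rewrite absvM absvV !absvX h1.
by apply: subfieldM => //; [|apply: subfieldV => //]; exact: subfieldX.
Qed.

Lemma horner_compare (f : {poly K}) x y (A : R) : 0 <= A ->
  (forall b, root f b -> absv (x - b) <= A * absv (y - b)) ->
  absv f.[x] <= A ^+ (size f).-1 * absv f.[y].
Proof.
move=> A0 fA; have [->|f0] := eqVneq f 0.
  by rewrite !horner0 absv0 mulr0.
have l0 : lead_coef f != 0 by rewrite lead_coef_eq0.
have [s fE] := closed_field_poly_normal f.
have sA b : b \in s -> absv (x - b) <= A * absv (y - b).
  by move=> bs; apply: fA; rewrite fE rootZ// root_prod_XsubC.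
have -> : (size f).-1 = size s by rewrite fE size_scale// size_prod_XsubC.
rewrite fE !hornerZ !absvM mulrCA ler_wpM2l ?absv_ge0//.
elim: s sA {fE} => [|b s IH] sA; first by rewrite big_nil !hornerC mul1r.
rewrite big_cons !hornerM !hornerXsubC !absvM exprS mulrACA.
apply: ler_pM; rewrite ?absv_ge0//; first by apply: sA; rewrite mem_head.
by apply: IH => c cs; apply: sA; rewrite inE cs orbT.
Qed.

Lemma over2P F P (HF : is_subfield F) :
  over2 F P <-> P \is a polyOver (polyOver (subfield_pred HF)).
Proof. by split=> [oP|/polyOverP oP j]; [apply/polyOverP|]; apply: oP. Qed.

Lemma over2_comp F P Q : is_subfield F -> over2 F P -> over2 F Q ->
  over2 F (P \Po Q).
Proof.
by move=> HF /(over2P _ HF) oP /(over2P _ HF) oQ; apply/(over2P _ HF)/polyOver_comp.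
Qed.

Lemma over2_XaddC F (f : {poly K}) : is_subfield F ->
  f \is a polyOver (mem F) -> over2 F ('X + f%:P).
Proof. by move=> HF oF; apply/(over2P _ HF); rewrite polyOverXaddC. Qed.

Lemma specialize_comp y P Q :
  specialize y (P \Po Q) = specialize y P \Po specialize y Q.
Proof. exact: map_comp_poly. Qed.

Lemma specialize_XaddC y (f : {poly K}) :
  specialize y ('X + f%:P) = 'X + (f.[y])%:P.
Proof. by rewrite /specialize rmorphD /= map_polyX map_polyC. Qed.

(* Moving [t] to a nearby point [a'] of [F'] changes the absolute values of
   finitely many polynomials over [F] by a factor close to 1; hence the Newton
   polygon of [P(., c + Z)] at [a'] is close to that at [t], and [c] is as well
   approximated by elements algebraic over [a'] as by elements algebraic over
   [t]. *)
Lemma subset_of_dist (k F F' : set K) t : is_subfield k ->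
  closed_analytic F -> closed_analytic F' -> k `<=` F -> k `<=` F' ->
  completion_in (alg_closure_in (adjoin_elt k t)) = [set: K] ->
  nontrivial_val F' -> 0 < dist_to F t -> dist_to F' t <= dist_to F t ->
  F `<=` F'.
Proof.
move=> Hk [HF cF kF] [HF' cF' kF'] kF_ kF'_ gen nt r0 rr c Fc.
apply: contrapT => nF'c.
have [d d0 dP] : exists2 d, 0 < d & forall a, F' a -> d <= absv (c - a).
  apply: contrapT => nd; apply: nF'c; apply: kF'; apply/completion_inP => e e0.
  apply: contrapT => na; apply: nd; exists e => // a F'a.
  by rewrite leNgt; apply/negP => ca; apply: na; exists a.
have /completion_inP/(_ (d / 2)) : completion_in (alg_closure_in (adjoin_elt k t)) c.
  by rewrite gen.
case; first by rewrite divr_gt0.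
move=> c' [p [p0 op pc']] cc'.
have [P [oP _ P0 Pc']] : exists P, [/\ over2 k P, (size P <= (size p).+1)%N,
    specialize t P != 0 & root (specialize t P) c'].
  by apply: degree_le_adjoinP => //; exists p.
pose P2 := P \Po ('X + c%:P%:P).
have oP2 : over2 F P2.
  apply: over2_comp => //; first by move=> j; exact: over_sub (oP j).
  by apply: over2_XaddC => //; exact: overC.
have P2E y : specialize y P2 = specialize y P \Po ('X + c%:P).
  by rewrite specialize_comp specialize_XaddC hornerC.
pose D := \max_(j < size P2) size (P2`_j)%R.
(* The loss [A^D < 2] must stay below the factor 2 gained from [|c - c'| < d / 2]. *)
have [A A1 AD] : exists2 A : R, 1 < A & A ^+ D < 2 by apply: expr_near1; rewrite ltr1n.
have A0 : 0 < A := lt_trans ltr01 A1.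
pose G := \prod_(j < size P2 | P2`_j != 0) P2`_j.
have G0 : G != 0 by apply/prodf_neq0.
have [s GE] := closed_field_poly_normal G.
have Gs b j : P2`_j != 0 -> root P2`_j b -> b \in s.
  move=> j0 jb; have jlt : (j < size P2)%N.
    by rewrite ltnNge; apply: contra_neqN j0 => ?; rewrite nth_default.
  rewrite -root_prod_XsubC -(@rootZ _ _ (lead_coef G)) ?lead_coef_eq0// -GE.
  by rewrite /G (bigD1 (Ordinal jlt))//= rootM jb.
have F0 : F !=set0 by exists 0; exact: subfield0.
have F'0 : F' !=set0 by exists 0; exact: subfield0.
set r := dist_to F t in r0 rr.
have rA : r < A * r by rewrite ltr_pMl.
have [a F'a ta] := dist_to_lt F'0 (le_lt_trans rr rA).
(* [|y|] is to lie slightly above [r] and [|t - a|] and to differ from every [|t - b|], so that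
   [|a' - b| = max(|t - b|, |y|)] for each root [b]. *)
have [|lo [hi [lo1 lohi hi1 avoid]]] :=
  @interval_avoid _ [seq absv (t - b) | b <- s] (Num.max r (absv (t - a))) (A * r).
  by rewrite gt_max rA.
have [|y F'y /andP[y1 y2]] := @dense_val F' lo hi HF' cF' nt.
  by rewrite lohi andbT; apply: lt_le_trans lo1; rewrite lt_max r0.
have yns : absv y \notin [seq absv (t - b) | b <- s] by apply: avoid; rewrite y1.
have yA : absv y < A * r by exact: lt_le_trans hi1.
have /andP[yr yta] : (r < absv y) && (absv (t - a) < absv y).
  by rewrite -gt_max; exact: le_lt_trans y1.
pose a' := a + y; have F'a' : F' a' by exact: subfieldD.
have near j b : P2`_j != 0 -> root P2`_j b ->
    absv (t - b) <= absv (a' - b) <= A * absv (t - b).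
  move=> j0 jb; have Fb : F b by exact: alg_closed_root (oP2 j) j0 jb.
  have rtb : r <= absv (t - b) by exact: dist_to_le.
  have tyb : absv (t - b) != absv y.
    by apply: contraNneq yns => <-; apply: map_f; exact: Gs jb.
  have a'E : a' - b = (t - b) + (y - (t - a)) by rewrite /a'; ring.
  have yE : absv (y - (t - a)) = absv y by rewrite absvDl// absvN.
  have Ar : A * r <= A * absv (t - b) by rewrite ler_pM2l.
  have [h|h|/eqP] := ltgtP (absv (t - b)) (absv y); last by rewrite (negPf tyb).
    have -> : absv (a' - b) = absv y by rewrite a'E absvDr yE.
    by rewrite (ltW h)/= ltW// (lt_le_trans yA).
  have -> : absv (a' - b) = absv (t - b) by rewrite a'E absvDl// yE.
  by rewrite lexx/= ler_peMl ?absv_ge0// ltW.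
have cmp1 j : absv (P2`_j).[t] <= absv (P2`_j).[a'].
  have [->|j0] := eqVneq P2`_j 0; first by rewrite !horner0.
  rewrite -[leRHS]mul1r -(expr1n _ (size (P2`_j)%R).-1); apply: horner_compare => // b jb.
  by rewrite mul1r; have /andP[] := near j b j0 jb.
have cmp2 j : absv (P2`_j).[a'] <= A ^+ D * absv (P2`_j).[t].
  have [->|j0] := eqVneq P2`_j 0; first by rewrite !horner0 absv0 mulr0.
  apply: (@le_trans _ _ (A ^+ (size (P2`_j)%R).-1 * absv (P2`_j).[t])).
    apply: horner_compare => [|b jb]; first exact: ltW.
    by have /andP[] := near j b j0 jb.
  rewrite ler_wpM2r ?absv_ge0// ler_weXn2l ?ltW//.
  have jlt : (j < size P2)%N.
    by rewrite ltnNge; apply: contra_neqN j0 => ?; rewrite nth_default.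
  by apply: leq_trans (leq_pred _) _; exact: (leq_bigmax (Ordinal jlt)).
pose f := specialize t P2; pose g := specialize a' P2.
have f0 : f != 0.
  by rewrite /f P2E comp_poly_eq0// size_XaddC.
have Pa'0 : specialize a' P != 0.
  suff : g != 0 by apply: contraNneq => Pz; rewrite /g P2E Pz comp_poly0.
  apply: contraNneq f0 => gz; apply/eqP/polyP => j; rewrite coef0 coef_specialize.
  apply/eqP; rewrite -absv_eq0 eq_le absv_ge0 andbT; apply: le_trans (cmp1 j) _.
  by rewrite -coef_specialize -/g gz coef0 absv0.
(* A root [e] of [P(a', c + Z)] gives a point [c + e] algebraic over [F'], hence in [F'], at
   distance at least [d] from [c]. *)
have groot e : root g e -> d <= absv e.
  move=> ge; have -> : absv e = absv (c - (c + e)) by rewrite opprD addrA subrr sub0r absvN.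
  apply: dP; apply: (alg_closed_root HF' cF' _ Pa'0).
    apply/(overP HF') => j; rewrite coef_specialize.
    by apply: over_horner => //; exact: over_sub (oP j).
  by move: ge; rewrite /g P2E !rootE horner_comp !hornerE addrC.
have gd j : absv g`_j * d ^+ j <= absv g`_0.
  have := @gauss_le_roots _ _ g d 1 0 (ltW d0) (lexx 1) _ j.
  rewrite expr1n mul1r horner_coef0; apply => e ge.
  by rewrite mul1r sub0r absvN ge_max groot// lexx.
have g00 : g`_0 != 0.
  apply/eqP => g0; have := groot 0; rewrite rootE horner_coef0 g0 eqxx => /(_ erefl).
  by rewrite absv0 leNgt d0.
have fc' : root f (c' - c).
  by rewrite /f P2E rootE horner_comp !hornerE subrK.
(* As [|c' - c| < d / 2], each term of positive degree in [f(c' - c) = 0] is at most half of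
   [|g_0|]. *)
have f0small : absv f`_0 <= absv g`_0 / 2.
  have -> : f`_0 = f`_0 - f.[c' - c] by rewrite (rootP fc') subr0.
  rewrite horner_coef; have szf : (0 < size f)%N by rewrite size_poly_gt0.
  rewrite -(prednK szf) big_ord_recl expr0 mulr1 opprD addrA subrr sub0r absvN.
  apply: absv_sum_le => [|j _]; first by rewrite divr_ge0 ?absv_ge0.
  rewrite absvM absvX lift0 absvB.
  apply: (@le_trans _ _ (absv g`_j.+1 * (d ^+ j.+1 / 2))).
    apply: ler_pM; rewrite ?exprn_ge0 ?absv_ge0 ?coef_specialize//.
    apply: (@le_trans _ _ ((d / 2) ^+ j.+1)).
      by apply: lerXn2r; rewrite ?nnegrE ?absv_ge0 ?divr_ge0 ?ltW.
    rewrite expr_div_n ler_pM2l ?exprn_gt0// lef_pV2 ?posrE ?exprn_gt0//.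
    by rewrite -[leLHS]expr1 ler_weXn2l// ler1n.
  by rewrite mulrA ler_pM2r// gd.
have := cmp2 0%N; rewrite -!coef_specialize -/f -/g => h.
have gpos : 0 < absv g`_0 by rewrite absv_gt0.
have fpos : 0 <= absv f`_0 by exact: absv_ge0.
have : absv g`_0 <= A ^+ D * (absv g`_0 / 2).
  by apply: le_trans h _; rewrite ler_wpM2l// exprn_ge0// ltW.
by apply/negP; rewrite -ltNge mulrCA gtr_pMr// ltr_pdivrMr// mul1r.
Qed.

End Comparison.

(** * Approximation by elements of small degree *)

Section PrimePowers.
Context {R : realType} {K : valuedFieldType R}.
Variable p : nat.
Hypothesis p_prime : prime p.
Implicit Types (x y h b : K) (B rho kappa tau : R).

(** By [i C(q, i) = q C(q - 1, i - 1)] with [q = p^m]: if [p] did not divide the binomial, [q] would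
    divide [i < q]. *)
Lemma prime_dvd_bin_exp m i : (0 < i < p ^ m)%N -> (p %| 'C(p ^ m, i))%N.
Proof.
case: i => // i /= ilt; have := mul_bin_diag (p ^ m) i.
have q0 : (0 < p ^ m)%N by rewrite expn_gt0 prime_gt0.
move=> E; have : (p ^ m %| i.+1 * 'C(p ^ m, i.+1))%N by rewrite -E dvdn_mulr.
apply: contraTT => pC; rewrite Gauss_dvdl ?coprimeXl ?prime_coprime//.
by rewrite gtnNdvd.
Qed.

Lemma absv_bin_exp m i : (0 < i < p ^ m)%N ->
  absv ('C(p ^ m, i)%:R : K) <= absv (p%:R : K).
Proof.
move=> /prime_dvd_bin_exp/dvdnP[k ->]; rewrite natrM absvM.
by rewrite ler_piMl ?absv_ge0// absv_natr.
Qed.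

Lemma absv_exprD_exp m x h B : absv x <= B -> absv h <= B ->
  absv ((x + h) ^+ (p ^ m) - x ^+ (p ^ m)) <=
  Num.max (absv h ^+ (p ^ m)) (absv (p%:R : K) * absv h * B ^+ (p ^ m).-1).
Proof.
move=> xB hB; have B0 : 0 <= B by apply: le_trans xB; exact: absv_ge0.
set q := (p ^ m)%N; have q0 : (0 < q)%N by rewrite expn_gt0 prime_gt0.
rewrite exprDn big_ord_recl /= subn0 bin0 expr0 mulr1 mulr1n addrC addKr.
apply: absv_sum_le => [|i _]; first by rewrite le_max exprn_ge0 ?absv_ge0.
rewrite /bump /= add1n; have iq : (i < q)%N := ltn_ord i.
have [iE|iN] := eqVneq i.+1 q.
  by rewrite iE subnn expr0 mul1r binn mulr1n absvX le_max lexx.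
have ilt : (i.+1 < q)%N by rewrite ltn_neqAle iN.
rewrite le_max; apply/orP; right.
rewrite -mulr_natr !absvM !absvX exprS mulrC -!mulrA.
apply: ler_pM; rewrite ?absv_ge0 ?mulr_ge0 ?exprn_ge0 ?absv_ge0//.
  exact: absv_bin_exp.
rewrite mulrCA ler_wpM2l ?absv_ge0//.
have -> : q.-1 = (q - i.+1 + i)%N by move: iq; clear; lia.
rewrite exprD; apply: ler_pM; rewrite ?exprn_ge0 ?absv_ge0//;
  by apply: lerXn2r; rewrite ?nnegrE ?absv_ge0.
Qed.

(** One [p]-th power multiplies the relative distance by at most [kappa]: the pure power of the
    difference contributes [rho^(p-1)], the mixed binomial terms contribute [|p|]. This is applied
    [m] times. *)
Lemma absv_expB_exp m x y B rho kappa : 0 <= rho <= 1 -> kappa <= 1 ->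
  rho ^+ p.-1 <= kappa -> absv (p%:R : K) <= kappa ->
  absv x <= B -> absv (y - x) <= rho * B ->
  absv (y ^+ (p ^ m) - x ^+ (p ^ m)) <= rho * kappa ^+ m * B ^+ (p ^ m).
Proof.
move=> /andP[r0 r1] k1 rk pk xB yx.
have B0 : 0 <= B by apply: le_trans xB; exact: absv_ge0.
have k0 : 0 <= kappa by apply: le_trans pk; exact: absv_ge0.
elim: m => [|m IH]; first by rewrite expn0 !expr1 expr0 mulr1.
set q := (p ^ m)%N in IH *; rewrite expnSr -/q !exprM.
set X := x ^+ q; set Y := y ^+ q in IH *.
have C0 : 0 <= B ^+ q by exact: exprn_ge0.
have XB : absv X <= B ^+ q.
  by rewrite absvX; apply: lerXn2r; rewrite ?nnegrE ?absv_ge0.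
set C := B ^+ q in C0 XB IH *.
have km1 : kappa ^+ m <= 1 by exact: exprn_ile1.
have km0 : 0 <= kappa ^+ m by exact: exprn_ge0.
have rkm : rho * kappa ^+ m <= rho by rewrite ler_piMr.
have hC : absv (Y - X) <= C.
  by apply: le_trans IH _; rewrite ler_piMl// (le_trans rkm).
have -> : Y = X + (Y - X) by ring.
have := absv_exprD_exp 1 XB hC; rewrite expn1 => /le_trans; apply.
have p0 := prime_gt0 p_prime.
rewrite ge_max; apply/andP; split.
  apply: (@le_trans _ _ ((rho * kappa ^+ m * C) ^+ p)).
    by apply: lerXn2r; rewrite ?nnegrE ?absv_ge0 ?mulr_ge0.
  rewrite exprMn ler_wpM2r ?exprn_ge0// -(prednK p0) exprS exprSr mulrA.
  rewrite ler_wpM2l ?mulr_ge0//; apply: le_trans rk.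
  by apply: lerXn2r; rewrite ?nnegrE ?mulr_ge0.
apply: (@le_trans _ _ (kappa * (rho * kappa ^+ m * C) * C ^+ p.-1)).
  by rewrite ler_wpM2r ?exprn_ge0// ler_pM ?absv_ge0.
by rewrite -!mulrA -exprS prednK// exprSr -!mulrA mulrCA [kappa * (_ * _)]mulrCA.
Qed.

End PrimePowers.

(** * Orthogonality of powers over the q-th power *)

Section Orthogonality.
Context {R : realType} {K : closedAnalyticFieldType R}.
Variable p : nat.
Hypothesis p_prime : prime p.
Implicit Types (u b z : K) (P : {poly {poly K}}).

(** This is [P(X^q, f)], with value [P(u^q, f(u))] at [u]. *)
Definition sparse (q : nat) P (f : {poly K}) := (map_poly (comp_poly 'X^q) P).[f].

Lemma sparseE q P f :
  sparse q P f = \sum_(j < size P) (P`_j \Po 'X^q) * f ^+ j.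
Proof.
rewrite /sparse (horner_coef_wide (n := size P)) ?size_poly//.
by apply: eq_bigr => j _; rewrite coef_map.
Qed.

Lemma horner_sparse q P f u : (sparse q P f).[u] = (specialize (u ^+ q) P).[f.[u]].
Proof.
rewrite sparseE horner_sum (horner_coef_wide (n := size P)) ?size_specialize//.
by apply: eq_bigr => j _; rewrite !hornerE horner_comp hornerXn coef_specialize.
Qed.

Lemma gauss_le_expD (S T tau : R) (f g : {poly K}) l : 0 <= S -> 0 <= T ->
  0 <= tau <= 1 -> gauss_le S T f -> gauss_le S (tau * T) g ->
  gauss_le S (tau * T ^+ l) ((f + g) ^+ l - f ^+ l).
Proof.
move=> S0 T0 /andP[t0 t1] fT gT; elim: l => [|l IH].
  by rewrite subrr; apply: gauss_le0; rewrite mulr_ge0 ?exprn_ge0.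
have -> : (f + g) ^+ l.+1 - f ^+ l.+1 =
    (f + g) * ((f + g) ^+ l - f ^+ l) + g * f ^+ l by rewrite !exprS; ring.
have fgT : gauss_le S T (f + g).
  by apply: gauss_leD => //; apply: gauss_leW gT; rewrite ler_piMl.
apply: gauss_leD => //.
  rewrite exprS mulrCA; apply: gauss_leM => //.
  by rewrite mulr_ge0 ?exprn_ge0.
rewrite exprS mulrA; apply: gauss_leM => //; rewrite ?mulr_ge0 ?exprn_ge0//.
exact: gauss_leXn.
Qed.

Lemma comp_polyXn (f g : {poly K}) n : (f ^+ n) \Po g = (f \Po g) ^+ n.
Proof. exact: (rmorphXn (comp_poly g)). Qed.

Lemma comp_poly_wide n (f g : {poly K}) : (size f <= n)%N ->
  f \Po g = \sum_(l < n) f`_l *: g ^+ l.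
Proof.
move=> fn; rewrite /comp_poly (horner_coef_wide (n := n)).
  by apply: eq_bigr => l _; rewrite coef_map mul_polyC.
exact: leq_trans (size_poly _ _) fn.
Qed.

Lemma exprXaddC_sub q b : (0 < q)%N ->
  ('X + b%:P) ^+ q - (b ^+ q)%:P - 'X^q =
  \sum_(i < q.-1) ((b ^+ i.+1) * 'C(q, i.+1)%:R)%:P * 'X^(q - i.+1).
Proof.
case: q => // q _; rewrite exprDn big_ord_recl big_ord_recr /=.
rewrite subn0 subnn bin0 /bump /= add1n binn !expr0 mulr1 mul1r !mulr1n.
rewrite rmorphXn /=.
rewrite [LHS](_ : _ = \sum_(i < q) 'X^(q.+1 - bump 0 i) * b%:P ^+ (bump 0 i) *+ 'C(q.+1, bump 0 i)); last by ring.
apply: eq_bigr => i _; rewrite /bump /= add1n polyCM rmorphXn /= polyC_natr.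
by rewrite -mulr_natr; ring.
Qed.

Lemma gauss_le_exprXaddC m b (S B : R) : 0 <= S <= B -> absv b <= B ->
  gauss_le S (absv (p%:R : K) * B ^+ (p ^ m))
    (('X + b%:P) ^+ (p ^ m) - (b ^+ (p ^ m))%:P - 'X^(p ^ m)).
Proof.
move=> /andP[S0 SB] bB; have B0 : 0 <= B by exact: le_trans SB.
set q := (p ^ m)%N; have q0 : (0 < q)%N by rewrite expn_gt0 prime_gt0.
have -> : ('X + b%:P) ^+ q - (b ^+ q)%:P - 'X^q =
    \sum_(i < q.-1) ((b ^+ i.+1) * 'C(q, i.+1)%:R)%:P * 'X^(q - i.+1).
  exact: exprXaddC_sub.
apply: gauss_le_sum => //; first by rewrite mulr_ge0 ?absv_ge0 ?exprn_ge0.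
move=> i _; have ilt : (i.+1 < q)%N by have := ltn_ord i; rewrite -ltnS prednK.
apply: (gauss_leW (B := B ^+ i.+1 * absv (p%:R : K) * S ^+ (q - i.+1))).
  rewrite mulrAC -[X in _ <= _ * B ^+ X](subnKC (ltnW ilt)) exprD mulrC.
  by rewrite ler_wpM2l ?absv_ge0// ler_wpM2l ?exprn_ge0// lerXn2r.
apply: gauss_leM => //; rewrite ?mulr_ge0 ?absv_ge0 ?exprn_ge0//.
  apply: gauss_leC; rewrite ?mulr_ge0 ?absv_ge0 ?exprn_ge0//.
  rewrite absvM absvX; apply: ler_pM; rewrite ?absv_ge0 ?exprn_ge0 ?absv_ge0//.
    by apply: lerXn2r; rewrite ?nnegrE ?absv_ge0.
  exact: absv_bin_exp.
exact: gauss_leXm.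
Qed.

(** [a] is invertible modulo [q], so the exponent determines [j < q] and then [l]: distinct terms
    give distinct monomials, and none can cancel. *)
Lemma sparse_exponent_inj q a j l j' l' : coprime q a -> (j < q)%N -> (j' < q)%N ->
  (q * l + a * j = q * l' + a * j')%N -> j = j' /\ l = l'.
Proof.
move=> cop; wlog jj : j l j' l' / (j <= j')%N.
  move=> h jq j'q E; have [jj|/ltnW jj] := leqP j j'; first exact: h jj jq j'q E.
  by have [-> ->] := h j' l' j l jj j'q jq (esym E).
move=> jq j'q E; have q0 : (0 < q)%N by exact: leq_ltn_trans jq.
have : (q %| a * (j' - j))%N.
  rewrite mulnBr -eqn_mod_dvd ?leq_mul2l ?jj ?orbT//.
  by rewrite -(modnMDl l') -[X in _ == X](modnMDl l) ![(_ * q)%N]mulnC E.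
rewrite Gauss_dvdr// => /dvdn_leq; have [E' _|lt /(_ isT)] := posnP (j' - j)%N.
  have je : j = j' by apply/eqP; rewrite eqn_leq jj -subn_eq0 E'.
  move: E; rewrite je => /addIn/eqP; rewrite eqn_pmul2l// => /eqP.
  by [].
by rewrite leqNgt (leq_ltn_trans (leq_subr _ _)).
Qed.

Lemma fin_argmax (T : finType) (f : T -> R) (t0 : T) :
  exists t, forall t', f t' <= f t.
Proof.
by case: (Order.TotalTheory.arg_maxP (P := xpredT) f (i0 := t0) isT) => t _ h; exists t => t'; exact: h.
Qed.

(* Powers of [V = u - b] of exponent less than [q] are orthogonal over the
   polynomials in [u ^+ q], for the Gauss norm on the disc of centre [b] through
   [u], since [u ^+ q] is congruent to [b ^+ q + V ^+ q] modulo [p]. *)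
Lemma no_sparse_root m u b z a P (B rho : R) : let q := (p ^ m)%N in
  let S := absv (u - b) in
  0 < S -> S <= B -> absv b <= B -> absv (p%:R : K) * B ^+ q < S ^+ q ->
  coprime q a -> (0 < a)%N -> a = 1%N \/ b = 0 -> (size P <= q)%N -> P != 0 -> rho < 1 ->
  absv ((u - b) ^+ a - z) <= rho * S ^+ a ->
  (sparse q P ('X^a - (b ^+ a)%:P) != 0 -> forall c,
    root (sparse q P ('X^a - (b ^+ a)%:P)) c -> S <= absv (u - c)) ->
  ~~ root (specialize (u ^+ q) P) z.
Proof.
move=> q S S0 SB bB pB cop a0 ab sP P0 rho1 zV rootG; apply/negP => Pz.
set G := sparse _ _ _ in rootG.
have q0 : (0 < q)%N by rewrite expn_gt0 prime_gt0.
have B0 : 0 <= B by apply: le_trans bB; exact: absv_ge0.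
have S0' := ltW S0.
have aE : ('X + b%:P) ^+ a - (b ^+ a)%:P = 'X^a.
  have [->|->] := ab; first by rewrite !expr1 addrK.
  by rewrite addr0 expr0n gtn_eqF// subr0.
pose Gb := G \Po ('X + b%:P).
have GbE : Gb = \sum_(j < size P) (P`_j \Po ('X + b%:P) ^+ q) * 'X^(a * j).
  rewrite /Gb /G sparseE rmorph_sum /=; apply: eq_bigr => j _.
  rewrite comp_polyM comp_polyXn comp_polyB comp_polyC comp_Xn_poly aE -exprM.
  by rewrite -comp_polyA comp_Xn_poly.
pose V := u - b.
have GbV : Gb.[V] = G.[u] by rewrite horner_comp !hornerE subrK.
(* No root of [G] is closer to [u] than [S], so the Gauss norm on this disc is attained at [V]. *)
have Gb_le : gauss_le S (absv G.[u]) Gb.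
  have [G0|G0] := eqVneq G 0.
    by rewrite /Gb G0 comp_poly0 horner0 absv0; apply: gauss_le0.
  rewrite -GbV -[X in gauss_le _ X]mul1r -(expr1n _ (size Gb).-1).
  apply: gauss_le_roots => // d; rewrite rootE horner_comp hornerD hornerX hornerC => dG.
  have Vd : S <= absv (V - d).
    by have := rootG G0 (d + b) dG; rewrite /V opprD addrA addrAC.
  rewrite mul1r ge_max Vd -[d in absv d](subKr V).
  by apply: absvD_le; rewrite ?absvN.
(* [g j] is the coefficient [P_j] expanded around [b^q]; [W] is the error in
   [(X + b)^q = X^q + b^q + W]. *)
pose g j := P`_j \Po ('X + (b ^+ q)%:P).
pose W := ('X + b%:P) ^+ q - (b ^+ q)%:P - 'X^q.
pose tau := absv (p%:R : K) * B ^+ q / S ^+ q.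
have Sq0 : 0 < S ^+ q by exact: exprn_gt0.
have t1 : tau < 1 by rewrite ltr_pdivrMr// mul1r.
have t0 : 0 <= tau by rewrite divr_ge0 ?mulr_ge0 ?absv_ge0 ?exprn_ge0.
have W_le : gauss_le S (tau * S ^+ q) W.
  rewrite divfK ?gt_eqF//; apply: gauss_le_exprXaddC => //.
  by rewrite S0'.
clearbody tau.
have gW j : P`_j \Po ('X + b%:P) ^+ q = g j \Po ('X^q + W).
  rewrite /g -comp_polyA comp_polyD comp_polyX comp_polyC.
  by congr (_ \Po _); rewrite /W; ring.
pose n := \max_(j < size P) size (g j).
have gn j : (size (g j) <= n)%N.
  have [jlt|jge] := ltnP j (size P); first exact: (leq_bigmax (Ordinal jlt)).
  by rewrite /g nth_default// comp_poly0 size_poly0.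
pose T : finType := ('I_(size P) * 'I_n)%type.
pose cf (t : T) := (g t.1)`_t.2.
pose ex (t : T) := (q * t.2 + a * t.1)%N.
have [t0' nz] : exists t : T, cf t != 0.
  pose j := (size P).-1.
  have jlt : (j < size P)%N by rewrite ltn_predL size_poly_gt0.
  have gj0 : g j != 0.
    by rewrite /g comp_poly_eq0 ?size_XaddC// -lead_coefE lead_coef_eq0.
  have llt : ((size (g j)).-1 < n)%N.
    by apply: leq_trans (gn j); rewrite ltn_predL size_poly_gt0.
  exists (Ordinal jlt, Ordinal llt) => /=.
  by rewrite /cf /= -lead_coefE lead_coef_eq0.
have [tm tmax] := fin_argmax (fun t : T => absv (cf t) * S ^+ ex t) t0'.
set M := absv (cf tm) * S ^+ ex tm in tmax.
have M0 : 0 < M.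
  by apply: lt_le_trans (tmax t0'); rewrite mulr_gt0 ?absv_gt0 ?exprn_gt0.
have GbE2 : Gb = \sum_(t : T) (cf t)%:P * ('X^q + W) ^+ t.2 * 'X^(a * t.1).
  rewrite GbE -(pair_big xpredT xpredT (fun (j : 'I_(size P)) (l : 'I_n) =>
    ((g j)`_l)%:P * ('X^q + W) ^+ l * 'X^(a * j))) /=.
  apply: eq_bigr => j _; rewrite gW (comp_poly_wide _ (gn j)) mulr_suml.
  by apply: eq_bigr => l _; rewrite mul_polyC.
(* Dropping [W] changes [Gb] by at most [tau M]; what remains is a sum of distinct monomials, of
   Gauss norm [M]. *)
have err_le : gauss_le S (tau * M) (Gb - \sum_(t : T) (cf t)%:P * 'X^(ex t)).
  rewrite GbE2 -sumrB; apply: gauss_le_sum => //; first by rewrite mulr_ge0// ltW.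
  move=> t _; rewrite /ex exprD ['X^(q * _)]exprM mulrA -mulrBl -mulrBr.
  apply: (gauss_leW (B := absv (cf t) * (tau * (S ^+ q) ^+ t.2) * S ^+ (a * t.1))).
    apply: le_trans (ler_wpM2l t0 (tmax t)).
    by rewrite /ex exprD [S ^+ (q * _)]exprM -!mulrA mulrCA lexx.
  apply: gauss_leM => //; rewrite ?mulr_ge0 ?absv_ge0 ?exprn_ge0 ?(ltW Sq0)//.
    apply: gauss_leM => //; rewrite ?mulr_ge0 ?absv_ge0 ?exprn_ge0 ?(ltW Sq0)//.
      by apply: gauss_leC; rewrite ?absv_ge0.
    apply: gauss_le_expD => //; first exact: ltW.
      by rewrite t0 ltW.
    exact: gauss_leXm.
  exact: gauss_leXm.
have exj t t' : ex t = ex t' -> t = t'.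
  move=> E; have := sparse_exponent_inj cop _ _ E.
  have lt1 : (t.1 < q)%N by apply: leq_trans sP.
  have lt2 : (t'.1 < q)%N by apply: leq_trans sP.
  move=> /(_ lt1 lt2)[e1 e2]; case: t t' {E lt1 lt2} e1 e2 => [j l] [j' l'] /=.
  by move=> /val_inj -> /val_inj ->.
have coefQ : (\sum_(t : T) (cf t)%:P * 'X^(ex t))`_(ex tm) = cf tm.
  rewrite coef_sum (bigD1 tm)//= big1 ?addr0 => [|t ttm].
    by rewrite coefCM coefXn eqxx mulr1.
  rewrite coefCM coefXn; case: eqP => [/exj E|_]; last by rewrite mulr0.
  by rewrite E eqxx in ttm.
have MG : M <= absv G.[u].
  apply: le_trans (Gb_le (ex tm)).
  have -> : Gb`_(ex tm) = cf tm + (Gb - \sum_(t : T) (cf t)%:P * 'X^(ex t))`_(ex tm).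
    by rewrite coefB coefQ addrC subrK.
  rewrite absvDl// -(@ltr_pM2r _ (S ^+ ex tm)) ?exprn_gt0//.
  by apply: le_lt_trans (err_le (ex tm)) _; rewrite gtr_pMl.
have uq : absv (u ^+ q - b ^+ q) <= S ^+ q.
  have -> : u = b + V by rewrite /V addrC subrK.
  apply: le_trans (absv_exprD_exp p_prime m bB (SB : absv V <= B)) _.
  rewrite ge_max lexx/=; apply: le_trans (ltW pB).
  rewrite -mulrA ler_wpM2l ?absv_ge0// -/q -(prednK q0) exprS prednK//.
  by rewrite ler_wpM2r ?exprn_ge0.
have rho0 : 0 <= rho.
  have Sa : 0 < S ^+ a by exact: exprn_gt0.
  by rewrite -(pmulr_lge0 _ Sa); apply: le_trans zV; exact: absv_ge0.
(* The opposite estimate: [P(u^q, Z)] vanishes at [z], and its values at [z] and at [V^a] differ by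
   at most [rho M]. *)
have : absv G.[u] <= rho * M.
  rewrite horner_sparse hornerD hornerN hornerXn hornerC.
  have -> : u ^+ a - b ^+ a = V ^+ a.
    have [->|b0] := ab; first by rewrite !expr1.
    by rewrite /V b0 subr0 expr0n gtn_eqF// subr0.
  rewrite -[_.[_]]subr0 -(rootP Pz) !(horner_coef_wide (n := size P)) ?size_specialize//.
  rewrite -sumrB; apply: absv_sum_le => [|j _]; first by rewrite mulr_ge0// ltW.
  rewrite coef_specialize -mulrBr absvM.
  have Fj : absv (P`_j).[u ^+ q] * S ^+ (a * j) <= M.
    have -> : (P`_j).[u ^+ q] = (g j).[u ^+ q - b ^+ q].
      by rewrite /g horner_comp hornerD hornerX hornerC subrK.
    rewrite -ler_pdivlMr ?exprn_gt0//.
    rewrite (horner_coef_wide _ (gn j)); apply: absv_sum_le => [|l _].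
      by rewrite divr_ge0 ?exprn_ge0// ltW.
    rewrite ler_pdivlMr ?exprn_gt0// absvM absvX; apply: le_trans (tmax (j, l)).
    rewrite /cf /ex /= exprD mulrA ler_wpM2r ?exprn_ge0// ler_wpM2l ?absv_ge0//.
    by rewrite exprM; apply: lerXn2r; rewrite ?nnegrE ?absv_ge0 ?exprn_ge0.
  have [j0|j0] := posnP j.
    by rewrite j0 !expr0 subrr absv0 mulr0 mulr_ge0// ltW.
  have Va : absv (V ^+ a) <= S ^+ a by rewrite absvX.
  have zS : absv z <= S ^+ a.
    rewrite -[z in absv z](subKr (V ^+ a)); apply: absvD_le => //.
    rewrite absvN; apply: le_trans zV _.
    by rewrite ler_piMl ?exprn_ge0// ltW.
  have := absvBXX j Va zS => h.
  apply: le_trans (ler_wpM2l (absv_ge0 _) h) _.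
  apply: (@le_trans _ _ (absv (P`_j).[u ^+ q] * (rho * S ^+ a * (S ^+ a) ^+ j.-1))).
    by rewrite ler_wpM2l ?absv_ge0// ler_wpM2r ?exprn_ge0.
  rewrite -mulrA -exprS prednK// -exprM mulrCA.
  by rewrite ler_wpM2l.
apply/negP; rewrite -ltNge; by apply: lt_le_trans MG; rewrite gtr_pMl.
Qed.
End Orthogonality.

(** * Elements of degree less than q, and lifting *)

Section SmallDegree.
Context {R : realType} {K : closedAnalyticFieldType R}.
Variable p : nat.
Hypothesis p_prime : prime p.
Hypothesis p_small : absv (p%:R : K) < 1.
Implicit Types (F E : set K) (x u w z : K).

Lemma absv_natr_coprime a : ~~ (p %| a)%N -> absv (a%:R : K) = 1.
Proof.
move=> pa; apply/eqP; rewrite eq_le absv_natr leNgt; apply/negP => a1.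
have a0 : (0 < a)%N by case: a pa {a1} => //; rewrite dvdn0.
case: (egcdnP p a0) => k l E _; move: E.
have -> : gcdn a p = 1%N by apply/eqP; rewrite -/(coprime a p) coprime_sym prime_coprime.
move=> /(congr1 (fun n => n%:R : K)); rewrite natrD !natrM => E.
have : absv (1 : K) < 1.
  have -> : 1 = k%:R * a%:R - l%:R * p%:R :> K by rewrite E; ring.
  by apply: absvD_lt; rewrite ?absvN absvM;
    [apply: le_lt_trans a1|apply: le_lt_trans p_small];
    rewrite ler_piMl ?absv_ge0 ?absv_natr.
by rewrite absv1 ltxx.
Qed.

(** A polynomial [P(u^q, Z)] killing [z] is brought to [no_sparse_root] by centring at a point [b]
    of [F]. The roots of [G = P(X^q, X^a)] lie in [F], so for [a = 1] the nearest to [u] among them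
    and 0 can serve; otherwise 0 itself is nearest by hypothesis. *)
Lemma no_small_degree F u a m z N (r rho : R) : closed_analytic F ->
  let q := (p ^ m)%N in 0 < r -> 0 <= rho < 1 ->
  (forall d, F d -> r <= absv (u - d) ^+ q) ->
  absv (p%:R : K) * absv u ^+ q < r -> rho ^+ q * absv u ^+ q < r ->
  (0 < a)%N -> coprime q a ->
  a = 1%N \/ (forall d, F d -> absv u <= absv (u - d)) -> (N < q)%N ->
  degree_le (adjoin_elt F (u ^+ q)) N z -> rho * absv u ^+ a < absv (u ^+ a - z).
Proof.
move=> [HF cF _] q r0 /andP[rho0 rho1] far pu rhou a0 cop acase Nq.
move=> /(degree_le_adjoinP HF)[P [oP sP P0 Pz]].
rewrite ltNge; apply/negP => near.
have q0 : (0 < q)%N by rewrite expn_gt0 prime_gt0.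
pose G := sparse q P 'X^a.
have oG : G \is a polyOver (mem F).
  rewrite /G sparseE; apply: over_sum => // j _; apply: overM => //.
    by apply: over_comp => //; apply: overXn => //; exact: overX.
  by apply: overXn => //; apply: overXn => //; exact: overX.
have F0 : F 0 by exact: subfield0.
have [b [Fb bu ab bG]] : exists b, [/\ F b, absv (u - b) <= absv u,
    a = 1%N \/ b = 0 &
    G != 0 -> forall c, root G c -> absv (u - b) <= absv (u - c)].
  case: acase => [a1|ud]; last first.
    exists 0; rewrite subr0 lexx; split=> //; first by right.
    by move=> G0 c Gc; apply: ud; exact: alg_closed_root oG G0 Gc.
  have [G0|G0] := eqVneq G 0.
    by exists 0; rewrite subr0 lexx; split=> //; left.
  have [s GE] := closed_field_poly_normal G.
  have l0 : lead_coef G != 0 by rewrite lead_coef_eq0.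
  have rs c : root G c = (c \in s) by rewrite GE rootZ// root_prod_XsubC.
  have [b bs bm] := seq_argmin s (fun c => absv (u - c)) 0.
  exists b; split=> //; last 2 first.
  - by left.
  - by move=> _ c; rewrite rs => cs; apply: bm; rewrite inE cs orbT.
  - move: bs; rewrite inE => /orP[/eqP->//|]; rewrite -rs.
    exact: alg_closed_root oG G0.
  - by have := bm 0; rewrite subr0; apply; exact: mem_head.
pose S := absv (u - b).
have Sr : r <= S ^+ q by exact: far.
have S0 : 0 < S.
  rewrite lt_neqAle absv_ge0 andbT eq_sym; apply: contraTneq Sr => ->.
  by rewrite expr0n gtn_eqF// -ltNge.
have bB : absv b <= absv u.
  rewrite -[b in absv b](subKr u); apply: absvD_le => //.
  by rewrite absvN.
have aE : u ^+ a - b ^+ a = (u - b) ^+ a.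
  have [->|->] := ab; first by rewrite !expr1.
  by rewrite subr0 expr0n gtn_eqF// subr0.
pose P2 := P \Po ('X + (b ^+ a)%:P%:P).
have PX : P != 0 by apply: contraNneq P0 => ->; rewrite /specialize rmorph0.
(* The precision measured against [S^a] instead of [|u|^a]. For [a = 1] it stays below 1 because
   [rho^q |u|^q < r <= S^q]. *)
pose rho' := rho * absv u ^+ a / S ^+ a.
have Sa : 0 < S ^+ a by exact: exprn_gt0.
have rho'1 : rho' < 1.
  rewrite ltr_pdivrMr// mul1r; case: ab => [->|b0]; last first.
    by rewrite /S b0 subr0 gtr_pMl// -[absv u]/(absv u) -(subr0 u) -b0.
  rewrite !expr1 ltNge; apply/negP => h.
  have : S ^+ q <= (rho * absv u) ^+ q.
    by apply: lerXn2r; rewrite ?nnegrE ?mulr_ge0 ?absv_ge0.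
  by apply/negP; rewrite -ltNge exprMn (lt_le_trans rhou).
have zV : absv ((u - b) ^+ a - (z - b ^+ a)) <= rho' * S ^+ a.
  rewrite /rho' divfK ?gt_eqF// -aE; apply: le_trans near.
  by rewrite opprB addrA subrK.
have sPE : sparse q P2 ('X^a - (b ^+ a)%:P) = G.
  rewrite /sparse /P2 map_comp_poly /= rmorphD /= map_polyX map_polyC /= comp_polyC.
  by rewrite horner_comp hornerD hornerX hornerC subrK.
have := @no_sparse_root R K p p_prime m u b (z - b ^+ a) a P2 (absv u) rho'.
move=> /(_ S0 bu bB _ cop a0 ab _ _ rho'1 zV); rewrite sPE.
have szX : size ('X + (b ^+ a)%:P%:P : {poly {poly K}}) = 2 by rewrite size_XaddC.
have pS : absv (p%:R : K) * absv u ^+ q < S ^+ q by exact: lt_le_trans Sr.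
have sP2 : (size P2 <= q)%N.
  by rewrite size_comp_poly2//; exact: leq_trans sP Nq.
have P20 : P2 != 0 by rewrite comp_poly2_eq0.
move=> /(_ pS sP2 P20 bG)/negP; apply.
rewrite specialize_comp specialize_XaddC hornerC rootE horner_comp.
by rewrite hornerD hornerX hornerC subrK.
Qed.

(** In the equation translated to [u], the linear coefficient is dominated by [a eta u^(a-1)], the
    contribution of [u^q] being small by its factor [q]; [small_root] then bounds the correction. *)
Lemma lift_root (u eta y w : K) a q (rho : R) : u != 0 -> eta != 0 ->
  (0 < a)%N -> (0 < q)%N -> absv (a%:R : K) = 1 ->
  absv (q%:R : K) * absv u ^+ q < absv eta * absv u ^+ a ->
  u ^+ q - eta * u ^+ a = y ->
  absv (w - y) <= rho * (absv eta * absv u ^+ a) ->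
  exists2 v, v ^+ q - eta * v ^+ a = w & absv (v - u) <= rho * absv u.
Proof.
move=> u0 eta0 a0 q0 a1 qu uy wy.
pose H : {poly K} := ('X + u%:P) ^+ q - eta *: ('X + u%:P) ^+ a - w%:P.
have H0 : H`_0 = y - w.
  by rewrite -horner_coef0 /H !hornerE ?add0r uy.
have H1 : H`_1 = q%:R * u ^+ q.-1 - eta * (a%:R * u ^+ a.-1).
  have -> : H`_1 = (H^`())`_0 by rewrite coef_deriv.
  rewrite -horner_coef0 /H !derivB derivZ !deriv_exp derivC derivD derivX derivC.
  rewrite addr0 subr0 !mul1r hornerD hornerN hornerZ !hornerMn !horner_exp.
  by rewrite hornerD hornerX hornerC add0r -!(mulr_natl (u ^+ _)).
have up : 0 < absv u by rewrite absv_gt0.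
have H1u : absv H`_1 * absv u = absv eta * absv u ^+ a.
  rewrite -absvM H1 mulrBl -!mulrA -!exprSr !prednK// addrC absvDl absvN !absvM ?absvX ?a1 ?mul1r//.
have H10 : H`_1 != 0.
  rewrite -absv_gt0 -(pmulr_lgt0 _ up) H1u mulr_gt0 ?exprn_gt0 ?absv_gt0//.
have [h /rootP Hh hle] := small_root H10.
exists (h + u).
  by apply/eqP; rewrite -subr_eq0; move: Hh; rewrite /H !hornerE => ->.
rewrite addrK -(ler_pM2r (x := absv H`_1)) ?absv_gt0//.
apply: le_trans hle _; rewrite H0 absvB; apply: le_trans wy _.
by rewrite -H1u mulrCA mulrC.
Qed.

(** Solving for [v] multiplies the degree by at most [max(q, a)]; passing from [v] to the polynomial
    [c + v^q] costs nothing. *)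
Lemma degree_le_step E N (c eta v w : K) q a : is_subfield E -> E c -> E eta ->
  q != a -> (0 < q)%N -> v ^+ q - eta * v ^+ a = w - c -> degree_le E N w ->
  degree_le E (N * maxn q a) (c + v ^+ q).
Proof.
move=> HE Ec Eeta qa q0 vw Nw.
have oX n : 'X^n \is a polyOver (mem E) by apply: overXn => //; exact: overX.
have oc : c%:P \is a polyOver (mem E) by exact: overC.
have -> : c + v ^+ q = ('X^q + c%:P).[v] by rewrite !hornerE addrC.
apply: degree_le_horner => //; first exact: overD.
pose h : {poly K} := 'X^q - eta *: 'X^a + c%:P.
apply: (@degree_le_comp _ _ E N (maxn q a) h) => //.
- by apply: overD => //; apply: overD => //; apply: overN => //; exact: overZ.
- apply: leq_trans (size_polyD _ _) _; rewrite geq_max; apply/andP; split; last first.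
    exact: leq_trans (size_polyC_leq1 _) _.
  apply: leq_trans (size_polyD _ _) _; rewrite geq_max size_polyN size_polyXn ltnS leq_maxl/=.
  by apply: leq_trans (size_scale_leq _ _) _; rewrite size_polyXn ltnS leq_maxr.
- rewrite ltnNge; apply/negP => /leq_sizeP/(_ q q0)/eqP.
  rewrite /h !coefD coefN coefZ !coefXn coefC eqxx (negPf qa) gtn_eqF//.
  by rewrite mulr0 subr0 addr0 oner_eq0.
- have -> : h.[v] = w by rewrite /h !hornerE vw subrK.
  exact: Nw.
Qed.

End SmallDegree.

(** * Choice of the parameters of a step *)

Section StepParameters.
Context {R : realType} {K : closedAnalyticFieldType R}.
Variable p : nat.
Hypothesis p_prime : prime p.
Hypothesis p_small : absv (p%:R : K) < 1.
Implicit Types (F E : set K) (x u w z : K).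

Lemma expr_small_near (c b : R) : 0 <= c < 1 -> 0 < b ->
  exists n, forall m, (n <= m)%N -> c ^+ m < b.
Proof.
move=> c01 b0; have [n nb] := expr_small c01 b0; exists n => m nm.
by apply: le_lt_trans nb; have /andP[c0 c1] := c01; apply: ler_wiXn2l => //; exact: ltW.
Qed.

Lemma size_XnsubXn (eta y : K) q a : (0 < q)%N -> q != a ->
  (1 < size ('X^q - eta *: 'X^a - y%:P : {poly K})%R)%N.
Proof.
move=> q0 qa; rewrite ltnNge; apply/negP => /leq_sizeP/(_ q q0)/eqP.
rewrite !coefB coefZ !coefXn coefC eqxx (negPf qa) gtn_eqF//.
by rewrite mulr0 !subr0 oner_eq0.
Qed.

(** The Newton polygon has a single slope: [|u| < g] would give [|y| < g^q], and [|u| > g] would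
    give [|y| = |u|^q > g^q]. *)
Lemma absv_root_linear (eta y u : K) q (g : R) : (1 < q)%N -> 0 < g ->
  absv y = g ^+ q -> absv eta * g < g ^+ q -> u ^+ q - eta * u = y ->
  absv u = g.
Proof.
move=> q1 g0 yg eg uy; have q0 : (0 < q)%N by exact: ltnW.
have eg' : absv eta < g ^+ q.-1.
  by rewrite -(ltr_pM2r g0) -exprSr prednK.
have [h|h|//] := ltgtP (absv u) g.
  have : absv y < g ^+ q.
    rewrite -uy; apply: absvD_lt.
      by rewrite absvX ltrXn2r ?gtn_eqF// absv_ge0.
    rewrite absvN absvM; apply: le_lt_trans eg.
    by rewrite ler_wpM2l ?absv_ge0// ltW.
  by rewrite yg ltxx.
have up : 0 < absv u by exact: lt_trans h.
have : absv y = absv u ^+ q.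
  rewrite -uy -absvX absvDl// absvN absvM absvX -(prednK q0) exprSr ltr_pM2r//.
  apply: lt_trans eg' _; rewrite ltrXn2r ?ltW//.
  by rewrite -lt0n -ltnS prednK.
rewrite yg => E; have : g ^+ q < absv u ^+ q by rewrite ltrXn2r ?gtn_eqF// ltW.
by rewrite E ltxx.
Qed.

(** [|u|] must be known before [eta] is chosen. It is read off from a [q]-th root [u0] of [x - c];
    the term [eta u] is too small to change it, since [hi] is below the distance. *)
Lemma step_param_nontrivial F x (lo hi mu : R) q : closed_analytic F ->
  nontrivial_val F -> (1 < q)%N -> 0 < lo < hi -> hi < dist_to F x ->
  0 < mu < 1 ->
  exists c u eta, [/\ F c, F eta, u ^+ q - eta * u = x - c,
    absv u ^+ q = absv (x - c) & [/\ absv (x - c) * mu < dist_to F x,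
    absv (x - c) < 2 * dist_to F x & lo <= absv eta * absv u <= hi]].
Proof.
move=> [HF cF _] nt q1 /andP[lo0 lohi] hir /andP[mu0 mu1].
have r0 : 0 < dist_to F x by exact: lt_trans (lt_trans lo0 lohi) hir.
have F0 : F !=set0 by exists 0; exact: subfield0.
have [|c Fc] := @dist_to_lt _ _ F x (Num.min (dist_to F x / mu) (2 * dist_to F x)) F0.
  by rewrite lt_min ltr_pdivlMr// gtr_pMr// mu1 ltr_pMl// ltr1n.
rewrite lt_min ltr_pdivlMr// => /andP[xc1 xc2].
have rxc : dist_to F x <= absv (x - c) by exact: dist_to_le.
have xc0 : 0 < absv (x - c) by exact: lt_le_trans rxc.
have q0 : (0 < q)%N by exact: ltnW.
have [|u0 /rootP u0P] := elimT (closed_rootP ('X^q - (x - c)%:P)).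
  by rewrite size_XnsubC//; case: q q0 {q1}.
have u0q : u0 ^+ q = x - c by apply/eqP; rewrite -subr_eq0 -u0P !hornerE.
have g0 : 0 < absv u0.
  rewrite absv_gt0; apply: contraTneq xc0 => u00.
  by rewrite -u0q u00 expr0n gtn_eqF// absv0 ltxx.
have [|eta Feta /andP[eta1 eta2]] := @dense_val _ _ F (lo / absv u0) (hi / absv u0) HF cF nt.
  by rewrite divr_gt0//= ltr_pM2r// invr_gt0.
rewrite ltr_pdivrMr// in eta1; rewrite ltr_pdivlMr// in eta2.
have xcE : absv (x - c) = absv u0 ^+ q by rewrite -u0q absvX.
have [|u /rootP uP] := elimT (closed_rootP ('X^q - eta *: 'X^1 - (x - c)%:P)).
  by rewrite gtn_eqF// size_XnsubXn// gtn_eqF.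
have uE : u ^+ q - eta * u = x - c.
  by apply/eqP; rewrite -subr_eq0 -uP !hornerE.
have ug : absv u = absv u0.
  by apply: (absv_root_linear q1 g0 xcE _ uE); rewrite -xcE;
    apply: lt_le_trans rxc; exact: lt_trans hir.
exists c, u, eta; split=> //; first by rewrite ug.
by split=> //; rewrite ug !ltW.
Qed.

(** With coefficient 1, the size of [u^a] is adjusted through the exponent. For [g = |x|^(1/q)] the
    hypothesis on [(lo / hi)^q] says [lo <= hi g^2]: this leaves room in [[lo, hi]] for two
    consecutive powers of [g], and [p] cannot divide both exponents. *)
Lemma step_param_trivial x (lo hi : R) m : (0 < m)%N -> let q := (p ^ m)%N in
  0 < lo < hi -> hi < absv x < 1 -> (lo / hi) ^+ q <= absv x ^+ 2 ->
  exists u a, [/\ u ^+ q - u ^+ a = x, absv u ^+ q = absv x,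
    lo <= absv u ^+ a <= hi, (0 < a)%N & ~~ (p %| a)%N].
Proof.
move=> m0 q /andP[lo0 lohi] /andP[hix x1] lohiq.
have q0 : (0 < q)%N by rewrite expn_gt0 prime_gt0.
have hi0 : 0 < hi by exact: lt_trans lohi.
have x0 : 0 < absv x by exact: lt_trans hix.
have [|u0 /rootP u0P] := elimT (closed_rootP ('X^q - x%:P)).
  by rewrite size_XnsubC//; case: (q) q0.
have u0q : u0 ^+ q = x by apply/eqP; rewrite -subr_eq0 -u0P !hornerE.
have gq : absv u0 ^+ q = absv x by rewrite -absvX u0q.
set g := absv u0 in gq; have gge0 : 0 <= g by exact: absv_ge0.
have g0 : 0 < g.
  rewrite lt_neqAle gge0 andbT eq_sym; apply: contraTneq x0 => g00.
  by rewrite -gq g00 expr0n gtn_eqF// ltxx.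
have g1 : g < 1.
  rewrite ltNge; apply/negP => h; move: x1; rewrite -gq ltNge.
  by rewrite exprn_ege1.
have g2 : lo <= hi * g ^+ 2.
  rewrite mulrC -ler_pdivrMr// leNgt; apply/negP => h.
  move: lohiq; rewrite leNgt -gq exprAC => /negP; apply.
  by rewrite ltrXn2r ?gtn_eqF// ?exprn_ge0// divr_ge0 ?ltW.
have ex : exists a, g ^+ a <= hi.
  by have [|a /ltW ha] := @expr_small _ g hi _ hi0; [rewrite gge0|exists a].
case: (ex_minnP ex) => -[|a] ha amin.
  by move: ha; rewrite expr0 leNgt (lt_trans hix).
have ha' : hi < g ^+ a by rewrite ltNge; apply/negP => /amin; rewrite ltnn.
have [b [pb b0 bhi blo]] : exists b, [/\ ~~ (p %| b)%N, (0 < b)%N, g ^+ b <= hi & lo <= g ^+ b].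
  have [pa|pa] := boolP (p %| a.+1)%N; last first.
    exists a.+1; split=> //; apply: le_trans g2 _.
    rewrite [g ^+ a.+1]exprSr expr2 mulrA ler_wpM2r//.
    by apply: le_trans (ltW ha'); rewrite ler_piMr// ltW.
  exists a.+2; split=> //.
  - by rewrite -addn1 dvdn_addr// dvdn1 gtn_eqF// prime_gt1.
  - by apply: le_trans ha; rewrite [g ^+ a.+2]exprSr ler_piMr ?exprn_ge0// ltW.
  - apply: le_trans g2 _; rewrite -[a.+2]addn2 exprD ler_wpM2r ?exprn_ge0//.
    exact: ltW.
have qb : (q < b)%N.
  rewrite ltnNge; apply/negP => bq; have : g ^+ q <= g ^+ b.
    by apply: ler_wiXn2l => //; exact: ltW.
  by rewrite gq leNgt (le_lt_trans bhi).
pose H : {poly K} := 'X^q - 1 *: 'X^b - x%:P.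
(* Otherwise the Gauss norm of [H] on the unit disc would be [|H(0)| = |x| < 1], while the
   coefficient of [X^q] is 1. *)
have [u Hu u1] : exists2 u, root H u & absv u < 1.
  apply: contrapT => nou.
  have := @gauss_le_roots _ _ H 1 1 0 ler01 (lexx 1) _ q.
  have -> : H`_q = 1.
    rewrite /H !coefB coefZ !coefXn coefC eqxx (ltn_eqF qb) (gtn_eqF q0).
    by rewrite mulr0 !subr0.
  have -> : H.[0] = - x.
    rewrite /H !hornerE !expr0n (gtn_eqF q0) (gtn_eqF b0).
    by rewrite subrr sub0r.
  rewrite !expr1n absv1 absvN !mul1r leNgt x1 => /(_ _)/negP; apply=> // c Hc.
  rewrite mul1r sub0r absvN ge_max lexx andbT leNgt.
  by apply/negP => c1; apply: nou; exists c.
have uE : u ^+ q - u ^+ b = x.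
  by apply/eqP; rewrite -subr_eq0 -(rootP Hu) /H !hornerE.
have up : 0 < absv u.
  rewrite absv_gt0; apply: contraTneq x0 => uz.
  by rewrite -uE uz !expr0n !gtn_eqF// subr0 absv0 ltxx.
have uq : absv u ^+ q = absv x.
  rewrite -uE -absvX absvDl// absvN !absvX -(subnKC (ltnW qb)) exprD gtr_pMr ?exprn_gt0//.
  by rewrite exprn_ilt1 ?absv_ge0// -lt0n subn_gt0.
have ug : absv u = g.
  by apply/eqP; rewrite -(eqrXn2 q0) ?absv_ge0// uq gq.
by exists u, b; split=> //; rewrite ug blo.
Qed.

End StepParameters.

(** * One approximation step *)

Section StepExistence.
Context {R : realType} {K : closedAnalyticFieldType R}.
Variable p : nat.
Hypothesis p_prime : prime p.
Hypothesis p_small : absv (p%:R : K) < 1.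
Implicit Types (F E : set K) (x u w z : K).

(** [hi] bounds the move, [delta] is the radius to be avoided around [x], and [eps] the radius to
    which it shrinks around [x']. The factor [D] is independent of [E] and [w], so degrees can be
    tracked along a sequence of steps. *)
Lemma step_exists F x (delta hi eps : R) N : closed_analytic F ->
  0 < delta < hi -> hi < dist_to F x -> 0 < eps ->
  nontrivial_val F \/ (dist_to F x = absv x /\ absv x < 1) ->
  exists x' D, [/\ absv (x' - x) <= hi,
    forall E M w, is_subfield E -> F `<=` E -> absv (w - x) <= delta ->
      degree_le E M w -> exists2 w', degree_le E (M * D) w' & absv (w' - x') <= eps
    & forall w, absv (w - x) <= delta -> ~ degree_le (adjoin_elt F x') N w].
Proof.
move=> GF /andP[delta0 deltahi] hir eps0 cases.
have [HF cF _] := GF.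
set r := dist_to F x in hir cases.
have hi0 : 0 < hi by exact: lt_trans deltahi.
have r0 : 0 < r by exact: lt_trans hir.
(* Since [|eta u^a| >= lo > delta], the ball of radius [delta] around [x] has relative radius at
   most [rho < 1]. *)
pose lo := (delta + hi) / 2.
have [lo1 lo2] : delta < lo /\ lo < hi by rewrite /lo; split; lra.
have lo0 : 0 < lo by exact: lt_trans lo1.
pose rho := delta / lo.
have rho0 : 0 < rho by exact: divr_gt0.
have rho1 : rho < 1 by rewrite ltr_pdivrMr// mul1r.
have p1 : (1 < p)%N by exact: prime_gt1.
have p0 := prime_gt0 p_prime.
pose kappa := Num.max (rho ^+ p.-1) (absv (p%:R : K)).
have rho01 : 0 <= rho <= 1 by rewrite !ltW.
have kappa0 : 0 <= kappa by rewrite le_max absv_ge0 orbT.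
have kappa1 : kappa < 1.
  rewrite gt_max p_small andbT exprn_ilt1 ?ltW//.
  by rewrite -lt0n -ltnS prednK.
have r2 : 0 < 2 * r by rewrite mulr_gt0// ltr0n.
have e0 : 0 < eps / (2 * r) by exact: divr_gt0.
have l0 : 0 < lo / (2 * r) by exact: divr_gt0.
have lohi01 : 0 <= lo / hi < 1 by rewrite divr_ge0 ?ltW//= ltr_pdivrMr// mul1r.
have kappa01 : 0 <= kappa < 1 by rewrite kappa0.
have pp01 : 0 <= absv (p%:R : K) < 1 by rewrite absv_ge0.
have [m1 m1P] := expr_small_near kappa01 e0.
have [m2 m2P] := expr_small_near pp01 l0.
have r20 : 0 < r ^+ 2 by exact: exprn_gt0.
have [m3 m3P] := expr_small_near lohi01 r20.
(* [m1] brings the contraction below [eps], [m2] makes the derivative of [u^q] negligible, [m3]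
   serves the trivially valued case, and [N < m < q] rules out degree [N]. *)
pose m := maxn (maxn m1 m2) (maxn m3 N.+1).
have m1m : (m1 <= m)%N by rewrite /m !leq_max leqnn.
have m2m : (m2 <= m)%N by rewrite /m !leq_max leqnn orbT.
have m3m : (m3 <= m)%N by rewrite /m !leq_max leqnn !orbT.
have Nm : (N < m)%N by rewrite /m !leq_max leqnn !orbT.
have {m1P m1m}K1 := m1P m m1m; have {m2P m2m}K2 := m2P m m2m.
clearbody m; pose q := (p ^ m)%N.
have mq : (m < q)%N by exact: ltn_expl.
have {m3P}K3 : (lo / hi) ^+ q < r ^+ 2 by apply: m3P; exact: leq_trans m3m (ltnW mq).
have m0 : (0 < m)%N by exact: leq_trans Nm.
have q1 : (1 < q)%N by exact: leq_trans mq.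
have q0 : (0 < q)%N by exact: ltnW.
(* Taking [c] with [|x - c| mu < r] keeps both [|p| |u|^q] and [rho^q |u|^q] below [r]. *)
pose mu := Num.max (absv (p%:R : K)) (rho ^+ q).
have mu01 : 0 < mu < 1.
  rewrite lt_max exprn_gt0 ?orbT//= gt_max p_small/=.
  by rewrite exprn_ilt1 ?ltW// -lt0n.
have [c [u [eta [a [Fc Feta uE uq [xmu x2 etau a0 [pa acase]]]]]]] :
  exists c u eta a, [/\ F c, F eta, u ^+ q - eta * u ^+ a = x - c,
    absv u ^+ q = absv (x - c) &
    [/\ absv (x - c) * mu < r, absv (x - c) < 2 * r,
     lo <= absv eta * absv u ^+ a <= hi, (0 < a)%N &
     ~~ (p %| a)%N /\ (a = 1%N \/ absv (x - c) = r)]].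
  case: cases => [nt|[rx x1]].
    have lohi : 0 < lo < hi by rewrite lo0.
    have [c [u [eta [Fc Feta uE uq [xmu x2 etau]]]]] :=
      step_param_nontrivial GF nt q1 lohi hir mu01.
    exists c, u, eta, 1%N; split=> //; split=> //; split; last by left.
    by rewrite dvdn1 gtn_eqF.
  have lohi : 0 < lo < hi by rewrite lo0.
  have hix : hi < absv x < 1 by rewrite -{1}rx hir.
  have xlohi : (lo / hi) ^+ (p ^ m) <= absv x ^+ 2 by rewrite -rx ltW.
  have [u [a [uE uq au a0 pa]]] := step_param_trivial p_prime m0 lohi hix xlohi.
  exists 0, u, 1, a; rewrite subr0 mul1r absv1 mul1r -rx; split=> //.
  - exact: subfield0.
  - exact: subfield1.
  - by rewrite uq rx.
  have /andP[mu0 mu1] := mu01.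
  split=> //; first by rewrite gtr_pMr.
    by rewrite ltr_pMl// ltr1n.
  by split=> //; right.
have xE : x = c + (u ^+ q - eta * u ^+ a) by rewrite uE addrC subrK.
have rxc : r <= absv (x - c) by exact: dist_to_le.
have u0 : u != 0.
  rewrite -absv_gt0 lt_neqAle absv_ge0 andbT eq_sym.
  apply: contraTneq rxc => uz; rewrite -uq uz expr0n gtn_eqF// -ltNge//.
have up : 0 < absv u by rewrite absv_gt0.
have /andP[etau1 etau2] := etau.
have eta0 : eta != 0.
  apply: contraTneq etau1 => ->; rewrite absv0 mul0r -ltNge//.
have etap : 0 < absv eta by rewrite absv_gt0.
have aR : absv (a%:R : K) = 1 := absv_natr_coprime p_prime p_small pa.
have cop : coprime q a by rewrite /q coprimeXl// prime_coprime.
have qa : q != a.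
  by apply: contraTneq cop => <-; rewrite /coprime gcdnn gtn_eqF.
have qR : absv (q%:R : K) * absv u ^+ q < absv eta * absv u ^+ a.
  rewrite /q natrX absvX -/q uq; apply: lt_le_trans etau1.
  rewrite ltr_pdivlMr// in K2; apply: le_lt_trans K2.
  by rewrite ler_wpM2l ?exprn_ge0 ?absv_ge0// ltW.
have pu : absv (p%:R : K) * absv u ^+ q < r.
  rewrite uq mulrC; apply: le_lt_trans xmu.
  by rewrite ler_wpM2l ?absv_ge0// le_max lexx.
have rhou : rho ^+ q * absv u ^+ q < r.
  rewrite uq mulrC; apply: le_lt_trans xmu.
  by rewrite ler_wpM2l ?absv_ge0// le_max lexx orbT.
pose B := absv u.
(* If [|u - d|^q < r], the element [c + d^q - eta d^a] of [F] would be closer to [x] than [r]. *)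
have far d : F d -> r <= absv (u - d) ^+ q.
  move=> Fd; rewrite leNgt; apply/negP => h.
  have hu : absv (d - u) <= absv u.
    rewrite absvB leNgt; apply/negP => h'.
    have : absv u ^+ q < absv (u - d) ^+ q by rewrite ltrXn2r ?gtn_eqF// ltW.
    rewrite uq => /lt_trans/(_ h); apply/negP; rewrite -leNgt//.
  have dB : absv d <= absv u.
    by rewrite -[d](subrK u); apply: absvD_le.
  have : absv (x - (c + (d ^+ q - eta * d ^+ a))) < r.
    have -> : x - (c + (d ^+ q - eta * d ^+ a)) =
      - (d ^+ q - u ^+ q) + eta * (d ^+ a - u ^+ a).
      by rewrite opprD addrA -uE; ring.
    apply: absvD_lt; last first.
      apply: le_lt_trans hir; apply: le_trans etau2; rewrite absvM ler_wpM2l ?absv_ge0//.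
      apply: absvD_le; rewrite ?absvN absvX; last exact: lexx.
      by apply: lerXn2r; rewrite ?nnegrE ?absv_ge0.
    rewrite absvN -[d in d ^+ q](subrKC u).
    apply: le_lt_trans (absv_exprD_exp p_prime m (lexx _) hu) _.
    rewrite gt_max absvB h/=; apply: le_lt_trans pu; rewrite -/q -mulrA.
    rewrite ler_wpM2l ?absv_ge0// -[X in _ <= _ ^+ X](prednK q0) exprS.
    by rewrite ler_wpM2r ?exprn_ge0 ?absv_ge0// absvB.
  apply/negP; rewrite -leNgt; apply: dist_to_le.
  apply: subfieldD => //; apply: subfieldB => //; first exact: subfieldX.
  by apply: subfieldM => //; exact: subfieldX.
exists (c + u ^+ q), (maxn q a); split.
- have -> : c + u ^+ q - x = eta * u ^+ a.
    by rewrite [X in _ - X]xE; ring.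
  by rewrite absvM absvX.
- move=> E M w HE FE wx Mw.
  have wy : absv (w - c - (x - c)) <= rho * (absv eta * absv u ^+ a).
    have -> : w - c - (x - c) = w - x by ring.
    apply: le_trans wx _.
    by rewrite /rho mulrAC ler_pdivlMr// ler_pM2l.
  have [v vE vu] := lift_root u0 eta0 a0 q0 aR qR uE wy.
  exists (c + v ^+ q).
    by apply: degree_le_step vE Mw => //; exact: FE.
  have -> : c + v ^+ q - (c + u ^+ q) = v ^+ q - u ^+ q by ring.
  have := absv_expB_exp p_prime m rho01 (ltW kappa1) _ _ (lexx (absv u)) vu.
  rewrite !le_max !lexx orbT => /(_ isT isT)/le_trans; apply.
  rewrite -/q uq; rewrite ltr_pdivlMr// in K1; apply: le_trans (ltW K1).
  apply: ler_pM; [| exact: absv_ge0 | | exact: ltW].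
    by rewrite mulr_ge0 ?exprn_ge0// ltW.
  by rewrite ler_piMl ?exprn_ge0// ltW.
move=> w wx Nw.
pose E := adjoin_elt F (c + u ^+ q).
have HE : is_subfield E by exact: is_subfield_adjoin.
have FE : F `<=` E by exact: sub_adjoin.
(* [F(x')] is contained in [F(u^q)], and [(x' - w) / eta] differs from [u^a] by [(x - w) / eta], so
   closeness of [w] to [x] becomes closeness to [u^a]. *)
have Nz : degree_le E N ((c + u ^+ q - w) / eta).
  have -> : (c + u ^+ q - w) / eta = (eta^-1 *: ((c + u ^+ q)%:P - 'X)).[w].
    by rewrite !hornerE mulrC.
  have oC := overC HE (@mem_adjoin _ _ F (c + u ^+ q)).
  apply: degree_le_horner => //; apply: overZ => //.
    exact: (subfieldV HE (FE _ Feta)).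
  by apply: overD => //; apply: overN => //; exact: overX.
have {}Nz : degree_le (adjoin_elt F (u ^+ q)) N ((c + u ^+ q - w) / eta).
  apply: degree_leS Nz => //; apply: adjoin_min.
  - exact: is_subfield_adjoin.
  - exact: sub_adjoin.
  - apply: (subfieldD (is_subfield_adjoin F (u ^+ q))); last exact: mem_adjoin.
    exact: sub_adjoin.
have Nq : (N < q)%N by exact: ltn_trans Nm mq.
have rho01' : 0 <= rho < 1 by rewrite ltW.
have acase' : a = 1%N \/ (forall d, F d -> absv u <= absv (u - d)).
  case: acase => [|xr]; [by left|right => d Fd].
  rewrite leNgt; apply/negP => h; have := far d Fd; rewrite -xr -uq leNgt.
  by rewrite ltrXn2r ?gtn_eqF ?absv_ge0.
have := no_small_degree p_prime GF r0 rho01' far pu rhou a0 cop acase' Nq Nz.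
have -> : u ^+ a - (c + u ^+ q - w) / eta = (w - x) / eta.
  rewrite xE.
  by field; exact: eta0.
rewrite absvM absvV ltr_pdivlMr//; apply/negP; rewrite -leNgt.
apply: le_trans wx _; rewrite -mulrA [_ * absv eta]mulrC.
by rewrite /rho mulrAC ler_pdivlMr// ler_pM2l.
Qed.

End StepExistence.

(** * Intermediate fields of prescribed radius *)

Section Perturbation.
Context {R : realType} {K : closedAnalyticFieldType R}.
Implicit Types (F E : set K) (x y t z : K).

(** Relative errors do not add up: a product of factors with relative error at most [eps] again has
    relative error at most [eps]. *)
Lemma horner_near (f : {poly K}) y y' (eps : R) : 0 <= eps <= 1 ->
  (forall c, root f c -> absv (y - y') <= eps * absv (y' - c)) ->
  absv (f.[y] - f.[y']) <= eps * absv f.[y'].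
Proof.
move=> /andP[eps0 eps1] fy; have [->|f0] := eqVneq f 0.
  by rewrite !horner0 subrr absv0 mulr0.
have [s fE] := closed_field_poly_normal f.
have l0 : lead_coef f != 0 by rewrite lead_coef_eq0.
have sy c : c \in s -> absv (y - y') <= eps * absv (y' - c).
  by move=> cs; apply: fy; rewrite fE rootZ// root_prod_XsubC.
rewrite fE !hornerZ -mulrBr !absvM mulrCA ler_wpM2l ?absv_ge0//.
elim: s sy {fE} => [|c s IH] sy.
  by rewrite big_nil !hornerC subrr absv0 mulr_ge0 ?absv_ge0.
rewrite big_cons !hornerM !hornerXsubC; set g := (\prod_(_ <- _) _) in IH *.
have {}IH : absv (g.[y] - g.[y']) <= eps * absv g.[y'].
  by apply: IH => d ds; apply: sy; rewrite inE ds orbT.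
have yc := sy c (mem_head _ _).
have -> : (y - c) * g.[y] - (y' - c) * g.[y'] =
  (y - c) * (g.[y] - g.[y']) + (y - y') * g.[y'] by ring.
rewrite absvM; apply: absvD_le; rewrite absvM; last first.
  by rewrite mulrA ler_wpM2r ?absv_ge0.
rewrite mulrCA; apply: ler_pM; rewrite ?absv_ge0//.
have -> : y - c = (y - y') + (y' - c) by ring.
by apply: absvD_le => //; apply: le_trans yc _; rewrite ler_piMl ?absv_ge0.
Qed.

(** [y'] is far from the roots in [F] of the coefficients of [P], so each coefficient of [P(y', Z)]
    is relatively close to that of [P(y, Z)], which kills [z]. Were no root of [P(y', Z)] within [s]
    of [z], the Gauss estimate at [z] would make the largest coefficient smaller than itself. *)
Lemma perturb_degree F N (C s r : R) : closed_analytic F -> 0 < s -> 0 < r ->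
  exists2 e, 0 < e & forall y y' z, (forall c, F c -> r <= absv (y' - c)) ->
    absv (y - y') <= e -> absv z <= C -> degree_le (adjoin_elt F y) N z ->
    exists2 z', degree_le (adjoin_elt F y') N z' & absv (z - z') < s.
Proof.
move=> [HF cF _]; wlog s1 : s / s <= 1.
  move=> h s0 r0; have [| |e e0 eP] := h (Num.min s 1) _ _ r0.
  - by rewrite ge_min lexx orbT.
  - by rewrite lt_min s0 ltr01.
  exists e => // y y' z y'F yy' zC /(eP _ _ _ y'F yy' zC)[z' z'N].
  by rewrite lt_min => /andP[zz' _]; exists z'.
move=> s0 r0; pose C1 := Num.max 1 C.
have C11 : 1 <= C1 by rewrite le_max lexx.
have C10 : 0 < C1 := lt_le_trans ltr01 C11.
(* [A] bounds [max(s, |c|) / |z - c|] for roots [c] with [|z - c| >= s]; [L] gathers [A^N] from the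
   Gauss estimate and [C1^N] from the powers of [z]. *)
pose A := C1 / s.
have A1 : 1 <= A by rewrite ler_pdivlMr// mul1r (le_trans s1).
have A0 : 0 < A := lt_le_trans ltr01 A1.
pose L := A ^+ N * C1 ^+ N.
have L0 : 0 < L by rewrite mulr_gt0 ?exprn_gt0.
pose eps := Num.min 1 (s ^+ N / (2 * L)).
have two0 : (0 : R) < 2 by rewrite ltr0n.
have eps0 : 0 < eps.
  by rewrite /eps lt_min ltr01/=; apply: divr_gt0; [exact: exprn_gt0|exact: mulr_gt0].
have eps1 : eps <= 1 by rewrite /eps ge_min lexx.
have epsL : eps * L < s ^+ N.
  apply: (@le_lt_trans _ _ (s ^+ N / 2)).
    by rewrite -ler_pdivlMr// -mulrA -invfM /eps ge_min lexx orbT.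
  by rewrite ltr_pdivrMr// ltr_pMr ?exprn_gt0// ltr1n.
exists (eps * r); first exact: mulr_gt0.
move=> y y' z y'F yy' zC Nz.
have [P [oP sP P0 Pz]] := degree_le_adjoinP HF Nz.
pose Q := specialize y' P.
have nearP j : absv ((P`_j).[y] - (P`_j).[y']) <= eps * absv (P`_j).[y'].
  have [->|j0] := eqVneq P`_j 0; first by rewrite !horner0 subrr absv0 mulr0.
  apply: horner_near => [|c jc]; first by rewrite ltW.
  apply: le_trans yy' _; apply: ler_wpM2l; [exact: ltW|apply: y'F].
  exact: alg_closed_root (oP j) j0 jc.
have Q0 : Q != 0.
  apply: contraNneq P0 => Q0; apply/eqP/polyP => j; rewrite coef0 coef_specialize.
  have := nearP j; rewrite -[_.[y']]coef_specialize -/Q Q0 coef0 absv0 mulr0 subr0.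
  by move=> h; apply/eqP; rewrite -absv_eq0 eq_le h absv_ge0.
have sQ : (size Q <= N.+1)%N by exact: leq_trans (size_specialize _ _) sP.
have sQ0 : (0 < size Q)%N by rewrite size_poly_gt0.
pose j0 : 'I_(size Q) := Ordinal sQ0.
have [jm jmax] := fin_argmax (fun j : 'I_(size Q) => absv Q`_j) j0.
have M0 : 0 < absv Q`_jm.
  have lt : ((size Q).-1 < size Q)%N by rewrite ltn_predL.
  apply: lt_le_trans (jmax (Ordinal lt)).
  by rewrite /= absv_gt0 -lead_coefE lead_coef_eq0.
have Qmax j : absv Q`_j <= absv Q`_jm.
  have [jlt|jge] := ltnP j (size Q); first exact: (jmax (Ordinal jlt)).
  by rewrite nth_default// absv0 ltW.
apply: contrapT => noz.
have far c : root Q c -> s <= absv (z - c).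
  move=> Qc; rewrite leNgt; apply/negP => zc; apply: noz; exists c => //.
  exact: degree_le_adjoin Q0 Qc.
have zC1 : absv z <= C1 by rewrite le_max zC orbT.
have := @gauss_le_roots _ _ Q s A z (ltW s0) A1 _ jm.
have rootA c : root Q c -> Num.max s (absv c) <= A * absv (z - c).
  move=> /far sc; have CA : C1 <= A * absv (z - c).
    by rewrite /A -mulrA ler_peMr ?(ltW C10)// mulrC ler_pdivlMr// mul1r.
  have zcA : absv (z - c) <= A * absv (z - c) by rewrite ler_peMl ?absv_ge0.
  rewrite ge_max (le_trans sc)//= -[c in absv c](subKr z); apply: absvD_le.
    exact: le_trans zC1 CA.
  by rewrite absvN.
move=> /(_ rootA); apply/negP; rewrite -ltNge.
have Qz : absv Q.[z] <= eps * (absv Q`_jm * C1 ^+ N).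
  have -> : Q.[z] = Q.[z] - (specialize y P).[z] by rewrite (rootP Pz) subr0.
  rewrite !(horner_coef_wide (n := N.+1))//; last first.
    exact: leq_trans (size_specialize _ _) sP.
  rewrite -sumrB; apply: absv_sum_le => [|j _].
    by rewrite !mulr_ge0 ?exprn_ge0 ?absv_ge0 ?ltW.
  rewrite -mulrBl absvM absvX mulrA; apply: ler_pM; rewrite ?exprn_ge0 ?absv_ge0//.
    rewrite !coef_specialize absvB; apply: le_trans (nearP j) _.
    by apply: ler_wpM2l; [exact: ltW|have := Qmax j; rewrite !coef_specialize].
  apply: (@le_trans _ _ (C1 ^+ j)); first by apply: lerXn2r; rewrite ?nnegrE ?absv_ge0// ltW.
  by apply: ler_weXn2l => //; rewrite -ltnS.
apply: (@le_lt_trans _ _ (A ^+ N * (eps * (absv Q`_jm * C1 ^+ N)))).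
  apply: ler_pM; rewrite ?exprn_ge0 ?absv_ge0 ?(ltW A0)//.
  by apply: ler_weXn2l => //; rewrite -ltnS prednK.
have -> : A ^+ N * (eps * (absv Q`_jm * C1 ^+ N)) = absv Q`_jm * (eps * L).
  by rewrite /L; ring.
rewrite ltr_pM2l//; apply: lt_le_trans epsL _.
by apply: ler_wiXn2l; rewrite ?(ltW s0)// -ltnS (leq_trans _ sQ).
Qed.

Lemma dist_to_near F x t : F !=set0 -> absv (x - t) < dist_to F t ->
  dist_to F x = dist_to F t.
Proof.
move=> F0 xt; have E c : F c -> absv (x - c) = absv (t - c).
  move=> Fc; have tc : absv (x - t) < absv (t - c).
    by apply: lt_le_trans xt _; exact: dist_to_le.
  have -> : x - c = (x - t) + (t - c) by ring.
  exact: absvDr.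
by congr inf; apply/seteqP; split=> _ [c Fc <-]; exists c => //; rewrite E.
Qed.

End Perturbation.

Section Between.
Context {R : realType} {K : closedAnalyticFieldType R}.
Variable p : nat.
Hypothesis p_prime : prime p.
Hypothesis p_small : absv (p%:R : K) < 1.
Implicit Types (F E : set K) (x y t z : K).

(* The field is the completed algebraic closure of [F(y)], with [y] the limit
   of the elements [x n] given by [step_exists]: no element of degree at most
   [n] over [F(x n)] is within [s] of [t], and by [perturb_degree] this
   persists in the limit for every [n]. *)
Lemma exists_between F t (s : R) : closed_analytic F ->
  0 < s < dist_to F t ->
  nontrivial_val F \/ (dist_to F t = absv t /\ absv t < 1) ->
  exists F', [/\ closed_analytic F', F `<=` F', s <= dist_to F' t &
    dist_to F' t < dist_to F t].
Proof.
move=> GF /andP[s0 sr] cases; have [HF cF _] := GF.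
have F0 : F !=set0 by exists 0; exact: subfield0.
set r := dist_to F t in sr cases *.
have r0 : 0 < r by exact: lt_trans sr.
pose C := Num.max (absv t) s.
have /choice[pert pertP] : forall N, exists e, 0 < e /\
    forall y y' z, (forall c, F c -> r <= absv (y' - c)) ->
    absv (y - y') <= e -> absv z <= C -> degree_le (adjoin_elt F y) N z ->
    exists2 z', degree_le (adjoin_elt F y') N z' & absv (z - z') < s.
  by move=> N; have [e e0 eP] := perturb_degree N C GF s0 r0; exists e.
pose e0 := (s + r) / 2.
have [se0 e0r] : s < e0 /\ e0 < r by rewrite /e0; split; lra.
(* Halving gives convergence; the bound by [pert] keeps the limit close enough to each [x n] for
   degree [n]. *)
pose e := fix e n := if n is m.+1 then Num.min (e m / 2) (pert m.+1) else e0.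
have eS n : e n.+1 = Num.min (e n / 2) (pert n.+1) by [].
have epos n : 0 < e n.
  elim: n => [|n IH]; first exact: lt_trans se0.
  by rewrite eS lt_min divr_gt0 ?ltr0n//=; have [] := pertP n.+1.
have e2 n : 0 < e n.+1 <= e n / 2 by rewrite epos eS ge_min lexx.
have ele n : e n <= e0.
  elim: n => // n IH; have /andP[_ h] := e2 n; apply: le_trans h _.
  have := epos n; lra.
have epert n : e n.+1 <= pert n.+1 by rewrite eS ge_min lexx orbT.
have e00 : e 0%N = e0 by [].
(* The radius avoided around [x n]: [s] at first, later half of [e n], since a step moves by more
   than the radius it avoids. *)
clearbody e; pose d n := if n is m.+1 then e m.+1 / 2 else s.
have d01 n : 0 < d n < e n.
  case: n => [|n] /=; first by rewrite s0 e00.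
  by have := epos n.+1; lra.
have nearF x : absv (x - t) <= e0 -> dist_to F x = r.
  by move=> xt; apply: dist_to_near => //; exact: le_lt_trans e0r.
(* The degree to exclude is [n.+1] times the product of the earlier factors: an element of degree
   [n.+1] near [t] may acquire it when transferred near [x n]. The premise makes the choice total,
   including points far from [t]. *)
have /choice[step stepP] : forall nx : nat * (K * nat), exists xD : K * nat,
    absv (nx.2.1 - t) <= e0 ->
    [/\ absv (xD.1 - nx.2.1) <= e nx.1,
      forall E M w, is_subfield E -> F `<=` E -> absv (w - nx.2.1) <= d nx.1 ->
        degree_le E M w ->
        exists2 w', degree_le E (M * xD.2) w' & absv (w' - xD.1) <= d nx.1.+1
    & forall w, absv (w - nx.2.1) <= d nx.1 ->
        ~ degree_le (adjoin_elt F xD.1) (nx.1.+1 * nx.2.2) w].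
  move=> [n [x Q]] /=; have [xt|xt] := leP (absv (x - t)) e0; last first.
    by exists (x, Q) => h.
  have rx := nearF x xt.
  have erx : e n < dist_to F x by rewrite rx; apply: le_lt_trans e0r.
  have dn0 : 0 < d n.+1 by have /andP[] := d01 n.+1.
  have casesx : nontrivial_val F \/ (dist_to F x = absv x /\ absv x < 1).
    case: cases => [|[rt t1]]; [by left|right].
    suff -> : absv x = absv t by rewrite rx.
    have -> : x = t + (x - t) by rewrite addrC subrK.
    by apply: absvDl; rewrite -rt; exact: le_lt_trans e0r.
  have [x' [D [x'x stepE stepF]]] :=
    step_exists p_prime p_small (n.+1 * Q) GF (d01 n) erx dn0 casesx.
  by exists (x', D).
pose st := fix st n : K * nat :=
  if n is m.+1 then ((step (m, st m)).1, ((st m).2 * (step (m, st m)).2)%N) else (t, 1%N).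
have stS n : st n.+1 = ((step (n, st n)).1, ((st n).2 * (step (n, st n)).2)%N) by [].
have st0 : st 0%N = (t, 1%N) by [].
clearbody st.
pose x n := (st n).1; pose Q n := (st n).2.
have xt n : absv (x n - t) <= e0.
  elim: n => [|n IH]; first by rewrite /x st0 subrr absv0 ltW// (lt_trans _ se0).
  have [h _ _] := stepP (n, st n) IH.
  by rewrite /x stS /=; apply: absv_dist_le IH; apply: le_trans h _.
have xstep n : absv (x n.+1 - x n) <= e n.
  by have [h _ _] := stepP (n, st n) (xt n); rewrite /x stS.
have [y yx] := cauchy_limit e2 xstep.
have xF n c : F c -> r <= absv (x n - c).
  by move=> Fc; rewrite -(nearF _ (xt n)); exact: dist_to_le.
have transfer E n M w : is_subfield E -> F `<=` E -> absv (w - t) <= s ->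
    degree_le E M w ->
    exists2 w', degree_le E (M * Q n) w' & absv (w' - x n) <= d n.
  move=> HE FE wt Mw; elim: n => [|n [w' w'M w'x]].
    by exists w; rewrite /x /Q st0 //= muln1.
  have [_ h _] := stepP (n, st n) (xt n).
  have [w2 w2M w2x] := h E _ w' HE FE w'x w'M.
  by exists w2; rewrite /x /Q stS //= mulnA.
have far n z : degree_le (adjoin_elt F (x n.+1)) n.+1 z -> s < absv (z - t).
  move=> zn; rewrite ltNge; apply/negP => zt.
  have [w' w'M w'x] := transfer _ n _ _ (is_subfield_adjoin F (x n.+1))
    (@sub_adjoin _ _ F (x n.+1)) zt zn.
  have [_ _ h] := stepP (n, st n) (xt n); apply: (h w' w'x).
  by move: w'M; rewrite /x stS.
pose F' := completion_in (alg_closure_in (adjoin_elt F y)).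
have HA := is_subfield_adjoin F y.
have GF' : closed_analytic F' by exact: closed_analytic_closure.
have subF' : adjoin_elt F y `<=` F'.
  by move=> z zA; apply: sub_completion; exact: sub_alg_closure.
have F'y : F' y by apply: subF'; exact: mem_adjoin.
exists F'; split=> //.
- by move=> z Fz; apply: subF'; exact: sub_adjoin.
- apply: dist_to_ge; first by exists y.
  move=> c F'c; rewrite leNgt; apply/negP => tc.
  have /completion_inP/(_ s s0)[z [q [q0 oq qz]] cz] := F'c.
  have tz : absv (z - t) < s by rewrite absvB; exact: absv_dist_lt tc cz.
  (* Any bound on the degree serves; a successor matches the index in [far]. *)
  have zN : degree_le (adjoin_elt F y) (size q).+1 z.
    by exists q; split=> //; rewrite -addn2 leq_addr.
  have [_ pert'] := pertP (size q).+1.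
  have yx' : absv (y - x (size q).+1) <= pert (size q).+1.
    exact: le_trans (yx _) (epert _).
  have zC : absv z <= C.
    rewrite -[z](subrK t); apply: absvD_le; rewrite le_max; last by rewrite lexx.
    by rewrite (ltW tz) orbT.
  have [z' z'N zz'] := pert' y (x (size q).+1) z (xF _) yx' zC zN.
  have := far _ _ z'N; apply/negP; rewrite -leNgt ltW//.
  by apply: absv_dist_lt tz; rewrite absvB.
- apply: le_lt_trans (dist_to_le t F'y) _.
  by rewrite absvB; have := yx 0%N; rewrite /x st0 e00 => /le_lt_trans; apply.
Qed.

End Between.

(** * Trivially valued base fields *)

Section Trivial.
Context {R : realType} {K : closedAnalyticFieldType R}.
Implicit Types (F E k : set K) (x y t z T : K).

Definition trivial_val F := forall d, F d -> d != 0 -> absv d = 1.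

Lemma trivialP F : trivial_val F \/ nontrivial_val F.
Proof.
have [nt|nt] := pselect (nontrivial_val F); [by right|left => d Fd d0].
by apply: contrapT => /eqP d1; apply: nt; exists d; rewrite ?d0.
Qed.

Lemma trivial_le1 F d : trivial_val F -> F d -> absv d <= 1.
Proof.
move=> tF Fd; have [->|d0] := eqVneq d 0; first by rewrite absv0 ler01.
by rewrite tF.
Qed.

Lemma trivial_dist F T : is_subfield F -> trivial_val F -> absv T != 1 ->
  dist_to F T = absv T.
Proof.
move=> HF tF T1; have F0 : F 0 by exact: subfield0.
apply/eqP; rewrite eq_le; apply/andP; split.
  by have := dist_to_le T F0; rewrite subr0.
apply: dist_to_ge => [|c Fc]; first by exists 0.
have [->|c0] := eqVneq c 0; first by rewrite subr0.
have c1 : absv (- c) = 1 by rewrite absvN tF.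
have [h|h|h] := ltgtP (absv T) 1; last by rewrite h eqxx in T1.
  by rewrite absvDr c1// ltW.
by rewrite absvDl ?c1.
Qed.

(** In a vanishing sum the largest absolute value is attained at least twice. *)
Lemma two_terms (Q : {poly K}) x : Q != 0 -> root Q x -> x != 0 ->
  exists i j, [/\ (i < j)%N, Q`_i != 0, Q`_j != 0 &
    absv Q`_i * absv x ^+ i = absv Q`_j * absv x ^+ j].
Proof.
move=> Q0 Qx x0; have sQ : (0 < size Q)%N by rewrite size_poly_gt0.
have [jm jmax] := fin_argmax (fun j : 'I_(size Q) => absv (Q`_j * x ^+ j)) (Ordinal sQ).
have lt : ((size Q).-1 < size Q)%N by rewrite ltn_predL.
have M0 : 0 < absv (Q`_jm * x ^+ jm).
  apply: lt_le_trans (jmax (Ordinal lt)).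
  by rewrite /= absv_gt0 mulf_neq0 ?expf_neq0// -lead_coefE lead_coef_eq0.
have [i ijm iE] : exists2 i : 'I_(size Q), i != jm &
    absv (Q`_i * x ^+ i) = absv (Q`_jm * x ^+ jm).
  apply: contrapT => noi.
  have : absv (Q`_jm * x ^+ jm) < absv (Q`_jm * x ^+ jm).
    have E : Q`_jm * x ^+ jm = - \sum_(i < size Q | i != jm) Q`_i * x ^+ i.
      by apply/eqP; move: (rootP Qx); rewrite horner_coef (bigD1 jm)//= => /eqP; rewrite addr_eq0.
    rewrite [X in absv X < _]E absvN; apply: absv_sum_lt => // i ijm.
    rewrite lt_neqAle jmax andbT; apply/eqP => iE; apply: noi.
    by exists i.
  by rewrite ltxx.
have Qi0 : Q`_i != 0 by apply: contraTneq M0 => Qi; rewrite -iE Qi mul0r absv0 ltxx.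
have Qjm0 : Q`_jm != 0 by apply: contraTneq M0 => Qi; rewrite Qi mul0r absv0 ltxx.
move: iE; rewrite !absvM !absvX => iE.
have [h|h|h] := ltngtP i jm; last by case/eqP: ijm; exact: val_inj.
  by exists i, jm.
by exists jm, i.
Qed.

Lemma approx_root k t x (e : R) : is_subfield k ->
  completion_in (alg_closure_in (adjoin_elt k t)) = [set: K] -> 0 < e ->
  exists x' P, [/\ absv (x - x') < e, over2 k P, specialize t P != 0 &
    root (specialize t P) x'].
Proof.
move=> Hk gen e0.
have /completion_inP/(_ e e0)[x' [p [p0 op px]] xx'] :
  completion_in (alg_closure_in (adjoin_elt k t)) x by rewrite gen.
have [|P [oP _ P0 Pz]] := @degree_le_adjoinP _ _ k t (size p) x' Hk.
  by exists p.
by exists x', P.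
Qed.

Variables (k : set K) (t : K).
Hypothesis Gk : closed_analytic k.
Hypothesis tk : trivial_val k.
Hypothesis gen : completion_in (alg_closure_in (adjoin_elt k t)) = [set: K].
Hypothesis K_nt : nontrivial_val [set: K].

Let Hk : is_subfield k. Proof. by case: Gk. Qed.
Let ck : is_alg_closed k. Proof. by case: Gk. Qed.

(** If [|t - c| = 1] for all [c] in [k], then [|f(t)| = 1] for every nonzero [f] over [k]. Two equal
    terms in an algebraic equation then force absolute value 1, and [K] would be trivially
    valued. *)
Lemma trivial_center : exists2 c, k c & absv (t - c) != 1.
Proof.
apply: contrapT => noc.
have tc c : k c -> absv (t - c) = 1.
  by move=> kc; apply: contrapT => /eqP h; apply: noc; exists c.
have f1 (f : {poly K}) : f \is a polyOver (mem k) -> f != 0 -> absv f.[t] = 1.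
  move=> of_ f0; have [s fE] := closed_field_poly_normal f.
  have l0 : lead_coef f != 0 by rewrite lead_coef_eq0.
  have ks c : c \in s -> k c.
    move=> cs; apply: alg_closed_root of_ f0 _ => //.
    by rewrite fE rootZ// root_prod_XsubC.
  have kl : k (lead_coef f) by exact: over_coef.
  rewrite fE hornerZ absvM (tk kl l0) mul1r.
  elim: s ks {fE} => [|c s IH] ks; first by rewrite big_nil hornerC absv1.
  rewrite big_cons hornerM hornerXsubC absvM tc ?mul1r; last exact/ks/mem_head.
  by apply: IH => d ds; apply: ks; rewrite inE ds orbT.
have [x _ /andP[x0 x1]] := K_nt.
have ax0 : 0 < absv x by rewrite absv_gt0.
have [x' [P [xx' oP P0 Px']]] := approx_root x Hk gen ax0.
have x'x : absv x' = absv x.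
  by rewrite -[x' in LHS](subKr x) absvDl// absvN.
have x'0 : x' != 0 by rewrite -absv_gt0 x'x.
have [i [j [ij Qi Qj]]] := two_terms P0 Px' x'0.
rewrite !coef_specialize in Qi Qj *.
have nz l : (P`_l).[t] != 0 -> P`_l != 0.
  by apply: contraNneq => ->; rewrite horner0.
rewrite !f1 ?nz// !mul1r x'x -(subnKC (ltnW ij)) exprD => E.
have : absv x ^+ (j - i) = 1 ^+ (j - i).
  apply: (mulfI (expf_neq0 i (lt0r_neq0 ax0))).
  by rewrite -E expr1n mulr1.
have ji : (0 < j - i)%N by rewrite subn_gt0.
move/eqP; rewrite eqrXn2 ?absv_ge0 ?ler01//; exact/negP.
Qed.

Section Center.
Variable c0 : K.
Hypothesis kc0 : k c0.
Let T := t - c0.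
Hypothesis T1 : absv T != 1.
Hypothesis T0 : T != 0.

(** The absolute value on [k(t)] is given by the order at [c0] if [|T| < 1] and by the degree if
    [|T| > 1]: each factor [t - c] is [T] or a nonzero constant, up to a smaller term. *)
Lemma trivial_leading (f : {poly K}) : f \is a polyOver (mem k) -> f != 0 ->
  exists e al, [/\ k al, al != 0 & absv (f.[t] - al * T ^+ e) < absv T ^+ e].
Proof.
have Tp : 0 < absv T by rewrite absv_gt0.
move=> of_ f0; have [s fE] := closed_field_poly_normal f.
have l0 : lead_coef f != 0 by rewrite lead_coef_eq0.
have ks c : c \in s -> k c.
  move=> cs; apply: alg_closed_root of_ f0 _ => //.
  by rewrite fE rootZ// root_prod_XsubC.
have kl : k (lead_coef f) by exact: over_coef.
pose lead x := exists e al, [/\ k al, al != 0 & absv (x - al * T ^+ e) < absv T ^+ e].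
have leadM x y : lead x -> lead y -> lead (x * y).
  move=> [e [al [kal al0 xe]]] [e' [al' [kal' al'0 ye]]].
  exists (e + e')%N, (al * al'); split; [exact: subfieldM|exact: mulf_neq0|].
  have -> : x * y - al * al' * T ^+ (e + e') =
    (x - al * T ^+ e) * (y - al' * T ^+ e') +
    (al' * T ^+ e' * (x - al * T ^+ e) + al * T ^+ e * (y - al' * T ^+ e')).
    by rewrite exprD; ring.
  have Te n : 0 < absv T ^+ n by exact: exprn_gt0.
  rewrite exprD; apply: absvD_lt; [|apply: absvD_lt]; rewrite !absvM ?absvX.
  - apply: (@le_lt_trans _ _ (absv T ^+ e * absv (y - al' * T ^+ e'))).
      by rewrite ler_wpM2r ?absv_ge0// ltW.
    by rewrite ltr_pM2l.
  - by rewrite (tk kal' al'0) mul1r mulrC ltr_pM2r.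
  - by rewrite (tk kal al0) mul1r ltr_pM2l.
rewrite -/(lead _) fE hornerZ; apply: (leadM _ _).
  by exists 0%N, (lead_coef f); split; rewrite // expr0 mulr1 subrr absv0 ltr01.
elim: s ks {fE} => [|c s IH] ks.
  exists 0%N, 1; split; [exact: subfield1|exact: oner_neq0|].
  by rewrite big_nil hornerC !expr0 mulr1 subrr absv0 ltr01.
rewrite big_cons hornerM hornerXsubC; apply: (leadM _ _); last first.
  by apply: IH => d ds; apply: ks; rewrite inE ds orbT.
have kc : k c by apply: ks; rewrite mem_head.
pose d := c0 - c; have kd : k d by exact: subfieldB.
have tcE : t - c = T + d by rewrite /T /d; ring.
have [h|h|h] := ltgtP (absv T) 1; last by have := T1; rewrite h eqxx.
  have [d0|d0] := eqVneq d 0.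
    exists 1%N, 1; split; [exact: subfield1|exact: oner_neq0|].
    by rewrite tcE d0 addr0 expr1 mul1r subrr absv0.
  by exists 0%N, d; split; rewrite // tcE !expr0 mulr1 addrK.
exists 1%N, 1; split; [exact: subfield1|exact: oner_neq0|].
rewrite tcE !expr1 mul1r addrC addKr.
by apply: le_lt_trans h; exact: (trivial_le1 tk kd).
Qed.

(** Two terms of equal size in an equation for [x] over [k(t)], whose coefficients have powers of
    [|T|] as absolute values, give the relation; an exponent on each side avoids negative powers. *)
Lemma trivial_value x : x != 0 -> exists m a b, (0 < m)%N /\
  absv x ^+ m * absv T ^+ a = absv T ^+ b.
Proof.
move=> x0; have ax0 : 0 < absv x by rewrite absv_gt0.
have [x' [P [xx' oP P0 Px']]] := approx_root x Hk gen ax0.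
have x'x : absv x' = absv x.
  by rewrite -[x' in LHS](subKr x) absvDl// absvN.
have x'0 : x' != 0 by rewrite -absv_gt0 x'x.
have [i [j [ij Qi Qj]]] := two_terms P0 Px' x'0.
rewrite !coef_specialize in Qi Qj *.
have val l : (P`_l).[t] != 0 -> exists e, absv (P`_l).[t] = absv T ^+ e.
  move=> nz; have Pl0 : P`_l != 0 by apply: contraNneq nz => ->; rewrite horner0.
  have [e [al [kal al0 h]]] := trivial_leading (oP l) Pl0.
  exists e; rewrite -[_.[t]](subrK (al * T ^+ e)) absvDr absvM absvX (tk kal al0) mul1r//.
have [a aE] := val i Qi; have [b bE] := val j Qj.
rewrite aE bE x'x -(subnKC (ltnW ij)) exprD => E.
exists (j - i)%N, b, a; split; first by rewrite subn_gt0.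
apply: (mulfI (expf_neq0 i (lt0r_neq0 ax0))).
by rewrite [RHS]mulrC E; ring.
Qed.

(** An equation over [k(t)] for a point [x'] near [x], divided by the size of its largest
    coefficient, reduces to an equation [B] over [k]. As [B] splits over [k] and [|B(x')| < 1], some
    root is close to [x']. *)
Lemma trivial_residue x : absv x <= 1 -> exists2 d, k d & absv (x - d) < 1.
Proof.
move=> x1; have [x' [P [xx' oP P0 Px']]] := approx_root x Hk gen ltr01.
have x'1 : absv x' <= 1.
  by rewrite -[x'](subKr x); apply: absvD_le; rewrite ?absvN// ltW.
have Tp : 0 < absv T by rewrite absv_gt0.
pose Q := specialize t P.
have /choice[al alP] j : exists al : K, k al /\ (Q`_j != 0 -> al != 0 /\
    exists e, absv Q`_j = absv T ^+ e /\ absv (Q`_j - al * T ^+ e) < absv T ^+ e).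
  have [Qj|Qj] := eqVneq Q`_j 0.
    by exists 0; split; [exact: subfield0|].
  have Pj0 : P`_j != 0.
    by apply: contraNneq Qj; rewrite /Q coef_specialize => ->; rewrite horner0.
  have [e [al [kal al0 h]]] := trivial_leading (oP j) Pj0.
  exists al; split=> // _; split=> //; exists e; rewrite /Q coef_specialize; split=> //.
  by rewrite -[_.[t]](subrK (al * T ^+ e)) absvDr absvM absvX (tk kal al0) mul1r.
have sQ : (0 < size Q)%N by rewrite size_poly_gt0.
have [jm jmax] := fin_argmax (fun j : 'I_(size Q) => absv Q`_j) (Ordinal sQ).
have lt : ((size Q).-1 < size Q)%N by rewrite ltn_predL.
have M0 : 0 < absv Q`_jm.
  apply: lt_le_trans (jmax (Ordinal lt)).
  by rewrite /= absv_gt0 -lead_coefE lead_coef_eq0.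
have Qjm : Q`_jm != 0 by rewrite -absv_gt0.
have [_ /(_ Qjm)[aljm [em [emE _]]]] := alP jm.
pose B := \poly_(j < size Q) (if absv Q`_j == absv Q`_jm then al j else 0).
have oB : B \is a polyOver (mem k).
  apply/(overP Hk) => j; rewrite coef_poly; case: ifP => _; last exact: subfield0.
  by case: ifP => _; [have [] := alP j|exact: subfield0].
have Bjm : absv B`_jm = 1.
  by rewrite coef_poly ltn_ord eqxx tk//; have [] := alP jm.
have B0 : B != 0.
  by apply/eqP => B0; move: Bjm; rewrite B0 coef0 absv0 => /eqP; rewrite eq_sym oner_eq0.
have Bx' : absv B.[x'] < 1.
  rewrite -(ltr_pM2r M0) mul1r [X in _ * X < _]emE -absvX -absvM.
  have -> : B.[x'] * T ^+ em = B.[x'] * T ^+ em - Q.[x'] by rewrite (rootP Px') subr0.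
  rewrite (horner_coef_wide (n := size Q)) ?size_poly// (horner_coef Q) mulr_suml -sumrB.
  apply: absv_sum_lt => // j _.
  have -> : B`_j * x' ^+ j * T ^+ em - Q`_j * x' ^+ j =
    (B`_j * T ^+ em - Q`_j) * x' ^+ j by ring.
  rewrite absvM absvX; apply: (@le_lt_trans _ _ (absv (B`_j * T ^+ em - Q`_j))).
    by rewrite ler_piMr ?absv_ge0// exprn_ile1 ?absv_ge0.
  rewrite coef_poly ltn_ord; case: eqP => [Ej|/eqP nEj]; last first.
    by rewrite mul0r sub0r absvN lt_neqAle nEj jmax.
  have Qj : Q`_j != 0 by rewrite -absv_gt0 Ej.
  have [_ /(_ Qj)[_ [e [eE h]]]] := alP j.
  have TT : absv (T ^+ em) = absv (T ^+ e) by rewrite !absvX -emE -eE Ej.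
  (* Since [|T|] is not 1, coefficients of equal size have the same leading power of [T]. *)
  have [ee|nee] := eqVneq em e.
    by rewrite ee absvB -Ej eE.
  exfalso; move: TT; rewrite !absvX => /eqP.
  clear - nee T1 T0 Tp; wlog lte : em e nee / (em < e)%N.
    move=> W; have [lt|lt|E] := ltngtP em e; first exact: W.
      by rewrite eq_sym; apply: W; rewrite // eq_sym.
    by rewrite E eqxx in nee.
   move=> /eqP E; have /eqP : absv T ^+ (e - em) = 1 ^+ (e - em).
    apply: (mulfI (expf_neq0 em (lt0r_neq0 Tp))).
    by rewrite -exprD subnKC ?(ltnW lte)// expr1n mulr1.
  by rewrite eqrXn2 ?subn_gt0 ?absv_ge0 ?ler01// (negPf T1).
apply: contrapT => nod.
have far c : root B c -> 1 <= absv (x' - c).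
  move=> Bc; have kc : k c by exact: alg_closed_root oB B0 Bc.
  rewrite leNgt; apply/negP => x'c; apply: nod; exists c => //.
  exact: absv_dist_lt xx' x'c.
have := @gauss_le_roots _ _ B 1 1 x' ler01 (lexx 1) _ jm.
rewrite !expr1n Bjm !mul1r leNgt Bx' => /(_ _)/negP; apply=> // c Bc.
have kc : k c by exact: alg_closed_root oB B0 Bc.
rewrite mul1r ge_max far//=; apply: le_trans (far c Bc).
exact: (trivial_le1 tk kc).
Qed.

End Center.
End Trivial.

Lemma residue_pchar (R : realType) (k : valuedFieldType R) p :
  p \in [pchar (residue_field k)] -> prime p /\ absv (p%:R : k) < 1.
Proof.
rewrite inE => /andP[pp /eqP p0]; split=> //.
have /eqP : \pi_({ideal_quot (max_idealI k)})%qT (p%:R : integers k) =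
    \pi_({ideal_quot (max_idealI k)})%qT (0 : integers k).
  by rewrite rmorph_nat rmorph0; exact: p0.
rewrite -Quotient.idealrBE subr0.
have -> : ((p%:R : integers k) \in max_idealI k) = (absv (val (p%:R : integers k)) < 1) by [].
by rewrite rmorph_nat.
Qed.

(** * Order and radii of all intermediate fields *)

Section Intermediate.
Context {R : realType} {K : closedAnalyticFieldType R}.
Implicit Types (F E k : set K) (x y t z T : K).

Lemma dist_to_eq0 F t : closed_analytic F -> dist_to F t <= 0 -> F t.
Proof.
move=> [HF _ kF] d0; apply: kF; apply/completion_inP => e e0.
have F0 : F !=set0 by exists 0; exact: subfield0.
exact: dist_to_lt F0 (le_lt_trans d0 e0).
Qed.

Lemma adjoinS F E y : F `<=` E -> adjoin_elt F y `<=` adjoin_elt E y.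
Proof.
move=> FE; apply: adjoin_min; [exact: is_subfield_adjoin| |exact: mem_adjoin].
by move=> x /FE; exact: sub_adjoin.
Qed.

Lemma generatingS F E t : F `<=` E ->
  completion_in (alg_closure_in (adjoin_elt F t)) = [set: K] ->
  completion_in (alg_closure_in (adjoin_elt E t)) = [set: K].
Proof.
move=> FE gen; apply/seteqP; split=> // x _.
have := I : [set: K] x; rewrite -gen => /completion_inP Fx.
apply/completion_inP => e /Fx[z [q [q0 oq qz]] xz]; exists z => //.
by exists q; split=> //; exact: over_sub (adjoinS FE) oq.
Qed.

Lemma full_of_mem k F t : closed_analytic F -> k `<=` F -> F t ->
  completion_in (alg_closure_in (adjoin_elt k t)) = [set: K] -> F = [set: K].
Proof.
move=> GF kF Ft gen; apply/seteqP; split=> //; rewrite -gen.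
by apply: completed_closure_sub => //; case: GF => HF _ _; exact: adjoin_min.
Qed.

Lemma dist_to_shift F t c : is_subfield F -> F c -> dist_to F (t - c) = dist_to F t.
Proof.
move=> HF Fc; congr inf; apply/seteqP; split=> _ [d Fd <-].
  exists (d + c); first exact: subfieldD.
  by congr absv; ring.
exists (d - c); first exact: subfieldB.
by congr absv; ring.
Qed.

Section Fixed.
Variables (k : set K) (t : K).
Hypothesis Gk : closed_analytic k.
Hypothesis gen : completion_in (alg_closure_in (adjoin_elt k t)) = [set: K].
Hypothesis K_nt : nontrivial_val [set: K].

Let Hk : is_subfield k. Proof. by case: Gk. Qed.
Let k0 : k !=set0. Proof. by exists 0; exact: subfield0. Qed.

Lemma trivial_dist_center : trivial_val k -> 0 < dist_to k t ->
  exists c, [/\ k c, absv (t - c) != 1, t - c != 0 & dist_to k t = absv (t - c)].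
Proof.
move=> tk r0; have [c kc tc] := trivial_center Gk tk gen K_nt.
have E : dist_to k t = absv (t - c).
  by rewrite -(dist_to_shift t Hk kc) trivial_dist.
by exists c; split=> //; rewrite -absv_gt0 -E.
Qed.

(** By [trivial_residue] each [x] in [F] is at distance less than 1 from some [d] in [k]; in a
    trivially valued field this means [x = d]. *)
Lemma trivial_subset F : trivial_val k -> 0 < dist_to k t ->
  closed_analytic F -> k `<=` F -> trivial_val F -> F `<=` k.
Proof.
move=> tk r0 [HF _ _] kF tF x Fx.
have [c [kc tc1 tc0 _]] := trivial_dist_center tk r0.
have [d kd xd] := trivial_residue Gk tk gen kc tc1 tc0 (trivial_le1 tF Fx).
have [xd0|xd0] := eqVneq (x - d) 0; first by rewrite (subr0_eq xd0).
have Fxd : F (x - d) by apply: subfieldB => //; exact: kF.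
by move: xd; rewrite (tF _ Fxd xd0) ltxx.
Qed.

(** A relation between [|x|] and [|T|], together with roots in [F], yields [y] in [F] with
    [|y| = |T|]. The residue of [T / y] is that of some [d] in [k], so [c + y d] is closer to [t]
    than [c], which realises the distance to [k]. *)
Lemma nontrivial_dist_lt F : trivial_val k -> 0 < dist_to k t ->
  closed_analytic F -> k `<=` F -> nontrivial_val F ->
  dist_to F t < dist_to k t.
Proof.
move=> tk r0 [HF cF _] kF [x Fx /andP[x0 x1]].
have [c [kc T1 T0 rE]] := trivial_dist_center tk r0; set T := t - c in T1 T0 rE.
have [m [a [b [m0 xE]]]] := trivial_value Gk tk gen kc T1 T0 x0.
have Tp : 0 < absv T by rewrite absv_gt0.
have xp : 0 < absv x by rewrite absv_gt0.
have [y Fy yT] : exists2 y, F y & absv y = absv T.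
  have root_ n e : F e -> (0 < n)%N -> absv e = absv T ^+ n ->
      exists2 y, F y & absv y = absv T.
    move=> Fe n0 eE; have [y Fy yE] := closed_nth_root HF cF n0 Fe.
    exists y => //; apply/eqP; rewrite -(eqrXn2 n0) ?absv_ge0//.
    by rewrite -absvX yE eE.
  have [ab|ba|ab] := ltngtP a b.
  - apply: (root_ (b - a)%N (x ^+ m)); rewrite ?subn_gt0//; first exact: subfieldX.
    apply: (mulIf (expf_neq0 a (lt0r_neq0 Tp))).
    by rewrite absvX xE -exprD subnK// ltnW.
  - apply: (root_ (a - b)%N (x ^- m)); rewrite ?subn_gt0//.
      by apply: subfieldV => //; exact: subfieldX.
    rewrite absvV absvX; apply: (mulfI (expf_neq0 m (lt0r_neq0 xp))).
    rewrite mulfV ?expf_neq0 ?lt0r_neq0//.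
    apply: (mulIf (expf_neq0 b (lt0r_neq0 Tp))).
    by rewrite mul1r -mulrA -exprD subnK ?xE// ltnW.
  - exfalso; move: xE; rewrite ab -[RHS]mul1r => /(mulIf (expf_neq0 b (lt0r_neq0 Tp))).
    rewrite -(expr1n _ m) => /eqP; rewrite eqrXn2 ?absv_ge0 ?ler01//.
    exact/negP.
have y0 : y != 0 by rewrite -absv_gt0 yT.
have Ty1 : absv (T / y) <= 1 by rewrite absvM absvV yT mulfV ?gt_eqF.
have [d kd Tyd] := trivial_residue Gk tk gen kc T1 T0 Ty1.
have Fyd : F (y * d + c).
  by apply: subfieldD => //; [apply: subfieldM => //|]; exact: kF.
apply: le_lt_trans (dist_to_le t Fyd) _; rewrite rE.
have -> : t - (y * d + c) = y * (T / y - d).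
  by rewrite /T; field.
by rewrite absvM yT gtr_pMr.
Qed.

(** Radius 0 puts [t] in [F'], which is then everything. If [F'] is trivially valued it equals [k],
    and so does [F], because a nontrivially valued [F] would have a radius strictly below that of
    [k]. *)
Lemma subset_dist F F' : closed_analytic F -> closed_analytic F' ->
  k `<=` F -> k `<=` F' -> dist_to F' t <= dist_to F t -> F `<=` F'.
Proof.
move=> GF GF' kF kF' dd; have [d0|d0] := leP (dist_to F t) 0.
  have F't : F' t by apply: dist_to_eq0 => //; exact: le_trans dd d0.
  by rewrite (full_of_mem GF' kF' F't gen).
have [tF'|ntF'] := trivialP F'; last exact: subset_of_dist gen ntF' d0 dd.
have tk : trivial_val k by move=> d /kF'; exact: tF'.
have r0 : 0 < dist_to k t by apply: lt_le_trans d0 _; exact: dist_toS.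
have [tF|ntF] := trivialP F.
  by move=> x /(trivial_subset tk r0 GF kF tF)/kF'.
have F'k := trivial_subset tk r0 GF' kF' tF'.
have F'0 : F' !=set0 by have [x kx] := k0; exists x; exact: kF'.
have : dist_to F t < dist_to F t.
  apply: lt_le_trans (nontrivial_dist_lt tk r0 GF kF ntF) _.
  by apply: le_trans dd; exact: dist_toS.
by rewrite ltxx.
Qed.

Lemma dist_to_completion (J : Type) (F : J -> set K) : [set: J] !=set0 ->
  (forall i, k `<=` F i) ->
  dist_to (completion_in (\bigcup_i F i)) t =
    inf [set dist_to (F i) t | i in [set: J]].
Proof.
move=> [i0 _] kF; have Fi0 i : F i !=set0.
  by have [x kx] := k0; exists x; exact: kF.
have hinf : has_inf [set dist_to (F i) t | i in [set: J]].
  split; first by exists (dist_to (F i0) t), i0.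
  by exists 0 => _ [i _ <-]; exact: dist_to_ge0.
apply/eqP; rewrite eq_le; apply/andP; split.
  apply: lb_le_inf; first by case: hinf.
  move=> _ [i _ <-]; apply: dist_toS => // x Fx.
  by apply: sub_completion; exists i.
apply: dist_to_ge.
  by have [x Fx] := Fi0 i0; exists x; apply: sub_completion; exists i0.
move=> c /completion_inP Fc; rewrite leNgt; apply/negP => tc.
have [|x [i _ Fx] cx] := Fc (inf [set dist_to (F i) t | i in [set: J]]).
  by apply: le_lt_trans tc; exact: absv_ge0.
have : absv (t - x) < inf [set dist_to (F i) t | i in [set: J]].
  exact: absv_dist_lt tc cx.
apply/negP; rewrite -leNgt; apply: le_trans (dist_to_le t Fx).
by apply: ge_inf; [case: hinf|exists i].
Qed.

Variable p : nat.
Hypothesis p_prime : prime p.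
Hypothesis p_small : absv (p%:R : K) < 1.

(** For trivially valued [F], a translate [T] of [t] has [|T|] different from 1 and equal to its
    distance to [F]. If [|T| > 1], the inverse is used: for [|d| = |T|] one has
    [|T - d| = |T|^2 |1/T - 1/d|], whence [s' = s / |T|^2]. *)
Lemma between_dist F (s : R) : closed_analytic F -> k `<=` F ->
  0 < s < dist_to F t -> exists F', [/\ closed_analytic F', F `<=` F',
    s <= dist_to F' t & dist_to F' t < dist_to F t].
Proof.
move=> GF kF /andP[s0 sr]; have [HF _ _] := GF.
have r0 : 0 < dist_to F t by exact: lt_trans sr.
have [tF|ntF] := trivialP F; last first.
  by apply: (exists_between p_prime p_small GF); [rewrite s0|left].
have genF := generatingS kF gen.
have tk : trivial_val k by move=> d /kF; exact: tF.
have [c Fc T1] := trivial_center GF tF genF K_nt.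
set T := t - c in T1.
have shift E : is_subfield E -> F `<=` E -> dist_to E T = dist_to E t.
  by move=> HE FE; apply: dist_to_shift => //; exact: FE.
have FF : F `<=` F by [].
have rT : dist_to F T = absv T by rewrite trivial_dist.
rewrite -(shift F HF FF) in sr r0 *.
have [h|h|h] := ltgtP (absv T) 1; last by rewrite h eqxx in T1.
  have [||F' [GF' FF' sF' F'r]] := exists_between p_prime p_small (t := T) (s := s) GF.
  - by rewrite s0.
  - by right.
  by exists F'; rewrite -shift; [split|case: GF'|].
rewrite rT in sr r0 *.
have TV1 : absv T^-1 != 1 by rewrite absvV invr_eq1.
have TVlt : absv T^-1 < 1 by rewrite absvV invf_lt1.
have rTV : dist_to F T^-1 = absv T^-1 by rewrite trivial_dist.
pose s' := s / absv T ^+ 2.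
have T2 : 0 < absv T ^+ 2 by exact: exprn_gt0.
have T0 : T != 0 by rewrite -absv_gt0.
have [||F' [GF' FF' sF' F'r]] := exists_between p_prime p_small (t := T^-1) (s := s') GF.
- rewrite divr_gt0//= rTV absvV ltr_pdivrMr// expr2 mulrA mulVf ?gt_eqF//.
  by rewrite mul1r.
- by right.
have [HF' _ _] := GF'.
have F'0 : F' !=set0 by exists 0; exact: subfield0.
have inv_dist d : d != 0 -> absv d = absv T ->
    absv (T - d) = absv T ^+ 2 * absv (T^-1 - d^-1).
  move=> d0 dT; have -> : T - d = - (T * d * (T^-1 - d^-1)) by field; rewrite T0 d0.
  by rewrite absvN !absvM dT expr2.
exists F'; rewrite -shift//; split=> //.
  apply: dist_to_ge => // d F'd.
  have [dT|dT] := eqVneq (absv d) (absv T); last first.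
    apply: le_trans (ltW sr) _; have [lt|lt] := ltP (absv d) (absv T).
      by rewrite absvDl ?absvN.
    have {}lt : absv T < absv d by rewrite lt_neqAle eq_sym dT.
    by rewrite absvDr absvN// ltW.
  have d0 : d != 0 by rewrite -absv_gt0 dT.
  rewrite inv_dist// mulrC -ler_pdivrMr//; apply: le_trans sF' _.
  by apply: dist_to_le; exact: subfieldV.
rewrite rTV in F'r; have [d F'd Td] := dist_to_lt F'0 F'r.
have dT : absv d = absv T^-1.
  by rewrite -[d in LHS](subKr T^-1) absvDl// absvN.
have d0 : d != 0 by rewrite -absv_gt0 dT absv_gt0 invr_eq0.
have F'dV : F' d^-1 by exact: subfieldV.
apply: le_lt_trans (dist_to_le T F'dV) _.
rewrite inv_dist ?invr_eq0//; last by rewrite absvV dT absvV invrK.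
rewrite invrK expr2 -mulrA gtr_pMr// -(mulfV (lt0r_neq0 r0)).
by rewrite ltr_pM2l// -absvV.
Qed.

(** If the completed union [U] of the fields of radius at least [s] had radius above [s],
    [between_dist] would give a field of smaller radius than [U] belonging to the same family, hence
    contained in [U]. *)
Lemma exists_dist (s : R) : 0 <= s <= dist_to k t ->
  exists F, [/\ closed_analytic F, k `<=` F & dist_to F t = s].
Proof.
move=> /andP[s0 sr].
have GT : closed_analytic [set: K].
  split=> //; first by split=> [|x y _ _|x y _ _]; apply/mem_set.
  move=> q oq sq; have [x qx] := closed_rootP q sq; by exists x.
(* [between_dist] requires a positive lower bound; the radius 0 is that of [K]. *)
have [->|sn0] := eqVneq s 0.
  exists [set: K]; split=> //; apply/eqP; rewrite eq_le dist_to_ge0; last by exists 0.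
  by rewrite andbT (le_trans (@dist_to_le _ _ setT t t I))// subrr absv0.
have sp : 0 < s by rewrite lt_neqAle eq_sym sn0.
pose J := {F : set K | [/\ closed_analytic F, k `<=` F & s <= dist_to F t]}.
pose F (i : J) := sval i.
have FP (i : J) : [/\ closed_analytic (F i), k `<=` F i & s <= dist_to (F i) t].
  exact: svalP i.
have J0 : [set: J] !=set0.
  have kJ : [/\ closed_analytic k, k `<=` k & s <= dist_to k t] by split.
  by exists (exist _ k kJ).
pose U := completion_in (\bigcup_i F i).
have GF i : closed_analytic (F i) by have [] := FP i.
have kF i : k `<=` F i by have [] := FP i.
have GU : closed_analytic U.
  apply: closed_analytic_chain => // i j.
  have [d|/ltW d] := leP (dist_to (F j) t) (dist_to (F i) t).
    by left; exact: subset_dist.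
  by right; exact: subset_dist.
have UE : dist_to U t = inf [set dist_to (F i) t | i in [set: J]].
  exact: dist_to_completion.
have kU : k `<=` U.
  by move=> x kx; have [i _] := J0; apply: sub_completion; exists i => //; exact: kF.
have sU : s <= dist_to U t.
  rewrite UE; apply: lb_le_inf.
    by have [i _] := J0; exists (dist_to (F i) t), i.
  by move=> _ [i _ <-]; have [] := FP i.
exists U; split=> //; apply/eqP; rewrite eq_le sU andbT leNgt; apply/negP => sU'.
have [|F' [GF' UF' sF' F'U]] := between_dist GU kU (s := s).
  by rewrite sp.
have F'J : [/\ closed_analytic F', k `<=` F' & s <= dist_to F' t].
  by split=> // x /kU/UF'.
have F'sub : F' `<=` U.
  by move=> x F'x; apply: sub_completion; exists (exist _ F' F'J).
have F'0 : F' !=set0 by have [x /kU/UF'] := k0; exists x.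
by move: F'U; rewrite ltNge dist_toS.
Qed.

End Fixed.
End Intermediate.

(** * The image of the base field and the bijection *)

Section Base.
Context {R : realType} {k K : closedAnalyticFieldType R}.
Variable iota : {rmorphism k -> K}.

Lemma closed_analytic_range : isometric iota -> closed_analytic (range iota).
Proof.
move=> iso; split; last exact: isometric_closed.
  split=> [|x y /set_mem[a _ <-] /set_mem[b _ <-]|x y /set_mem[a _ <-] /set_mem[b _ <-]];
    apply/mem_set.
  - by exists 1; rewrite ?rmorph1.
  - by exists (a - b); rewrite ?rmorphB.
  - by exists (a / b); rewrite ?fmorph_div.
move=> p op sp; have /choice[c cP] i : exists c : k, iota c = p`_i.
  have [ilt|ige] := ltnP i (size p).
    by have /set_mem[c _ <-] := allP op p`_i (mem_nth 0 ilt); exists c.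
  by exists 0; rewrite rmorph0 nth_default.
have pE : p = map_poly iota (\poly_(i < size p) c i).
  apply/polyP => i; rewrite coef_map coef_poly /=.
  by case: ltnP => // ige; rewrite rmorph0 nth_default.
have [|x qx] := elimT (closed_rootP (\poly_(i < size p) c i)).
  by rewrite -(size_map_poly iota) -pE.
by exists (iota x); [exists x|rewrite pE fmorph_root].
Qed.

Lemma intermediateP F :
  intermediate iota F <-> closed_analytic F /\ range iota `<=` F.
Proof.
split=> [[HF kF cF /is_completeP cpl]|[[HF cF kF] sub]]; first by split.
by split=> //; exact/is_completeP.
Qed.

End Base.

Lemma value_group_nontrivial (R : realType) (K : closedAnalyticFieldType R) :
  value_group K <> [set 1] -> nontrivial_val [set: K].
Proof.
move=> K1; apply: contrapT => nt; apply: K1.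
have x1 (x : K) : x != 0 -> absv x = 1.
  by move=> x0; apply: contrapT => /eqP xn1; apply: nt; exists x; rewrite ?x0.
apply/seteqP; split=> [_ [x /x1 x1' <-] //|_ ->].
by exists 1; [exact: oner_neq0|exact: absv1].
Qed.

Theorem theorem3p1p13 (R : realType) (k K : closedAnalyticFieldType R)
    (iota : {rmorphism k -> K}) (iota_isometric : isometric iota)
    (trc1 : trc_is iota `I_1)
    (res_char : exists p : nat, p \in [pchar (residue_field k)])
    (K_nontrivial : value_group K <> [set 1])
    (t : K) (t_gen : completed_closure iota [set t] = [set: K]) :
  [/\ set_bij (intermediate iota) `[0, dist_to (range iota) t]
        (fun F => dist_to F t),
      forall F F' : set K, intermediate iota F -> intermediate iota F' ->
        (F `<=` F' <-> dist_to F t >= dist_to F' t)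
    & forall (J : Type) (F : J -> set K),
        [set: J] !=set0 -> (forall i, intermediate iota (F i)) ->
        let F' := \bigcap_i F i in
        let F'' := completion_in (\bigcup_i F i) in
        [/\ intermediate iota F', intermediate iota F'',
            dist_to F' t = sup [set dist_to (F i) t | i in [set: J]]
          & dist_to F'' t = inf [set dist_to (F i) t | i in [set: J]]]].
Proof.
have [p /residue_pchar[p_prime pk]] := res_char.
have p_small : absv (p%:R : K) < 1.
  by rewrite -(rmorph_nat iota) iota_isometric.
have K_nt := value_group_nontrivial K_nontrivial.
have Gk := closed_analytic_range iota_isometric.
have k0 : range iota !=set0 by exists (iota 0), 0.
have le_sub F F' : intermediate iota F -> intermediate iota F' ->
    (F `<=` F' <-> dist_to F t >= dist_to F' t).
  move=> /intermediateP[GF kF] /intermediateP[GF' kF']; split.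
    by apply: dist_toS; have [x kx] := k0; exists x; exact: kF.
  exact: (subset_dist Gk t_gen K_nt).
have surj s : 0 <= s <= dist_to (range iota) t ->
    exists2 F, intermediate iota F & dist_to F t = s.
  move=> /(exists_dist Gk t_gen K_nt p_prime p_small)[F [GF kF Fs]].
  by exists F => //; apply/intermediateP.
have bounds F : intermediate iota F -> 0 <= dist_to F t <= dist_to (range iota) t.
  move=> /intermediateP[GF kF]; rewrite dist_toS// andbT dist_to_ge0//.
  by have [x kx] := k0; exists x; exact: kF.
split=> //.
  split.
  - by move=> F /bounds; rewrite /= in_itv.
  - move=> F F' /set_mem IF /set_mem IF' E; apply/seteqP.
    by split; apply/le_sub => //; rewrite E.
  - by move=> s; rewrite /= in_itv /= => /surj[F IF Fs]; exists F.
move=> J F J0 IF F' F''.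
have GF i : closed_analytic (F i) by have /intermediateP[] := IF i.
have kF i : range iota `<=` F i by have /intermediateP[] := IF i.
have IF' : intermediate iota F'.
  apply/intermediateP; split; first exact: closed_analytic_bigcap.
  by move=> x kx i _; exact: kF.
have IF'' : intermediate iota F''.
  apply/intermediateP; split.
    apply: closed_analytic_chain => // i j.
    have [d|/ltW d] := leP (dist_to (F j) t) (dist_to (F i) t).
      by left; apply/le_sub.
    by right; apply/le_sub.
  have [i _] := J0; move=> x kx; apply: sub_completion; exists i => //.
  exact: kF.
split=> //; last exact: (dist_to_completion t Gk J0 kF).
set D := [set dist_to (F i) t | i in [set: J]].
have supD : has_sup D.
  split; first by have [i _] := J0; exists (dist_to (F i) t), i.
  exists (dist_to (range iota) t) => _ [i _ <-].
  by have /andP[] := bounds _ (IF i).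
have leD i : dist_to (F i) t <= sup D by apply: ub_le_sup; [case: supD|exists i].
apply/eqP; rewrite eq_le; apply/andP; split; last first.
  apply: ge_sup; first by case: supD.
  by move=> _ [i _ <-]; apply/le_sub => // x; apply.
(* The intersection has no direct estimate; surjectivity supplies a field [G] of radius [sup D],
   which by the order lies in every [F i], hence in the intersection. *)
have [|G IG Gs] := surj (sup D).
  have [i _] := J0; have /andP[d0 _] := bounds _ (IF i).
  rewrite (le_trans d0)//=; apply: ge_sup; first by case: supD.
  by move=> _ [j _ <-]; have /andP[] := bounds _ (IF j).
rewrite -Gs; apply/le_sub => // x Gx i _.
have GFi : dist_to (F i) t <= dist_to G t by rewrite Gs.
exact: (le_sub _ _ IG (IF i)).2 GFi x Gx.
Qed.
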